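(* Let $0<Q<n$, let $E\subset\mathbb{R}^n$ be a compact Ahlfors $Q$-regular set with $\operatorname{diam}(E)\le 1$, let $B\subset\mathbb{R}^n$ be a ball with $E\subset\tfrac12 B$, and let $\nu=\mathcal{H}^Q|_E$. Let $p>1$ and $0<\theta<1$. Fix $\alpha\le 0$ such that $\alpha+n-Q>0$ and $\theta\ge 1-\tfrac{\alpha+n-Q}{p}$. Let $\mu_\alpha$ be a measure on $\mathbb{R}^n$, absolutely continuous with respect to Lebesgue measure and doubling on $B$, with $\mu_\alpha(B(x,r))\simeq r^{n+\alpha}$ for all $x\in E$ and $0<r\le 10$. Then there are a constant $C\ge 1$ and a linear extension operator \[ S:B^\theta_{p,p}(E,\nu)\to N^{1,p}(B,\mu_\alpha) \] such that for all $u\in B^\theta_{p,p}(E,\nu)$ \[ \int_B|\nabla Su|^p\,d\mu_\alpha\le C\,\|u\|_{B^\theta_{p,p}(E,\nu)}^p,\qquad \int_B|Su|^p\,d\mu_\alpha\le C\int_E|u|^p\,d\nu . \] Moreover, if $u$ is $L$-Lipschitz on $E$, then $Su$ is $CL$-Lipschitz on $B$.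
   Context: Notation: $m$ is Lebesgue measure on $\mathbb{R}^n$, $d$ the Euclidean metric, $\mathcal{H}^Q$ the $Q$-dimensional Hausdorff measure, $\tau B$ the ball concentric with $B$ with radius $\tau$ times as large. $F\simeq G$ means $C^{-1}G\le F\le CG$ with a constant $C\ge1$ independent of the points and radii involved. $E$ is Ahlfors $Q$-regular if $\mathcal{H}^Q(E\cap B(x,r))\simeq r^Q$ for all $x\in E$ and $0<r\le\operatorname{diam}(E)$. The measure $\mu_\alpha$ is a Borel regular measure of the form $d\mu_\alpha=\omega\,dm$ with $\omega\ge 0$ locally integrable. Doubling on $B$: there is $C\ge1$ with $\mu_\alpha(B(x,2r))\le C\mu_\alpha(B(x,r))$ for all $x\in B$, $0<r\le 10$ (balls being taken in the space $B$ with the Euclidean metric, i.e. intersected with $B$). Weighted Sobolev space: $N^{1,p}(B,\mu_\alpha)=W^{1,p}(B,\mu_\alpha)$ consists of the functions $f\in L^p(B,\mu_\alpha)$ having a weak derivative $\nabla f:B\to\mathbb{R}^n$ with $|\nabla f|\in L^p(B,\mu_\alpha)$, with norm $\|f\|_{L^p(B,\mu_\alpha)}+\||\nabla f|\|_{L^p(B,\mu_\alpha)}$. Besov space: $B^\theta_{p,p}(E,\nu)$ consists of the $u\in L^p(E,\nu)$ with \[ \|u\|_{B^\theta_{p,p}(E,\nu)}^p=\int_E\int_E\frac{|u(y)-u(x)|^p}{d(x,y)^{\theta p}\,\nu(B(x,d(x,y)))}\,d\nu(y)\,d\nu(x)<\infty . \] ''Extension operator'' means that $Su|_E=u$ whenever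 $u$ is a Lipschitz function on $E$ (with $Su$ the Lipschitz representative on $B$).
   Formalization: E is assumed not to be a single point: for a singleton, regularity with 0<r≤diam(E)=0 is vacuous and ν=0, so for u=1 the bound ∫_B|Su|^p dμ_α ≤ C∫_E|u|^p dν forces Su=0, contradicting Su=u on E. *)

(* Defs.v *)
From HB Require Import structures.
From mathcomp Require Import all_boot all_order all_algebra.
From mathcomp Require Import all_classical all_reals all_analysis.
From mathcomp Require Import measurable_realfun ring.

(* Points of R^n are row vectors 'rV[R]_n over R : realType. The library norm
   `|_| and `ball` on 'rV[R]_n are those of the sup norm; they induce the same
   topology as the Euclidean metric (so open, compact, continuous and derivable
   are used as they are), but all metric notions below use enorm and eball. *)

Set Implicit Arguments.
Unset Strict Implicit.
Unset Printing Implicit Defensive.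

Import Order.TTheory GRing.Theory Num.Theory.
Import numFieldNormedType.Exports.

Local Open Scope classical_set_scope.
Local Open Scope ring_scope.

HB.instance Definition _ (R : realType) (m n : nat) :=
  @isMeasurable.Build (sigma_display (@open 'M[R]_(m, n))) 'M[R]_(m, n)
    <<s (@open 'M[R]_(m, n)) >> (@sigma_algebra0 _ setT _)
    (@sigma_algebraC _ _) (@sigma_algebra_bigcup _ setT _).

Lemma open_measurable_rV (R : realType) (n : nat) (A : set 'rV[R]_n) :
  open A -> measurable A.
Proof. exact: sub_sigma_algebra. Qed.

Lemma closed_measurable_rV (R : realType) (n : nat) (A : set 'rV[R]_n) :
  closed A -> measurable A.
Proof.
move=> cA; rewrite -(setCK A); apply: measurableC.
by apply: open_measurable_rV; exact: closed_openC.
Qed.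

Lemma compact_measurable_rV (R : realType) (n : nat) (A : set 'rV[R]_n) :
  compact A -> measurable A.
Proof.
move=> cA; apply: closed_measurable_rV; apply: compact_closed cA.
exact: norm_hausdorff.
Qed.

Lemma measurable_fun_rV (R : realType) (n : nat) d (T : measurableType d)
    (f : T -> 'rV[R]_n) :
  (forall i, measurable_fun [set: T] (fun t => f t 0 i)) ->
  measurable_fun [set: T] f.
Proof.
move=> mf.
apply: (@measurability _ _ _ _ _ _ (@open 'rV[R]_n)) => // _ [U oU <-].
rewrite setTI.
pose c (qk : 'rV[rat]_n * nat) : set T :=
  [set t | forall i, `|f t 0 i - ratr (qk.1 0 i)| < qk.2.+1%:R^-1].
pose P (qk : 'rV[rat]_n * nat) : set T :=
  if `[< c qk `<=` f @^-1` U >] then c qk else set0.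
have -> : f @^-1` U = \bigcup_(qk in setT) P qk.
  apply/seteqP; split=> [t Ut|t [qk _]]; last first.
    by rewrite /P; case: asboolP => // cU ct; exact: cU.
  have /nbhs_ballP[e /= e0 eU] : nbhs (f t) U by exact: open_nbhs_nbhs.
  have [k ke] : exists k : nat, (k.+1%:R^-1 : R) < e / 2.
    exists (Num.truncn (e / 2)^-1); rewrite invf_plt ?posrE ?divr_gt0//.
    exact: truncnS_gt.
  have ex i : {q : rat | `|f t 0 i - ratr q| < k.+1%:R^-1}.
    apply/cid.
    have [|q] := @rat_in_itvoo R (f t 0 i - k.+1%:R^-1) (f t 0 i + k.+1%:R^-1).
      by rewrite ltrD2l (@lt_trans _ _ 0) ?oppr_lt0 ?invr_gt0.
    rewrite in_itv/= => q1; exists q.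
    by rewrite distrC ltr_distl.
  exists (\row_i sval (ex i), k) => //.
  have ct : c (\row_i sval (ex i), k) t.
    by move=> i /=; rewrite mxE; case: (ex i).
  rewrite /P; case: asboolP => // -[] s cs; apply: eU.
  split => // i j; rewrite !ord1 /ball/=.
  have := ct j; have := cs j => /= h1 h2.
  rewrite (le_lt_trans (ler_distD (ratr ((\row_i sval (ex i)) 0 j)) _ _))//.
  rewrite [ltRHS](splitr e) ltrD// ?(lt_trans _ ke)//.
  by rewrite distrC.
apply: countable_bigcupT_measurable => [|qk]; first exact: countableP.
rewrite /P; case: asboolP => // _.
rewrite [X in measurable X](_ : _ = \bigcap_(i in [set: 'I_n])
  [set t | `|f t 0 i - ratr (qk.1 0 i)| < qk.2.+1%:R^-1]); last first.
  by apply/seteqP; split => [t ct i _|t ct i]; [exact: ct|exact: ct].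
apply: fin_bigcap_measurable => // i _.
rewrite -[X in measurable X]setTI.
rewrite [X in _ `&` X](_ : _ =
  (fun t => `|f t 0 i - ratr (qk.1 0 i)|) @^-1` `]-oo, qk.2.+1%:R^-1[%classic).
  apply: measurableT_comp => //; apply: measurable_funB => //.
by apply/seteqP; split => t /=; rewrite in_itv.
Qed.

Definition rV_cons (R : realType) (n : nat) (tv : R * 'rV[R]_n) : 'rV[R]_n.+1 :=
  row_mx tv.1%:M tv.2.

Lemma measurable_coord (R : realType) (n : nat) (i : 'I_n) :
  measurable_fun [set: 'rV[R]_n] (fun v => v 0 i).
Proof.
apply: (measurability _ (RGenOpens.measurableE R)).
move=> _ [_ [a [b ->]] <-]; rewrite setTI; apply: open_measurable_rV.
by apply: open_comp => [v _|]; [exact: coord_continuous|exact: interval_open].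
Qed.

Lemma measurable_rV_cons (R : realType) (n : nat) :
  measurable_fun [set: R * 'rV[R]_n] (@rV_cons R n).
Proof.
apply: measurable_fun_rV => i.
rewrite (_ : (fun t => _) = fun t : R * 'rV[R]_n =>
  match fintype.split (i : 'I_(1 + n)) with inl _ => t.1 | inr k => t.2 0 k end).
  case: fintype.split => k; first exact: measurable_fst.
  by apply: (measurableT_comp (@measurable_coord R n k)); exact: measurable_snd.
apply/funext => t; rewrite /rV_cons /row_mx mxE.
by case: fintype.split => k //; rewrite mxE ord1 eqxx.
Qed.

Section leb.
Variables (R : realType) (n : nat).
Variable m : {sigma_finite_measure set 'rV[R]_n -> \bar R}.

Definition lebesgue_cons : set 'rV[R]_n.+1 -> \bar R :=
  pushforward (@lebesgue_measure R \x m)%E (@rV_cons R n).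

HB.instance Definition _ := Measure.copy lebesgue_cons
  (measure_function_pushforward__canonical__measure_function_Measure
    (@lebesgue_measure R \x m)%E (@measurable_rV_cons R n)).

Let lebesgue_cons_sigma_finite : sigma_finite [set: 'rV[R]_n.+1] lebesgue_cons.
Proof.
have /sigma_finiteP[F [FT ndF Foo]] := sigma_finiteT (@lebesgue_measure R).
have /sigma_finiteP[G [GT ndG Goo]] := sigma_finiteT m.
pose u (v : 'rV[R]_(1 + n)) : R * 'rV[R]_n := (v 0 0, rsubmx v).
have mu : measurable_fun [set: 'rV[R]_n.+1] u.
  apply: measurable_fun_pair; first exact: measurable_coord.
  apply: measurable_fun_rV => i.
  rewrite (_ : (fun t => _) = fun t : 'rV[R]_(1 + n) => t 0 (rshift 1 i)).
    exact: (@measurable_coord R (1 + n)).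
  by apply/funext => t; rewrite mxE.
exists (fun k => u @^-1` (F k `*` G k)).
  apply/esym; rewrite -subTset => v _.
  have : (\bigcup_k F k) (u v).1 by rewrite -FT.
  have : (\bigcup_k G k) (u v).2 by rewrite -GT.
  move=> [i _ Gi] [j _ Fj]; exists (maxn i j) => //; split.
    by move: Fj; exact/subsetPset/ndF/leq_maxr.
  by move: Gi; exact/subsetPset/ndG/leq_maxl.
move=> k; have [mFk Fkoo] := Foo k; have [mGk Gkoo] := Goo k; split.
  by rewrite -[X in measurable X]setTI; apply: mu => //; exact: measurableX.
rewrite /lebesgue_cons /pushforward -comp_preimage.
suff -> : u \o @rV_cons R n = id.
  by rewrite preimage_id product_measure1E// lte_mul_pinfty// ge0_fin_numE.
apply/funext => -[t v]; rewrite /u /rV_cons/= row_mxKr; congr (_, _).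
rewrite /row_mx mxE; case: fintype.splitP => // j _.
by rewrite mxE !ord1 eqxx.
Qed.

HB.instance Definition _ := @Measure_isSigmaFinite.Build _ _ _ lebesgue_cons
  lebesgue_cons_sigma_finite.

End leb.

(* Iterated product of the one-dimensional Lebesgue measure. *)
Fixpoint lebesgue_rV (R : realType) (n : nat) :
    {sigma_finite_measure set 'rV[R]_n -> \bar R} :=
  match n with
  | 0 => \d_(0 : 'rV[R]_0)
  | n'.+1 => lebesgue_cons (lebesgue_rV R n')
  end.

Definition enorm (R : realType) (n : nat) (v : 'rV[R]_n) : R :=
  Num.sqrt (\sum_(i < n) v 0 i ^+ 2).

Definition eball (R : realType) (n : nat) (x : 'rV[R]_n) (r : R) :
    set 'rV[R]_n :=
  [set y | enorm (x - y) < r].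

(* The 0 makes the diameter of the empty set 0 instead of -oo. *)
Definition diam (R : realType) (n : nat) (A : set 'rV[R]_n) : \bar R :=
  maxe 0%E (ereal_sup [set (enorm (x - y))%:E | x in A & y in A]).

Section enorm_theory.
Variables (R : realType) (n : nat).
Implicit Types u v w : 'rV[R]_n.

Lemma enorm_ge0 v : 0 <= enorm v.
Proof. exact: sqrtr_ge0. Qed.

Lemma enorm_sqr v : enorm v ^+ 2 = \sum_(i < n) v 0 i ^+ 2.
Proof. by rewrite sqr_sqrtr// sumr_ge0// => i _; rewrite sqr_ge0. Qed.

Lemma enormN v : enorm (- v) = enorm v.
Proof. by congr Num.sqrt; apply: eq_bigr => i _; rewrite mxE sqrrN. Qed.

Lemma enormC u v : enorm (u - v) = enorm (v - u).
Proof. by rewrite -enormN opprB. Qed.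

Lemma enorm_dot u v : \sum_(i < n) u 0 i * v 0 i <= enorm u * enorm v.
Proof.
set s := \sum_(i < n) _.
have [s0|s0] := leP s 0; first by rewrite (le_trans s0)// mulr_ge0 ?enorm_ge0.
have t0 i : 0 <= (enorm v ^+ 2 * u 0 i - s * v 0 i) ^+ 2 by rewrite sqr_ge0.
have [v0|v0] := eqVneq (enorm v) 0.
  have vi i : v 0 i = 0.
    have : \sum_(i < n) v 0 i ^+ 2 == 0 by rewrite -enorm_sqr v0 expr0n.
    rewrite psumr_eq0 => [/allP/(_ i)|k _]; last by rewrite sqr_ge0.
    by rewrite mem_index_enum sqrf_eq0 => /(_ isT)/eqP.
  by move: s0; rewrite /s big1 ?ltxx// => i _; rewrite vi mulr0.
have : 0 <= \sum_(i < n) (enorm v ^+ 2 * u 0 i - s * v 0 i) ^+ 2.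
  by rewrite sumr_ge0.
have -> : \sum_(i < n) (enorm v ^+ 2 * u 0 i - s * v 0 i) ^+ 2 =
    enorm v ^+ 2 * (enorm u ^+ 2 * enorm v ^+ 2 - s ^+ 2).
  transitivity (\sum_(i < n) ((enorm v ^+ 4 * u 0 i ^+ 2 +
     s ^+ 2 * v 0 i ^+ 2) - 2 * enorm v ^+ 2 * s * (u 0 i * v 0 i))).
    by apply: eq_bigr => i _; ring.
  rewrite sumrB big_split/= -!mulr_sumr -!enorm_sqr -/s; ring.
rewrite pmulr_rge0 ?exprn_gt0// ?lt_def ?v0 ?enorm_ge0//.
rewrite subr_ge0 -exprMn ler_pXn2r// ?nnegrE ?mulr_ge0 ?enorm_ge0// ltW//.
Qed.

Lemma ler_enormD u v : enorm (u + v) <= enorm u + enorm v.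
Proof.
rewrite -(@ler_pXn2r _ 2)// ?nnegrE ?addr_ge0 ?enorm_ge0//.
rewrite sqrrD !enorm_sqr.
under eq_bigr do rewrite mxE sqrrD.
rewrite !big_split/= lerD2r lerD2l mulr2n.
by rewrite lerD ?enorm_dot.
Qed.

Lemma enorm_distD u v w : enorm (v - w) <= enorm (v - u) + enorm (u - w).
Proof. by rewrite (le_trans _ (ler_enormD _ _))// addrA subrK. Qed.

Lemma ler_norm_enorm v : `|v| <= enorm v.
Proof.
rewrite [leLHS]/Num.norm/= mx_normrE; apply/bigmax_leP; split=> [|[i j] _ /=].
  exact: enorm_ge0.
rewrite ord1 -sqrtr_sqr ler_wsqrtr// (bigD1 j)//= lerDl sumr_ge0// => k _.
by rewrite sqr_ge0.
Qed.

End enorm_theory.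

(* diam(U)^Q, with the convention that the empty set contributes 0 (for Q = 0,
   diam(set0)^0 would be 1). The measure is not normalized: a constant factor
   c(Q) would not affect any of the statements below. *)
Definition hausdorff_gauge (R : realType) (n : nat) (Q : R)
    (U : set 'rV[R]_n) : \bar R :=
  if U == set0 then 0%E else (diam U `^ Q)%E.

Definition hausdorff_pre (R : realType) (n : nat) (Q delta : R)
    (A : set 'rV[R]_n) : \bar R :=
  ereal_inf [set (\sum_(k <oo) hausdorff_gauge Q (U k))%E | U in
    [set U : (set 'rV[R]_n)^nat |
      A `<=` \bigcup_k U k /\ forall k, (diam (U k) <= delta%:E)%E]].

Definition hausdorff_outer (R : realType) (n : nat) (Q : R)
    (A : set 'rV[R]_n) : \bar R :=
  ereal_sup [set hausdorff_pre Q delta A | delta in [set delta : R | 0 < delta]].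

Section hausdorff_theory.
Local Open Scope ereal_scope.
Variables (R : realType) (n : nat) (Q : R).
Implicit Types A B X F : set 'rV[R]_n.

Lemma diam0 : @diam R n set0 = 0.
Proof.
rewrite /diam (_ : [set _ | _ in _ & _ in _] = set0).
  by rewrite ereal_sup0 maxEle leNgt ltNy0/=.
by apply/seteqP; split=> // _ [? []].
Qed.

Lemma diam_ge0 A : 0 <= diam A.
Proof. by rewrite /diam le_max lexx. Qed.

Lemma diam_ub A x y : A x -> A y -> (enorm (x - y))%:E <= diam A.
Proof.
move=> Ax Ay; rewrite /diam le_max; apply/orP; right.
by apply: ereal_sup_ubound; exists x => //; exists y.
Qed.

Lemma hausdorff_gauge0 : @hausdorff_gauge R n Q set0 = 0.
Proof. by rewrite /hausdorff_gauge eqxx. Qed.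

Lemma hausdorff_gauge_ge0 A : 0 <= hausdorff_gauge Q A.
Proof. by rewrite /hausdorff_gauge; case: ifP => // _; exact: poweR_ge0. Qed.

Hint Resolve hausdorff_gauge_ge0 : core.

Section fixed_scale.
Variable delta : R.

Let T := g_sigma_algebraType [set: set 'rV[R]_n].

Let g (A : set T) : \bar R :=
  if diam A <= delta%:E then hausdorff_gauge Q A else +oo.

Let g_ge0 A : 0 <= g A.
Proof. by rewrite /g; case: ifP => // _; rewrite leey. Qed.

Let hausdorff_preE A : hausdorff_pre Q delta A = @mu_ext _ T R g A.
Proof.
rewrite /hausdorff_pre /mu_ext; apply/eqP; rewrite eq_le; apply/andP; split.
  apply: le_ereal_inf_tmp => _ [F [mF AF] <-].
  have [Fd|/existsNP[k Fk]] := pselect (forall k, diam (F k) <= delta%:E).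
    apply: ereal_inf_lbound; exists F => //.
    by apply: eq_eseriesr => k _; rewrite /g Fd.
  rewrite (@eseries_pinfty _ (fun k => g (F k)) xpredT k) ?leey//.
    by move=> j _; rewrite gt_eqF// (lt_le_trans _ (g_ge0 _)).
  by rewrite /g; case: ifP.
apply: le_ereal_inf_tmp => _ [F [AF Fd] <-].
apply: ereal_inf_lbound; exists F; last first.
  by apply: eq_eseriesr => k _; rewrite /g Fd.
by split => // k; exact: sub_sigma_algebra.
Qed.

Lemma hausdorff_pre_ge0 A : 0 <= hausdorff_pre Q delta A.
Proof. by rewrite hausdorff_preE; exact: mu_ext_ge0. Qed.

Lemma le_hausdorff_pre A B : A `<=` B ->
  hausdorff_pre Q delta A <= hausdorff_pre Q delta B.
Proof. by move=> AB; rewrite !hausdorff_preE; exact: le_mu_ext. Qed.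

Lemma hausdorff_pre_sigma_subadditive :
  sigma_subadditive (@hausdorff_pre R n Q delta).
Proof.
have -> : @hausdorff_pre R n Q delta = @mu_ext _ T R g.
  by apply/funext => A; exact: hausdorff_preE.
exact: (@mu_ext_sigma_subadditive _ T R g g_ge0).
Qed.

Lemma hausdorff_pre0 : (0 <= delta)%R -> @hausdorff_pre R n Q delta set0 = 0.
Proof.
move=> d0; rewrite hausdorff_preE; apply: mu_ext0 => //.
by rewrite /g diam0 lee_fin d0 hausdorff_gauge0.
Qed.

End fixed_scale.

Lemma le_hausdorff_pre_scale (d1 d2 : R) A : (d1 <= d2)%R ->
  hausdorff_pre Q d2 A <= hausdorff_pre Q d1 A.
Proof.
move=> d12; apply: le_ereal_inf_tmp => _ [F [AF Fd] <-].
apply: ereal_inf_lbound; exists F => //; split => // k.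
by rewrite (le_trans (Fd k))// lee_fin.
Qed.

Lemma hausdorff_pre_outer delta A : (0 < delta)%R ->
  hausdorff_pre Q delta A <= hausdorff_outer Q A.
Proof. by move=> d0; apply: ereal_sup_ubound; exists delta. Qed.

Let hausdorff_outer0 : @hausdorff_outer R n Q set0 = 0.
Proof.
apply/eqP; rewrite eq_le; apply/andP; split.
  by apply: ge_ereal_sup => _ [d /= d0 <-]; rewrite hausdorff_pre0// ltW.
rewrite -(@hausdorff_pre0 1)//; exact: hausdorff_pre_outer.
Qed.

Let hausdorff_outer_ge0 A : 0 <= hausdorff_outer Q A.
Proof.
exact: le_trans (hausdorff_pre_ge0 1 A) (hausdorff_pre_outer _ _).
Qed.

Let le_hausdorff_outer :
  {homo @hausdorff_outer R n Q : A B / A `<=` B >-> A <= B}.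
Proof.
move=> A B AB; apply: ge_ereal_sup => _ [d /= d0 <-].
exact: le_trans (le_hausdorff_pre d AB) (hausdorff_pre_outer _ _).
Qed.

Let hausdorff_outer_sigma_subadditive :
  sigma_subadditive (@hausdorff_outer R n Q).
Proof.
move=> F; apply: ge_ereal_sup => _ [d /= d0 <-].
apply: (le_trans (hausdorff_pre_sigma_subadditive d F)).
apply: lee_nneseries => [k _ _|k _]; first exact: hausdorff_pre_ge0.
exact: hausdorff_pre_outer.
Qed.

HB.instance Definition _ := isOuterMeasure.Build R 'rV[R]_n
  (@hausdorff_outer R n Q) hausdorff_outer0 hausdorff_outer_ge0
  le_hausdorff_outer hausdorff_outer_sigma_subadditive.

Lemma hausdorff_outer_separated (e : R) A B : (0 < e)%R ->
  (forall x y, A x -> B y -> (e <= enorm (x - y))%R) ->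
  hausdorff_outer Q A + hausdorff_outer Q B <= hausdorff_outer Q (A `|` B).
Proof.
move=> e0 AB.
have key d : (0 < d)%R -> (d < e)%R ->
    hausdorff_pre Q d A + hausdorff_pre Q d B <= hausdorff_pre Q d (A `|` B).
  move=> d0 de; apply: le_ereal_inf_tmp => _ [U [ABU Ud] <-].
  pose V (C : set 'rV[R]_n) k := if `[< U k `&` C !=set0 >] then U k else set0.
  have VC C : C `<=` A `|` B ->
      hausdorff_pre Q d C <= \sum_(k <oo) hausdorff_gauge Q (V C k).
    move=> CAB; apply: ereal_inf_lbound; exists (V C) => //; split.
      move=> x Cx; have [k _ Ux] := ABU _ (CAB _ Cx).
      by exists k => //; rewrite /V; case: asboolP => // -[]; exists x.
    move=> k; rewrite /V; case: asboolP => // _.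
    by rewrite diam0 lee_fin ltW.
  apply: (le_trans (leeD (VC A (@subsetUl _ _ _)) (VC B (@subsetUr _ _ _)))).
  rewrite -nneseriesD//; [|by move=> *; exact: hausdorff_gauge_ge0..].
  apply: lee_nneseries => [k _ _|k _]; first by rewrite adde_ge0.
  rewrite /V; case: asboolP => [[x [Ux Ax]]|_]; case: asboolP => [[y [Uy By]]|_];
    rewrite ?hausdorff_gauge0 ?adde0 ?add0e//.
  have := le_trans (diam_ub Ux Uy) (Ud k).
  by rewrite lee_fin leNgt (lt_le_trans de)// AB.
have [->|ABoo] := eqVneq (hausdorff_outer Q (A `|` B)) +oo; first by rewrite leey.
have ABfin : hausdorff_outer Q (A `|` B) < +oo by rewrite ltey.
have Afin : hausdorff_outer Q A \is a fin_num.
  by rewrite ge0_fin_numE// (le_lt_trans _ ABfin)// le_hausdorff_outer.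
have Bfin : hausdorff_outer Q B \is a fin_num.
  by rewrite ge0_fin_numE// (le_lt_trans _ ABfin)// le_hausdorff_outer.
rewrite -leeBrDr//; apply: ge_ereal_sup => _ [d1 /= d10 <-].
have A1fin : hausdorff_pre Q d1 A \is a fin_num.
  rewrite ge0_fin_numE ?hausdorff_pre_ge0//.
  by rewrite (le_lt_trans (hausdorff_pre_outer _ d10))// -ge0_fin_numE.
rewrite leeBrDr// -leeBrDl//; apply: ge_ereal_sup => _ [d2 /= d20 <-].
rewrite leeBrDl//.
pose d := Num.min (Num.min d1 d2) (e / 2)%R.
have d0 : (0 < d)%R by rewrite !lt_min d10 d20 divr_gt0.
have de : (d < e)%R.
  rewrite /d gt_min; apply/orP; right; by rewrite ltr_pdivrMr// ltr_pMr// ltr1n.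
apply: (le_trans _ (hausdorff_pre_outer _ d0)).
apply: (le_trans _ (key _ d0 de)).
by apply: leeD; apply: le_hausdorff_pre_scale; rewrite !ge_min lexx ?orbT.
Qed.

End hausdorff_theory.

Section hausdorff_borel.
Local Open Scope ereal_scope.
Variables (R : realType) (n : nat) (Q : R).
Implicit Types A B X F : set 'rV[R]_n.

Local Notation H := (@hausdorff_outer R n Q).

Let H_ge0 A : 0 <= H A. Proof. exact: outer_measure_ge0. Qed.
Let le_H A B : A `<=` B -> H A <= H B. Proof. exact: le_outer_measure. Qed.

Lemma closed_hausdorff_caratheodory F : closed F -> H.-caratheodory F.
Proof.
move=> cF; apply: le_caratheodory_measurable => X.
change (H (X `&` F) + H (X `&` ~` F) <= H X).
have [->|Xoo] := eqVneq (H X) +oo; first by rewrite leey.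
pose Y k : set 'rV[R]_n :=
  X `&` [set x | forall y, F y -> (k.+1%:R^-1 <= enorm (x - y))%R].
pose A k := Y k.+1 `\` Y k.
have YX k : Y k `<=` X by move=> x [].
have Yle : {homo Y : j k / (j <= k)%N >-> j `<=` k}.
  move=> j k jk x [Xx Yx]; split => // y Fy.
  by rewrite (le_trans _ (Yx _ Fy))// lef_pV2 ?posrE// ler_nat.
have sepF k : H (X `&` F) + H (Y k) <= H X.
  apply: (@le_trans _ _ (H (X `&` F `|` Y k))); last first.
    by apply: le_H; rewrite subUset; split => // x [].
  apply: (@hausdorff_outer_separated _ _ _ k.+1%:R^-1%R) => // x y [_ Fx] [_].
  by move=> /(_ _ Fx); rewrite enormC.
have sepA k : H (Y k) + H (A k.+1) <= H (Y k.+2).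
  apply: (@le_trans _ _ (H (Y k `|` A k.+1))); last first.
    apply: le_H; rewrite subUset; split; last by move=> x [].
    exact: (Yle k k.+2 (leqW (leqnSn k))).
  apply: (@hausdorff_outer_separated _ _ _ (k.+1%:R^-1 - k.+2%:R^-1)%R).
    by rewrite subr_gt0 ltf_pV2 ?posrE// ltr_nat.
  move=> x y [_ Yx] [[Xy _] nYy].
  have [z Fz yz] : exists2 z, F z & (enorm (y - z) < k.+2%:R^-1)%R.
    apply: contrapT => nz; apply: nYy; split => // z Fz.
    by rewrite leNgt; apply/negP => yz; apply: nz; exists z.
  rewrite lerBlDr (le_trans (Yx _ Fz))// (le_trans (enorm_distD y x z))//.
  by rewrite lerD2l ltW.
have sumA N : \sum_(i < N) H (A i.+1) <= H (Y N) + H (Y N.+1).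
  elim: N => [|N IH]; first by rewrite big_ord0 adde_ge0.
  rewrite big_ord_recr/=; apply: (le_trans (leeD2r _ IH)).
  by rewrite addeAC [leRHS]addeC leeD2r.
have sumAoo : \sum_(i <oo) H (A i) < +oo.
  apply: (@le_lt_trans _ _ (H X + (H X + H X))).
    apply: lime_le; first by apply: is_cvg_nneseries => *; exact: H_ge0.
    apply: nearW => -[|N]; first by rewrite big_nil !adde_ge0.
    rewrite big_mkord big_ord_recl/= leeD//.
      by apply: le_H => x [] /YX.
    by rewrite (le_trans (sumA N))// leeD// le_H.
  by rewrite !lte_add_pinfty// ltey.
have FE N : X `&` ~` F `<=` Y N `|` \bigcup_(i in ~` `I_N) A i.
  move=> x [Xx nFx].
  have [k Yk] : exists k, Y k x.
    have : nbhs x (~` F) by apply: open_nbhs_nbhs; split => //; exact: closed_openC.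
    move=> /nbhs_ballP[e /= e0 eF].
    exists (Num.truncn e^-1); split => // y Fy.
    rewrite leNgt; apply/negP => xy; apply: (eF y) => //.
    rewrite -ball_normE/=; apply: (le_lt_trans (ler_norm_enorm _)).
    rewrite (lt_trans xy)// invf_plt ?posrE//.
    exact: truncnS_gt.
  have [YN|nYN] := pselect (Y N x); [by left|right].
  have Nk : (N <= k)%N.
    by rewrite leqNgt; apply/negP => kN; apply: nYN; apply: Yle Yk; exact: ltnW.
  elim: k Nk Yk => [|k IH]; first by rewrite leqn0 => /eqP N0 Y0; case: nYN; rewrite N0.
  rewrite leq_eqVlt => /predU1P[NE Yk|Nk Yk]; first by case: nYN; rewrite NE.
  have [Ykx|nYk] := pselect (Y k x); first exact: IH.
  by exists k => //=; apply/negP; rewrite -leqNgt.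
apply/lee_addgt0Pr => e e0.
have [N tN] : exists N, \sum_(N <= i <oo) H (A i) < e%:E.
  have : \forall N \near \oo, \sum_(N <= i <oo) H (A i) < e%:E.
    have := nneseries_tail_cvg sumAoo (fun k _ => H_ge0 _).
    move=> /(_ [set u | u < e%:E]); apply.
    by apply: open_ereal_lt'; rewrite lte_fin.
  by move=> /filter_ex.
apply: (@le_trans _ _ (H (X `&` F) + (H (Y N) + e%:E))).
  apply: leeD2l; apply: (le_trans (le_H (FE N))).
  apply: (le_trans (outer_measureU2 _ _ _)); apply: leeD => //.
  exact: (le_trans (outer_measure_sigma_subadditive_tail _ _ _) (ltW tN)).
by rewrite addeA leeD2r.
Qed.

Lemma measurable_hausdorff_caratheodory A : measurable A -> H.-caratheodory A.
Proof.
move: A; apply: smallest_sub; last first.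
  move=> U oU; rewrite -(setCK U); apply: caratheodory_measurable_setC.
  by apply: closed_hausdorff_caratheodory; exact: open_closedC.
split.
- exact: caratheodory_measurable_set0.
- by move=> B HB; rewrite setTD; exact: caratheodory_measurable_setC.
- exact: caratheodory_measurable_bigcup.
Qed.

Definition hausdorff_measure : set 'rV[R]_n -> \bar R := H.

Let hausdorff_measure0 : hausdorff_measure set0 = 0.
Proof. exact: outer_measure0. Qed.

Let hausdorff_measure_ge0 A : 0 <= hausdorff_measure A.
Proof. exact: outer_measure_ge0. Qed.

Let hausdorff_measure_sigma_additive : semi_sigma_additive hausdorff_measure.
Proof.
move=> F mF tF _.
by apply: caratheodory_measure_sigma_additive => // [k|];
  [|apply: caratheodory_measurable_bigcup => k];
  exact: measurable_hausdorff_caratheodory.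
Qed.

HB.instance Definition _ := isMeasure.Build _ 'rV[R]_n R hausdorff_measure
  hausdorff_measure0 hausdorff_measure_ge0 hausdorff_measure_sigma_additive.

End hausdorff_borel.

Section function_spaces.
Variables (R : realType) (n : nat).
Implicit Types (E U : set 'rV[R]_n) (mu nu : {measure set 'rV[R]_n -> \bar R}).
Implicit Types (f u : 'rV[R]_n -> R) (g : 'rV[R]_n -> 'rV[R]_n).

Definition lipschitz_eucl (L : R) E u :=
  forall x y, E x -> E y -> `|u x - u y| <= L * enorm (x - y).

Definition ahlfors_regular (Q : R) E :=
  exists2 C : R, 1 <= C & forall x r, E x -> 0 < r -> (r%:E <= diam E)%E ->
    ((C^-1 * r `^ Q)%:E <= hausdorff_measure Q (E `&` eball x r)
      <= (C * r `^ Q)%:E)%E.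

Definition loc_integrable mu U f :=
  measurable_fun U f /\
  forall K, compact K -> K `<=` U -> (\int[mu]_(x in K) `|f x|%:E < +oo)%E.

(* mu = w dm with w >= 0 locally integrable *)
Definition weighted_lebesgue mu :=
  exists w : 'rV[R]_n -> R, [/\ forall x, 0 <= w x,
    loc_integrable (lebesgue_rV R n) [set: 'rV[R]_n] w &
    forall A, measurable A -> mu A = (\int[lebesgue_rV R n]_(x in A) (w x)%:E)%E].

(* Balls of the metric space U are the traces on U of the balls of R^n. *)
Definition doubling_on mu U :=
  exists2 C : R, 1 <= C & forall x r, U x -> 0 < r <= 10 ->
    (mu (U `&` eball x (2 * r)%R) <= C%:E * mu (U `&` eball x r))%E.

Definition Lp_on mu (p : R) U f := f \_ U \in Lfun mu p%:E.

Definition basis_rV (i : 'I_n) : 'rV[R]_n := delta_mx 0 i.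

Fixpoint Ck (k : nat) f : Prop :=
  match k with
  | 0 => continuous f
  | k'.+1 => continuous f /\ forall i : 'I_n,
      (forall x, derivable f x (basis_rV i)) /\
      Ck k' (fun x => 'D_(basis_rV i) f x)
  end.

(* C_c^oo(U) *)
Definition test_function U f :=
  (forall k, Ck k f) /\
  exists K, [/\ compact K, K `<=` U & forall x, ~ K x -> f x = 0].

(* Determined by f up to lebesgue_rV-null sets of the open set U. *)
Definition weak_gradient U f g :=
  [/\ loc_integrable (lebesgue_rV R n) U f,
      forall i, loc_integrable (lebesgue_rV R n) U (fun x => g x 0 i) &
      forall phi, test_function U phi -> forall i,
        (\int[lebesgue_rV R n]_(x in U) (f x * 'D_(basis_rV i) phi x)%:E =
         - \int[lebesgue_rV R n]_(x in U) (g x 0 i * phi x)%:E)%E].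

(* f belongs to N^{1,p}(U, mu) = W^{1,p}(U, mu), with weak gradient g *)
Definition sobolev_with_gradient mu (p : R) U f g :=
  [/\ Lp_on mu p U f, weak_gradient U f g & Lp_on mu p U (fun x => enorm (g x))].

(* The p-th power of the Besov (semi)norm. For x = y the integrand is 0, since
   0^-1 = 0 in the library. *)
Definition besov_energy nu (p theta : R) E u : \bar R :=
  (\int[nu]_(x in E) \int[nu]_(y in E)
    (`|u y - u x| `^ p /
     (enorm (x - y) `^ (theta * p) *
      fine (nu (eball x (enorm (x - y))))))%R%:E)%E.

Definition besov nu (p theta : R) E u :=
  Lp_on nu p E u /\ (besov_energy nu p theta E u < +oo)%E.

End function_spaces.

Definition hausdorff_on (R : realType) (n : nat) (Q : R) (E : set 'rV[R]_n)
    (cE : compact E) : {measure set 'rV[R]_n -> \bar R} :=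
  mrestr (hausdorff_measure Q) (compact_measurable_rV cE).

(* Main.v *)
(* The extension is a Shepard average. With M = 2N large and
   K_e(x,y) = (|x-y|^2 + e)^-N, let f_e be the quotient of the integrals over E
   of u K_e(x,.) and of K_e(x,.) with respect to nu; then Su = f_0 off E and
   Su = u on E. Lower Ahlfors regularity bounds the mass of K_e(x,.) from below
   by dist(x,E)^(Q-M), up to a constant, so Jensen's inequality gives
     |f_e(x)|^p <= C int_E |u(y)|^p |x-y|^-Q dnu(y),
     |grad f_e(x)|^p <= C int_E int_E |u(y)-u(z)|^p
        max(|y-z|/2,|x-y|)^-(p+2Q) dnu(y) dnu(z),
   uniformly in e. Put s = Q + p(1-theta) <= n + alpha <= n. Both mu and the
   Lebesgue measure of a ball centred on E grow at most like r^s, so summing over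
   dyadic annuli bounds the integrals over B of the right-hand sides by the L^p
   norm and by the Besov energy, for both measures. For e > 0 the f_e are smooth, and
   by dominated convergence for Lebesgue measure the weak gradient of Su is the limit
   of grad f_e as e tends to 0. For a Lipschitz u, comparing u with its value at
   the point of E nearest to x bounds grad f_e uniformly; the mean value theorem
   on segments of B and f_e -> u on E do the rest. *)
Require Import Defs.
From HB Require Import structures.
From mathcomp Require Import all_boot all_order all_algebra.
From mathcomp Require Import all_classical all_reals all_analysis.
From mathcomp Require Import measurable_realfun ring lra.
Import Order.TTheory GRing.Theory Num.Theory.
Import numFieldNormedType.Exports.
Local Open Scope classical_set_scope.
Local Open Scope ring_scope.
Set Implicit Arguments.
Unset Strict Implicit.
Unset Printing Implicit Defensive.

(** * Integrals of kernels *)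

(** Two obstacles shape the argument. The weak gradient is tested against Lebesgue measure while the
    bounds are wanted for [mu]; the integral estimates over [B] are therefore proved for an abstract
    measure whose balls centred on [E] grow at most like r^s, and are used twice. And f_0 is
    singular along [E]: for e > 0 the average is differentiable along every line, even through [E],
    so that partial integration needs no cutoff near [E], which drops out in the limit as a null
    set. The number s satisfies s - (p + 2Q) = -(Q + theta p): integrating the gradient majorant
    over x leaves exactly the power of |y - z| found in the Besov integrand, once |y - z|^Q is
    exchanged for the measure of a ball. The hypothesis on [theta] says s <= n + alpha, and theta <
    1 gives Q < s, which makes the L^p majorant integrable near [E] and [E] a null set. The exponent
    M is at least p + 2Q because a product of two kernel weights has to be bounded by the larger of
    the two distances alone. *)

Section real_integrable.
Context d (T : measurableType d) (R : realType).
Variables (mu : {measure set T -> \bar R}) (E : set T).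
Hypothesis mE : measurable E.
Implicit Types f g h : T -> R.

Lemma measurable_of_integrable f :
  mu.-integrable E (EFin \o f) -> measurable_fun E f.
Proof. by move=> /integrableP[/measurable_EFinP]. Qed.

Lemma EFin_Rintegral f : mu.-integrable E (EFin \o f) ->
  (\int[mu]_(y in E) f y)%:E = (\int[mu]_(y in E) (f y)%:E)%E.
Proof. by move=> h; rewrite fineK//; exact: integrable_fin_num. Qed.

Lemma integrable_addr f g : mu.-integrable E (EFin \o f) ->
  mu.-integrable E (EFin \o g) -> mu.-integrable E (EFin \o (fun y => f y + g y)).
Proof. by move=> hf hg; apply: eq_integrable (integrableD mE hf hg). Qed.

Lemma integrable_subr f g : mu.-integrable E (EFin \o f) ->
  mu.-integrable E (EFin \o g) -> mu.-integrable E (EFin \o (fun y => f y - g y)).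
Proof. by move=> hf hg; apply: eq_integrable (integrableB mE hf hg). Qed.

Lemma integrable_mulr f c : mu.-integrable E (EFin \o f) ->
  mu.-integrable E (EFin \o (fun y => f y * c)).
Proof. by move=> hf; apply: eq_integrable (integrableZr mE c hf). Qed.

Lemma integrable_dom f g : measurable_fun E f ->
  (forall y, E y -> `|f y| <= g y) -> mu.-integrable E (EFin \o g) ->
  mu.-integrable E (EFin \o f).
Proof.
move=> mf fg; apply: le_integrable => //; first exact/measurable_EFinP.
by move=> y Ey /=; rewrite lee_fin (le_trans (fg _ Ey))// ler_norm.
Qed.

Lemma integrable_mul_bounded f h c : mu.-integrable E (EFin \o f) ->
  measurable_fun E h -> (forall y, E y -> `|h y| <= c) ->
  mu.-integrable E (EFin \o (fun y => f y * h y)).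
Proof.
move=> hf mh hc.
apply: (@integrable_dom _ (fun y => `|f y| * c)).
- by apply: measurable_funM => //; exact: measurable_of_integrable.
- by move=> y Ey; rewrite normrM ler_wpM2l// hc.
- by apply: integrable_mulr; exact: integrable_norm.
Qed.

Lemma integrable_bounded f c : (mu E < +oo)%E -> measurable_fun E f ->
  (forall y, E y -> `|f y| <= c) -> mu.-integrable E (EFin \o f).
Proof.
move=> Eoo mf fc; apply: measurable_bounded_integrable => //.
exists c; split; first exact: num_real.
by move=> M cM y Ey /=; apply: (le_trans (fc _ Ey)); exact: ltW.
Qed.

Lemma integrable_nonneg_fin f : measurable_fun E f -> (forall y, E y -> 0 <= f y) ->
  (\int[mu]_(y in E) (f y)%:E < +oo)%E -> mu.-integrable E (EFin \o f).
Proof.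
move=> mf f0 foo; apply/integrableP; split; first exact/measurable_EFinP.
rewrite (eq_integral (fun y => (f y)%:E))// => y /set_mem Ey /=.
by rewrite ger0_norm// f0.
Qed.

End real_integrable.

(** * Parameter integrals and Tonelli's theorem on sets of finite measure *)

Section tonelli_on.
Local Open Scope ereal_scope.
Context d1 d2 (X : measurableType d1) (Y : measurableType d2) (R : realType).
Variables (mu : {measure set X -> \bar R}) (nu : {measure set Y -> \bar R}).

(** The measure [nu] is arbitrary outside [E]; its restriction to [E] is finite, and there the
    measurability part of Tonelli's theorem applies. *)
Lemma measurable_ge0_integral_param (E : set Y) (f : X * Y -> \bar R) :
  measurable E -> nu E < +oo -> measurable_fun setT f -> (forall z, 0 <= f z) ->
  measurable_fun setT (fun x => \int[nu]_(y in E) f (x, y)).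
Proof.
move=> mE Eoo mf f0.
pose nuE : {finite_measure set Y -> \bar R} := mfrestr mE Eoo.
have mTE : measurable ([set: X] `*` E) by exact: measurableX.
pose g : X * Y -> \bar R := f \_ ([set: X] `*` E).
have mg : measurable_fun setT g.
  by apply/measurable_restrict => //; rewrite setTI; exact: measurable_funTS.
have -> : (fun x => \int[nu]_(y in E) f (x, y)) = fubini_F nuE g.
  apply/funext => x; rewrite /fubini_F.
  transitivity (\int[nuE]_(y in E) f (x, y)).
    apply: eq_measure_integral => A mA AE.
    by change (nu A = nu (A `&` E)); rewrite setIidl.
  rewrite [LHS]integral_mkcond; apply: eq_integral => y _.
  rewrite /g !patchE; congr (if _ then _ else _).
  by apply/idP/idP => [/set_mem yE|/set_mem[_ yE]]; apply/mem_set.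
apply: measurable_fun_fubini_tonelli_F => // z.
by rewrite /g patchE; case: ifP.
Qed.

Lemma tonelli_on (A : set X) (E : set Y) (f : X * Y -> \bar R) :
  measurable A -> mu A < +oo -> measurable E -> nu E < +oo ->
  measurable_fun setT f -> (forall z, 0 <= f z) ->
  \int[mu]_(x in A) \int[nu]_(y in E) f (x, y) =
  \int[nu]_(y in E) \int[mu]_(x in A) f (x, y).
Proof.
move=> mA Aoo mE Eoo mf f0.
pose nuE : {finite_measure set Y -> \bar R} := mfrestr mE Eoo; pose muA : {finite_measure set X
  -> \bar R} := mfrestr mA Aoo.
pose g : X * Y -> \bar R := f \_ (A `*` E).
have mAE : measurable (A `*` E) by exact: measurableX.
have mg : measurable_fun setT g.
  by apply/measurable_restrict => //; rewrite setTI; exact: measurable_funTS.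
have g0 z : 0 <= g z by rewrite /g patchE; case: ifP.
have HE h : \int[nu]_(y in E) h y = \int[nuE]_(y in E) h y.
  apply: eq_measure_integral => U mU UE.
  by change (nu U = nu (U `&` E)); rewrite setIidl.
have HA h : \int[mu]_(y in A) h y = \int[muA]_(y in A) h y.
  apply: eq_measure_integral => U mU UE.
  by change (mu U = mu (U `&` A)); rewrite setIidl.
have := @fubini_tonelli _ _ _ _ R muA nuE g mg g0.
rewrite HA HE [in X in _ -> X = _]integral_mkcond
  [in X in _ -> _ = X]integral_mkcond => H.
transitivity (\int[muA]_x \int[nuE]_y g (x, y)).
  apply: eq_integral => x _; rewrite patchE; case: ifPn => [xA|xA].
    rewrite HE integral_mkcond; apply: eq_integral => y _.
    rewrite /g !patchE; congr (if _ then _ else _).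
    apply/idP/idP => [/set_mem yE|/set_mem[_ yE]]; apply/mem_set => //.
    by split => //=; exact: set_mem.
  rewrite (eq_integral (cst 0)) ?integral0// => y _.
  rewrite /g patchE ifF//; apply/negbTE; apply: contra xA => /set_mem[/= xA _].
  exact: mem_set.
rewrite H; apply: eq_integral => y _; rewrite patchE; case: ifPn => [yE|yE].
  rewrite HA [in RHS]integral_mkcond; apply: eq_integral => x _.
  rewrite /g !patchE; congr (if _ then _ else _).
  apply/idP/idP => [/set_mem[xA _]|/set_mem xA]; apply/mem_set => //.
  by split => //=; exact: set_mem.
rewrite (eq_integral (cst 0)) ?integral0// => x _.
rewrite /g patchE ifF//; apply/negbTE; apply: contra yE => /set_mem[/= _ yE].
exact: mem_set.
Qed.

(** No integrability is required: the integral is the difference of those of the positive and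
    negative parts, and [fine] is measurable whatever that difference is. *)
Lemma measurable_Rintegral_param (E : set Y) (f : X * Y -> R) :
  measurable E -> nu E < +oo -> measurable_fun setT f ->
  measurable_fun setT (fun x => (\int[nu]_(y in E) f (x, y))%R).
Proof.
move=> mE Eoo mf.
rewrite /Rintegral; apply: (@measurableT_comp _ _ _ _ _ _ (@fine R)) => //.
have -> : (fun x => \int[nu]_(y in E) (f (x, y))%:E) = (fun x =>
    (\int[nu]_(y in E) ((EFin \o f)^\+ (x, y))) -
    (\int[nu]_(y in E) ((EFin \o f)^\- (x, y)))).
  by apply/funext => x; rewrite [LHS]integralE;
    congr (_ - _); apply: eq_integral => y _; rewrite ?funeposE ?funenegE.
have me : measurable_fun setT (EFin \o f) by apply/measurable_EFinP.
apply: emeasurable_funB; apply: measurable_ge0_integral_param => //.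
- exact: measurable_funepos.
- exact: measurable_funeneg.
Qed.

End tonelli_on.

(** * Jensen's inequality for powers *)

Section jensen.
Local Open Scope ereal_scope.
Context d (T : measurableType d) (R : realType).
Variable mu : {measure set T -> \bar R}.

(** Young's inequality g b <= g^p / p + b^q / q is integrated against [w] with the constant b =
    a^(p-1), where a is the mean of g. Since a b = b^q = a^p, the term a^p / q is absorbed and a^p /
    p remains on the left. *)
Lemma powR_jensen (E : set T) (w g : T -> R) (p : R) :
  measurable E -> (1 < p)%R ->
  measurable_fun E w -> measurable_fun E g ->
  (forall y, E y -> 0 <= w y)%R -> (forall y, E y -> 0 <= g y)%R ->
  \int[mu]_(y in E) (w y)%:E = 1 ->
  mu.-integrable E (EFin \o (fun y => g y * w y)%R) ->
  ((\int[mu]_(y in E) (g y * w y))%R `^ p)%:E <=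
    \int[mu]_(y in E) (g y `^ p * w y)%:E.
Proof.
move=> mE p1 mw mg w0 g0 w1 igw.
have p0 : (0 < p)%R by lra.
set a := (\int[mu]_(y in E) (g y * w y))%R.
have a0 : (0 <= a)%R by apply: Rintegral_ge0 => y Ey; rewrite mulr_ge0 ?g0 ?w0.
have [->|I_fin] := eqVneq (\int[mu]_(y in E) (g y `^ p * w y)%:E) +oo.
  by rewrite leey.
have mgp : measurable_fun E (fun y => g y `^ p * w y)%R.
  by apply: measurable_funM => //; apply: (measurableT_comp (measurable_powR p)).
have i0 : 0 <= \int[mu]_(y in E) (g y `^ p * w y)%:E.
  by apply: integral_ge0 => y Ey; rewrite lee_fin mulr_ge0 ?powR_ge0 ?w0.
have igp : mu.-integrable E (EFin \o (fun y => g y `^ p * w y)%R).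
  apply/integrableP; split; first exact/measurable_EFinP.
  rewrite (eq_integral (fun y => (g y `^ p * w y)%:E)) ?ltey// => y /set_mem Ey /=.
  by rewrite ger0_norm// mulr_ge0 ?powR_ge0 ?w0.
have iw : mu.-integrable E (EFin \o w).
  apply/integrableP; split; first exact/measurable_EFinP.
  rewrite (eq_integral (fun y => (w y)%:E)) ?w1 ?ltry// => y /set_mem Ey /=.
  by rewrite ger0_norm// w0.
pose b := (a `^ (p - 1))%R; pose q := (p / (p - 1))%R.
have q0 : (0 < q)%R by rewrite divr_gt0// subr_gt0.
have pq : (p^-1 + q^-1 = 1)%R.
  rewrite /q invf_div -[X in (X + _)%R]mul1r -mulrDl addrC subrK divff//.
  by rewrite gt_eqF.
have bq : (b `^ q = a `^ p)%R.
  rewrite /b -powRrM /q; congr (_ `^ _)%R.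
  by field; rewrite gt_eqF// subr_gt0.
have Ew : (\int[mu]_(y in E) w y)%R = 1%R by rewrite /Rintegral w1.
have key : (a * b <= (\int[mu]_(y in E) (g y `^ p * w y))%R / p + a `^ p / q)%R.
  have -> : (a * b)%R = (\int[mu]_(y in E) (g y * w y * b))%R.
    by rewrite RintegralZr.
  have -> : ((\int[mu]_(y in E) (g y `^ p * w y))%R / p + a `^ p / q)%R =
     (\int[mu]_(y in E) (g y `^ p * w y / p + w y * (a `^ p / q)))%R.
    rewrite RintegralD//.
    - by rewrite !RintegralZr// Ew mul1r.
    - exact: integrable_mulr.
    - exact: integrable_mulr.
  apply: le_Rintegral => //.
  - exact: integrable_mulr.
  - by apply: integrable_addr => //; exact: integrable_mulr.
  - move=> y Ey.
    have := @conjugate_powR R (g y) b p q (g0 _ Ey) (powR_ge0 _ _) p0 q0 pq.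
    rewrite bq => h; have := ler_wpM2r (w0 _ Ey) h.
    by rewrite mulrDl mulrAC [(g y `^ p / p * _)%R]mulrAC [(a `^ p / q * _)%R]mulrC.
rewrite -[leRHS]fineK; last by rewrite ge0_fin_numE// ltey.
rewrite lee_fin -/(Rintegral mu E (fun y => g y `^ p * w y)%R).
move: key; rewrite /b mulr_powRB1// => key.
have e : (a `^ p / q = a `^ p - a `^ p / p)%R.
  by rewrite -[X in (_ = X - _)%R]mulr1 -pq; ring.
move: key; rewrite e -lerBlDr opprB addrCA subrr addr0.
by rewrite ler_pM2r// invr_gt0.
Qed.

End jensen.

(** * Powers of a distance integrated over geometric layers *)

Section geometric_layers.
Context d (T : measurableType d) (R : realType).
Variable mu : {measure set T -> \bar R}.

(* [h] is dominated by the sum of the geometric step functions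
   [c * r_k `^ - a * 1_{rho < r_k}], [r_k = del * b ^ k]. *)
Lemma integral_geometric_layers (B : set T) (rho h : T -> R) (C c a s b del : R) :
  measurable B -> measurable_fun B h -> measurable_fun setT rho ->
  0 <= C -> 0 <= c -> 0 < b -> 0 < del -> b `^ (s - a) < 1 ->
  (forall k, (mu (B `&` [set x | (rho x < del * b ^+ k)%R]) <=
     (C * (del * b ^+ k) `^ s)%:E)%E) ->
  (forall x, B x -> 0 <= h x) ->
  (forall x, B x -> exists2 k, rho x < del * b ^+ k & h x <= c * (del * b ^+ k) `^ (- a)) ->
  (\int[mu]_(x in B) (h x)%:E <= (C * c / (1 - b `^ (s - a)) * del `^ (s - a))%:E)%E.
Proof.
move=> mB mh mrho C0 c0 b0 d0 b1 growth h0 hk.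
pose r k := del * b ^+ k.
have r0 k : 0 < r k by rewrite mulr_gt0 ?exprn_gt0//.
pose A k := [set x | rho x < r k].
have mA k : measurable (A k).
  rewrite -[X in measurable X]setTI (_ : A k = rho @^-1` `]-oo, r k[%classic).
    exact: mrho.
  by apply/seteqP; split => x /=; rewrite in_itv.
pose g k x : \bar R := ((c * (r k) `^ (- a)) * \1_(A k) x)%:E.
have g0 k x : (0 <= g k x)%E by rewrite lee_fin !mulr_ge0 ?powR_ge0.
have mg k : measurable_fun B (g k).
  apply/measurable_EFinP; apply: measurable_funM => //; exact: measurable_indic.
apply: (@le_trans _ _ (\int[mu]_(x in B) (\sum_(k <oo) g k x))%E).
  apply: ge0_le_integral => //.
  - by apply/measurable_EFinP.
  - by apply: ge0_emeasurable_sum => // k x _ _; exact: g0.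
  - move=> x Bx; have [k xk hxk] := hk x Bx.
    apply: (@le_trans _ _ (g k x)).
      by rewrite /g lee_fin indicE mem_set// mulr1.
    rewrite (@nneseriesD1 _ _ k)// ?leeDl//; apply: nneseries_ge0 => *; exact: g0.
rewrite integral_nneseries//.
apply: (@le_trans _ _ (\sum_(k <oo) ((C * c * del `^ (s - a)) * (b `^ (s - a)) ^+ k)%:E)%E).
  apply: lee_nneseries => k _.
    by move=> _; apply: integral_ge0 => x _; exact: g0.
  rewrite /g; under eq_integral do rewrite EFinM.
  rewrite ge0_integralZl_EFin//; last 2 first.
  - by apply/measurable_EFinP; exact: measurable_indic.
  - by rewrite mulr_ge0 ?powR_ge0.
  rewrite integral_indic// setIC.
  apply: le_trans (lee_wpmul2l _ (growth k)) _.
    by rewrite lee_fin mulr_ge0 ?powR_ge0.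
  rewrite -EFinM lee_fin -/(r k).
  have -> : c * r k `^ (- a) * (C * r k `^ s) = C * c * (r k `^ (s - a)).
    rewrite powRD; first by ring.
    by apply/implyP => _; rewrite gt_eqF.
  suff -> : r k `^ (s - a) = del `^ (s - a) * (b `^ (s - a)) ^+ k by rewrite !mulrA.
  rewrite /r powRM ?(ltW d0) ?exprn_ge0 ?(ltW b0)//; congr (_ * _).
  by rewrite -[b ^+ k]powR_mulrn ?(ltW b0)// powRAC powR_mulrn ?powR_ge0.
set q := b `^ (s - a).
have q0 : 0 <= q by exact: powR_ge0.
have c00 : 0 <= C * c * del `^ (s - a) by rewrite !mulr_ge0 ?powR_ge0.
apply: lime_le.
  apply: is_cvg_nneseries => k _ _; rewrite lee_fin mulr_ge0// exprn_ge0//.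
apply: nearW => n; rewrite sumEFin lee_fin.
have [q00|q00] := eqVneq q 0.
  case: n => [|n].
    by rewrite big_nil !mulr_ge0 ?invr_ge0 ?powR_ge0// q00 subr0 ler01.
  rewrite big_nat_recl// expr0 mulr1 big1 ?addr0 ?q00 ?subr0 ?divr1// => i _.
  by rewrite exprS mul0r mulr0.
have := @geometric_le_lim R n (C * c * del `^ (s - a)) q c00.
rewrite lt_def q00 q0 ger0_norm// => /(_ isT b1).
rewrite /series/= => /le_trans; apply.
by rewrite mulrAC.
Qed.

Lemma powRN_anti (x y a : R) : 0 <= a -> 0 < x -> x <= y -> y `^ (- a) <= x `^ (- a).
Proof.
move=> a0 x0 xy; rewrite !powRN lef_pV2 ?posrE ?powR_gt0//; last exact: lt_le_trans xy.
by apply: ge0_ler_powR => //; rewrite nnegrE ltW//; exact: lt_le_trans xy.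
Qed.

Lemma half_double_powRN (x a : R) : 0 < x -> 2 `^ a * x `^ (- a) = (x / 2) `^ (- a).
Proof.
move=> x0; rewrite powRM ?ltW ?invr_gt0// mulrC; congr (_ * _).
by rewrite -powR_inv1// -powRrM mulN1r opprK.
Qed.

(** Here the layers grow with ratio 2. For the least k with rho x < del 2^k the maximum in the
    integrand is at least half of del 2^k, which costs 2^a, and s < a makes the series converge. *)
Lemma integral_far (B : set T) (rho : T -> R) (C a s del : R) :
  measurable B -> measurable_fun setT rho -> 0 <= C -> 0 < del -> 0 <= s < a ->
  (forall r : R, 0 < r -> (mu (B `&` [set x | (rho x < r)%R]) <= (C * r `^ s)%:E)%E) ->
  (\int[mu]_(x in B) (Num.max del (rho x) `^ (- a))%:E <=
   (C * 2 `^ a / (1 - 2 `^ (s - a)) * del `^ (s - a))%:E)%E.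
Proof.
move=> mB mrho C0 d0 /andP[s0 sa] growth.
have mrhoB : measurable_fun B rho by exact: measurable_funTS.
apply: integral_geometric_layers (mrho) _ _ _ (d0) _ _ _ _ => //.
- apply: (measurableT_comp (measurable_powR _)).
  exact: measurable_maxr.
- by rewrite -[ltRHS](powRr0 (2:R)) /powR pnatr_eq0/= ltr_expR ltr_pM2r ?subr_lt0// ln_gt0// ltr1n.
- by move=> k; apply/growth/mulr_gt0 => //; exact: exprn_gt0.
- by move=> x _; exact: powR_ge0.
- move=> x _.
  have [k0 k0P] : exists k, rho x < del * 2 ^+ k.
    exists (Num.truncn (rho x / del)).+1; rewrite -ltr_pdivrMl// mulrC.
    rewrite (lt_le_trans (truncnS_gt _))//.
    by rewrite -natrX ler_nat ltnW// ltn_expl.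
  have [k kP kmin] := ex_minnP (ex_intro (fun k => rho x < del * 2 ^+ k) k0 k0P).
  exists k => //; rewrite half_double_powRN ?mulr_gt0 ?exprn_gt0//.
  apply: powRN_anti; [lra|by rewrite divr_gt0 ?mulr_gt0 ?exprn_gt0//|].
  (* For k = 0 the lower bound is [del] itself; for larger k it comes from [rho x], by minimality of
     k. *)
  rewrite le_max; case: k kP kmin => [|k] kP kmin.
    by apply/orP; left; rewrite expr0; lra.
  apply/orP; right; rewrite exprSr mulrA mulfK// leNgt; apply/negP => /kmin.
  by rewrite ltnn.
Qed.

(** Here the layers shrink with ratio 1/2, and a < s makes the series converge. The index is the
    least k for which r0 / 2^(k+1) no longer exceeds [rho x]. *)
Lemma integral_near (B : set T) (rho : T -> R) (C a s r0 : R) :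
  measurable B -> measurable_fun setT rho -> 0 <= C -> 0 < r0 -> 0 < a < s ->
  (forall x, B x -> 0 <= rho x < r0) ->
  (forall r : R, 0 < r -> (mu (B `&` [set x | (rho x < r)%R]) <= (C * r `^ s)%:E)%E) ->
  (\int[mu]_(x in B) (rho x `^ (- a))%:E <=
   (C * 2 `^ a / (1 - 2^-1 `^ (s - a)) * r0 `^ (s - a))%:E)%E.
Proof.
move=> mB mrho C0 d0 /andP[a0 sa] rhoB growth.
have mrhoB : measurable_fun B rho by exact: measurable_funTS.
apply: integral_geometric_layers (mrho) _ _ _ (d0) _ _ _ _ => //.
- exact: (measurableT_comp (measurable_powR _)).
- rewrite -[ltRHS](powRr0 (2^-1:R)) /powR invr_eq0 pnatr_eq0/= ltr_expR.
  by rewrite ltr_nM2r ?subr_gt0// lnV ?posrE// oppr_lt0 ln_gt0// ltr1n.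
- by move=> k; apply/growth/mulr_gt0 => //; exact: exprn_gt0.
- by move=> x _; exact: powR_ge0.
- move=> x Bx; have /andP[] := rhoB _ Bx.
  (* Where [rho] vanishes the integrand is 0 by convention, because the exponent -a is nonzero, so
     any layer will do there. *)
  rewrite le_eqVlt => /predU1P[<- _|r1 r2].
    exists 0%N; first by rewrite expr0 mulr1.
    by rewrite powR0 ?mulr_ge0 ?powR_ge0// oppr_eq0 gt_eqF.
  have [k0 k0P] : exists k, r0 * 2^-1 ^+ k.+1 <= rho x.
    exists (Num.truncn (r0 / rho x)).+1; rewrite -ler_pdivlMl//.
    rewrite exprVn -[leRHS]invrK lef_pV2 ?posrE ?exprn_gt0 ?invr_gt0 ?mulr_gt0 ?invr_gt0//.
    rewrite invfM invrK mulrC (le_trans (ltW (truncnS_gt _)))//.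
    by rewrite -natrX ler_nat (leq_trans (ltnW (ltn_expl _ (ltnSn 1))))// leq_exp2l.
  have [k kP kmin] := ex_minnP (ex_intro (fun k => r0 * 2^-1 ^+ k.+1 <= rho x) k0 k0P).
  exists k.
    case: k kP kmin => [|k] kP kmin; first by rewrite expr0 mulr1.
    by rewrite ltNge; apply/negP => /kmin; rewrite ltnn.
  rewrite half_double_powRN ?mulr_gt0 ?exprn_gt0//.
  apply: powRN_anti; [lra|by rewrite divr_gt0 ?mulr_gt0 ?exprn_gt0//|].
  by rewrite -mulrA -exprSr.
Qed.

End geometric_layers.

(** * Continuity and differentiation under the integral sign *)

Section under_integral.
Context d (Y : measurableType d) (R : realType).
Variables (nu : {measure set Y -> \bar R}) (E : set Y) (u : Y -> R).
Variables (k k' : R -> Y -> R) (C : R).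
Hypothesis mE : measurable E.
Hypothesis iu : nu.-integrable E (EFin \o u).

Lemma continuous_Rintegral :
  (forall t, measurable_fun E (k t)) ->
  (forall y, E y -> continuous (k ^~ y)) ->
  (forall t y, E y -> `|k t y| <= C) ->
  continuous (fun t => \int[nu]_(y in E) (u y * k t y)).
Proof.
move=> mk ck kC t.
have tI : t \in [set` `]t - 1, t + 1[].
  by rewrite inE/= in_itv/=; apply/andP; split; lra.
apply: (@continuity_under_integral R _ Y nu (fun t y => u y * k t y) E mE (t - 1) (t + 1)
  _ _ (fun y => `|u y| * C) _ _ t tI).
- by move=> x _; apply: integrable_mul_bounded => //; exact: kC.
- apply: aeW => y Ey x _; apply: cvgMl_tmp; exact: ck.
- by apply: integrable_mulr => //; exact: integrable_norm.
- by move=> x _; apply: aeW => y Ey; rewrite normrM ler_wpM2l// kC.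
Qed.

Lemma is_derive_Rintegral :
  (forall t, measurable_fun E (k t)) ->
  (forall (t : R) y, E y -> is_derive t (1 : R) (k ^~ y) (k' t y)) ->
  (forall t y, E y -> `|k t y| <= C) ->
  (forall t y, E y -> `|k' t y| <= C) ->
  forall t : R, is_derive t (1 : R) (fun t : R => \int[nu]_(y in E) (u y * k t y))
    (\int[nu]_(y in E) (u y * k' t y)).
Proof.
move=> mk dk kC k'C t.
have tI : [set` `]t - 1, t + 1[] t.
  by rewrite /= in_itv/=; apply/andP; split; lra.
have ik x : [set` `]t - 1, t + 1[] x ->
    nu.-integrable E (EFin \o (fun y => u y * k x y)).
  by move=> _; apply: integrable_mul_bounded => //; exact: kC.
have dd x y : E y -> is_derive (x : R) (1 : R) (fun x : R => u y * k x y) (u y * k' x y).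
  move=> Ey; have := dk x y Ey => ?.
  have := is_deriveZ (u y); apply.
have der x y : [set` `]t - 1, t + 1[] x -> E y ->
    derivable (fun x : R => u y * k x y) x (1 : R).
  by move=> _ Ey; have [] := dd x y Ey.
have dE x y : E y -> partial1of2 (fun x y => u y * k x y) x y = u y * k' x y.
  move=> Ey; rewrite partial1of2E; have ? := dd x y Ey; exact: derive_val.
have iG : nu.-integrable E (EFin \o (fun y => `|u y| * C)).
  by apply: integrable_mulr => //; exact: integrable_norm.
(* The sign of [C] can only be read off at a point of [E]; for empty [E] both integrals are 0. *)
have [[y0 Ey0]|E0] := pselect (exists y, E y); last first.
  have E0' : E = set0 by apply/seteqP; split => // y Ey; apply: E0; exists y.
  rewrite (_ : (fun t => _) = cst 0).
    by rewrite E0' Rintegral_set0; exact: is_derive_cst.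
  by apply/funext => x; rewrite E0' Rintegral_set0.
have C0 : 0 <= C := le_trans (normr_ge0 _) (kC 0 y0 Ey0).
have G0 y : 0 <= `|u y| * C by rewrite mulr_ge0.
have Gub x y : [set` `]t - 1, t + 1[] x -> E y ->
    `|partial1of2 (fun x y => u y * k x y) x y| <= `|u y| * C.
  by move=> _ Ey; rewrite dE// normrM ler_wpM2l// k'C.
apply: DeriveDef.
  exact: (derivable_under_integral mE tI ik der G0 iG Gub).
rewrite -derive1E (differentiation_under_integral mE tI ik der G0 iG Gub).
by apply: eq_Rintegral => y /set_mem Ey; rewrite dE.
Qed.

End under_integral.

(** * The regularised Shepard kernel *)

(** Inversion is discontinuous at 0, so it is written with the measurable power function; at 0 both
    expressions are 0 by convention. *)
Lemma measurable_invr (R : realType) : measurable_fun [set: R] (fun x : R => x^-1).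
Proof.
rewrite (_ : (fun x : R => x^-1) = (fun x => x * (x ^+ 2) `^ (-1))).
  apply: measurable_funM => //; apply: (measurableT_comp (measurable_powR _)).
  exact: measurable_funX.
apply/funext => x; rewrite powR_inv1 ?sqr_ge0//; have [->|x0] := eqVneq x 0.
  by rewrite invr0 mul0r.
by field.
Qed.

Section euclid.
Variables (R : realType) (n : nat).
Implicit Types (u v w x y z : 'rV[R]_n) (r : R).

Definition dotv u v := \sum_(i < n) u 0 i * v 0 i.

Lemma enorm_dotv v : enorm v ^+ 2 = dotv v v.
Proof. by rewrite enorm_sqr; apply: eq_bigr => i _; rewrite expr2. Qed.

Lemma dotvDl u v w : dotv (u + v) w = dotv u w + dotv v w.
Proof. by rewrite /dotv -big_split; apply: eq_bigr => i _; rewrite mxE mulrDl. Qed.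

Lemma dotvC u v : dotv u v = dotv v u.
Proof. by apply: eq_bigr => i _; rewrite mulrC. Qed.

Lemma dotvZl (a : R) u v : dotv (a *: u) v = a * dotv u v.
Proof. by rewrite /dotv mulr_sumr; apply: eq_bigr => i _; rewrite mxE mulrA. Qed.

Lemma dotvDr u v w : dotv w (u + v) = dotv w u + dotv w v.
Proof. by rewrite dotvC dotvDl !(dotvC w). Qed.

Lemma dotvZr (a : R) u v : dotv u (a *: v) = a * dotv u v.
Proof. by rewrite dotvC dotvZl dotvC. Qed.

Lemma dotvNl u v : dotv (- u) v = - dotv u v.
Proof. by rewrite -scaleN1r dotvZl mulN1r. Qed.

Lemma normr_dotv u v : `|dotv u v| <= enorm u * enorm v.
Proof.
rewrite ler_norml enorm_dot andbT lerNl -dotvNl.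
by rewrite (le_trans (enorm_dot _ _))// enormN.
Qed.

Lemma enorm0 : enorm (0 : 'rV[R]_n) = 0.
Proof.
by apply/eqP; rewrite -sqrf_eq0 enorm_sqr big1// => i _; rewrite mxE expr0n.
Qed.

Lemma enormZ (a : R) v : enorm (a *: v) = `|a| * enorm v.
Proof.
apply/eqP; rewrite -(@eqrXn2 _ 2)// ?mulr_ge0 ?enorm_ge0// exprMn !enorm_dotv.
by rewrite dotvZl dotvC dotvZl mulrA -expr2 real_normK ?num_real.
Qed.

Lemma enorm_le_sum v : enorm v <= \sum_(i < n) `|v 0 i|.
Proof.
rewrite -(@ler_pXn2r _ 2)// ?nnegrE ?enorm_ge0 ?sumr_ge0// enorm_sqr expr2 mulr_suml.
apply: ler_sum => i _; rewrite -real_normK ?num_real// expr2 ler_wpM2l//.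
by rewrite (bigD1 i)//= lerDl sumr_ge0.
Qed.

Lemma enorm_le_norm v : enorm v <= n%:R * `|v|.
Proof.
rewrite (le_trans (enorm_le_sum v))//.
rewrite (@le_trans _ _ (\sum_(i < n) `|v|))//; last by rewrite sumr_const card_ord mulr_natl.
apply: ler_sum => i _; rewrite [leRHS]/Num.norm/= mx_normrE.
exact: (le_bigmax _ (fun ij : 'I_1 * 'I_n => `|v ij.1 ij.2|) (0, i)).
Qed.

Lemma enorm_basis (i : 'I_n) : enorm (basis_rV R i) = 1.
Proof.
apply/eqP; rewrite -(@eqrXn2 _ 2)// ?enorm_ge0// enorm_sqr expr1n (bigD1 i)//=.
rewrite mxE !eqxx expr1n big1 ?addr0// => j ji.
by rewrite mxE (negbTE ji) andbF expr0n.
Qed.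

Lemma open_eball x r : open (eball x r).
Proof.
rewrite openE => y xy; apply/nbhs_ballP.
(* The sup norm and the Euclidean norm differ by a factor at most n; [n.+1] keeps the radius
   positive when n = 0. *)
exists ((r - enorm (x - y)) / n.+1%:R) => /=; first by rewrite divr_gt0// subr_gt0.
move=> z; rewrite -ball_normE/= => yz; rewrite /eball/=.
rewrite (le_lt_trans (enorm_distD y x z))// -ltrBrDl.
rewrite (le_lt_trans (enorm_le_norm _))//.
rewrite (@le_lt_trans _ _ (n.+1%:R * `|y - z|))//; first by rewrite ler_wpM2r// ler_nat.
by rewrite -ltr_pdivlMl// mulrC.
Qed.

Lemma measurable_eball x r : measurable (eball x r).
Proof. by apply: open_measurable_rV; exact: open_eball. Qed.

Lemma measurable_sub_rV d (T : measurableType d) (f g : T -> 'rV[R]_n) :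
  measurable_fun setT f -> measurable_fun setT g ->
  measurable_fun setT (fun t => f t - g t).
Proof.
move=> mf mg; apply: measurable_fun_rV => i.
rewrite (_ : (fun _ => _) = (fun t => f t 0 i - g t 0 i)).
  apply: measurable_funB.
  - exact: (measurableT_comp (@measurable_coord R n i)).
  - exact: (measurableT_comp (@measurable_coord R n i)).
by apply/funext => t; rewrite !mxE.
Qed.

Lemma measurable_dotv d (T : measurableType d) (f : T -> 'rV[R]_n) v :
  measurable_fun setT f -> measurable_fun setT (fun t => dotv (f t) v).
Proof.
move=> mf; rewrite /dotv; apply: measurable_sum => i.
by apply: measurable_funM => //; exact: (measurableT_comp (@measurable_coord R n i)).
Qed.

Lemma measurable_enorm d (T : measurableType d) (f : T -> 'rV[R]_n) :
  measurable_fun setT f -> measurable_fun setT (fun t => enorm (f t)).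
Proof.
move=> mf; rewrite /enorm.
apply: (measurableT_comp (continuous_measurable_fun (@sqrt_continuous R))).
apply: measurable_sum => i; apply: measurable_funX.
exact: (measurableT_comp (@measurable_coord R n i)).
Qed.

End euclid.

Section kernel.
Variables (R : realType) (n N : nat).
Implicit Types (x y v : 'rV[R]_n) (e t : R).

Definition qdist e x y := enorm (x - y) ^+ 2 + e.
Definition rdist e x y := Num.sqrt (qdist e x y).
(** The decay exponent is the even number 2N so that the kernel is an integer power of the inverse
    of [qdist], a polynomial in the coordinates: for e > 0 it is smooth even at x = y. *)
Definition shepard e x y := (qdist e x y)^-1 ^+ N.
Definition dshepard v e x y :=
  - ((2 * N)%:R * dotv (x - y) v * (qdist e x y)^-1 ^+ N.+1).

Lemma qdist_ge0 e x y : 0 <= e -> 0 <= qdist e x y.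
Proof. by move=> e0; rewrite addr_ge0// sqr_ge0. Qed.

Lemma shepard_ge0 e x y : 0 <= e -> 0 <= shepard e x y.
Proof. by move=> e0; rewrite exprn_ge0// invr_ge0 qdist_ge0. Qed.

Lemma rdist_sqr e x y : 0 <= e -> rdist e x y ^+ 2 = qdist e x y.
Proof. by move=> e0; rewrite sqr_sqrtr// qdist_ge0. Qed.

Lemma rdist_ge0 e x y : 0 <= rdist e x y.
Proof. exact: sqrtr_ge0. Qed.

Lemma rdist_gt0 e x y : 0 < qdist e x y -> 0 < rdist e x y.
Proof. by move=> q0; rewrite sqrtr_gt0. Qed.

Lemma enorm_le_rdist e x y : 0 <= e -> enorm (x - y) <= rdist e x y.
Proof.
by move=> e0; rewrite -(@ler_pXn2r _ 2)// ?nnegrE ?rdist_ge0 ?enorm_ge0// rdist_sqr// lerDl.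
Qed.

Lemma rdist0 x y : rdist 0 x y = enorm (x - y).
Proof. by rewrite /rdist /qdist addr0 sqrtr_sqr ger0_norm// enorm_ge0. Qed.

Lemma rdist_le e x y : 0 <= e -> rdist e x y <= enorm (x - y) + Num.sqrt e.
Proof.
move=> e0; rewrite -(@ler_pXn2r _ 2)// ?nnegrE ?rdist_ge0 ?addr_ge0 ?enorm_ge0 ?sqrtr_ge0//.
rewrite rdist_sqr// /qdist -[X in _ + X](sqr_sqrtr e0).
have := mulr_ge0 (enorm_ge0 (x - y)) (sqrtr_ge0 e).
by move: (enorm _) (Num.sqrt e) => a b ab; nra.
Qed.

(** With r = rdist e x y, the bounds |x - z| <= 2r and e <= r^2 give a square of at most 5 r^2,
    hence 9 r^2 suffices. On the ball about [y] with radius r the kernel is therefore comparable to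
    its value at [y]. *)
Lemma rdist_le3 e x y z : 0 <= e -> enorm (y - z) <= rdist e x y ->
  rdist e x z <= 3 * rdist e x y.
Proof.
move=> e0 yz; have r0 := rdist_ge0 e x y.
rewrite -(@ler_pXn2r _ 2)// ?nnegrE ?rdist_ge0 ?mulr_ge0// rdist_sqr//.
have h1 := enorm_distD y x z; have h2 := enorm_le_rdist x y e0.
have h3 : enorm (x - z) <= 2 * rdist e x y by lra.
have h4 : enorm (x - z) ^+ 2 <= (2 * rdist e x y) ^+ 2.
  by rewrite ler_pXn2r// ?nnegrE ?enorm_ge0 ?mulr_ge0.
have h5 : e <= rdist e x y ^+ 2 by rewrite rdist_sqr// lerDr sqr_ge0.
by rewrite /qdist; nra.
Qed.

Lemma shepardE e x y : 0 <= e -> 0 < qdist e x y ->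
  shepard e x y = rdist e x y `^ (- (2 * N)%:R).
Proof.
move=> e0 q0; rewrite powRN powR_mulrn ?rdist_ge0// exprM rdist_sqr//.
by rewrite /shepard exprVn.
Qed.

Lemma shepard_gt0 e x y : 0 < qdist e x y -> 0 < shepard e x y.
Proof. by move=> q0; rewrite exprn_gt0// invr_gt0. Qed.

(** The derivative carries two more inverse powers of [rdist] than the kernel; Cauchy-Schwarz and |x
    - y| <= rdist cancel one of them. *)
Lemma normr_dshepard v e x y : 0 <= e -> 0 < qdist e x y ->
  `|dshepard v e x y| <= (2 * N)%:R * enorm v * (shepard e x y / rdist e x y).
Proof.
move=> e0 q0; have r0 := rdist_gt0 q0.
rewrite normrN !normrM normr_nat -!mulrA ler_wpM2l//.
have -> : `|(qdist e x y)^-1 ^+ N.+1| = shepard e x y / rdist e x y / rdist e x y.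
  rewrite ger0_norm ?exprn_ge0 ?invr_ge0 ?qdist_ge0// exprSr -rdist_sqr// /shepard rdist_sqr//.
  by rewrite -mulrA -invfM -expr2 rdist_sqr.
rewrite mulrA [_ * (shepard _ _ _ / _)]mulrC -[leRHS]mulr1 -!mulrA [enorm v * _]mulrC.
rewrite -!mulrA ler_wpM2l ?shepard_ge0// ler_wpM2l ?invr_ge0 ?rdist_ge0//.
rewrite mul1r ler_pdivrMr// (le_trans (normr_dotv _ _))// [leRHS]mulrC.
by rewrite ler_wpM2r ?enorm_ge0// enorm_le_rdist.
Qed.

Lemma qdist_line e x y v t :
  qdist e (x + t *: v) y =
  qdist e x y + 2 * t * dotv (x - y) v + t ^+ 2 * enorm v ^+ 2.
Proof.
rewrite /qdist addrAC; move: (x - y) => w.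
by rewrite !enorm_dotv !(dotvDl, dotvDr, dotvZl, dotvZr) (dotvC v w); ring.
Qed.

Lemma dotv_line x y v t :
  dotv (x + t *: v - y) v = dotv (x - y) v + t * enorm v ^+ 2.
Proof. by rewrite addrAC [LHS]dotvDl dotvZl enorm_dotv. Qed.

Lemma is_derive_qdistV v e x y t : qdist e (x + t *: v) y != 0 ->
  is_derive (t : R) (1 : R) (fun t : R => (qdist e (x + t *: v) y)^-1)
    (- (2 * dotv (x + t *: v - y) v * (qdist e (x + t *: v) y)^-1 ^+ 2)).
Proof.
move=> q0.
have d : is_derive (t : R) (1 : R) (fun t : R => qdist e (x + t *: v) y)
   (2 * dotv (x + t *: v - y) v).
  rewrite (_ : (fun t => _) = (fun t : R => qdist e x y + (2 * dotv (x - y) v) * t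
     + enorm v ^+ 2 * t ^+ 2)); last by apply/funext => s; rewrite qdist_line; ring.
  apply: is_derive_eq; rewrite dotv_line /GRing.scale/=; ring.
have dV : is_derive (t : R) (1 : R) (fun t : R => (qdist e (x + t *: v) y)^-1)
    (- (qdist e (x + t *: v) y) ^- 2 *: (2 * dotv (x + t *: v - y) v)).
  by apply: is_deriveV.
by apply: is_derive_eq; rewrite exprVn /GRing.scale/=; ring.
Qed.

Lemma is_derive_shepard v e x y t : qdist e (x + t *: v) y != 0 ->
  is_derive (t : R) (1 : R) (fun t : R => shepard e (x + t *: v) y)
    (dshepard v e (x + t *: v) y).
Proof.
move=> q0; rewrite /shepard /dshepard.
have d := is_derive_qdistV q0.
have dX := @is_deriveX R R (fun t : R => (qdist e (x + t *: v) y)^-1) N t 1 _ d.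
rewrite (_ : - _ = N%:R * (qdist e (x + t *: v) y)^-1 ^+ N.-1 *:
    (- (2 * dotv (x + t *: v - y) v * (qdist e (x + t *: v) y)^-1 ^+ 2))); first (rewrite [X in
      is_derive _ _ X](_ : _ = (fun t : R => (qdist e (x + t *: v) y)^-1) ^+ N);
    [exact: dX|by apply/funext => s; rewrite fctE]).
(* The power rule involves [N.-1], hence the separate case N = 0, where both sides vanish. *)
case: (N) => [|k]; first by rewrite muln0 !mul0r scale0r oppr0.
rewrite /GRing.scale/= natrM !exprS; ring.
Qed.

Lemma continuous_dshepard v e x y : 0 < e ->
  continuous (fun t : R => dshepard v e (x + t *: v) y).
Proof.
move=> e0 t.
have q0 s : qdist e (x + s *: v) y != 0 by rewrite gt_eqF// ltr_wpDl ?sqr_ge0.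
apply: cvgN; apply: cvgM.
  apply: cvgMl_tmp; rewrite (_ : (fun s => _) = (fun s : R =>
    dotv (x - y) v + s * enorm v ^+ 2)); last by apply/funext => s; rewrite dotv_line.
  have : continuous (fun s : R => dotv (x - y) v + s * enorm v ^+ 2).
    move=> s; apply: (@continuousD R R R (cst (dotv (x - y) v)) (fun s => s * _)).
      exact: cst_continuous.
    exact: mulrr_continuous.
  by move=> /(_ t); rewrite /continuous_at dotv_line.
have d := is_derive_qdistV (q0 t).
have [dX _] := @is_deriveX R R (fun s : R => (qdist e (x + s *: v) y)^-1) N.+1 t 1 _ d.
have /differentiable_continuous := (derivable1_diffP _ _).1 dX.
by rewrite /continuous_at fctE.
Qed.

Lemma shepard_le e x y : 0 < e -> shepard e x y <= e ^- N.
Proof.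
move=> e0; rewrite /shepard exprVn lef_pV2 ?posrE ?exprn_gt0 ?ltr_wpDl ?sqr_ge0//.
by rewrite lerXn2r// ?nnegrE ?qdist_ge0 ?lerDr ?sqr_ge0// ltW.
Qed.

Lemma dshepard_le v e x y : 0 < e ->
  `|dshepard v e x y| <= (2 * N)%:R * enorm v * (e ^- N / Num.sqrt e).
Proof.
move=> e0; have q0 : 0 < qdist e x y by rewrite ltr_wpDl ?sqr_ge0.
rewrite (le_trans (normr_dshepard _ (ltW e0) q0))//.
rewrite ler_wpM2l ?mulr_ge0 ?enorm_ge0//.
apply: ler_pM; rewrite ?shepard_ge0 ?invr_ge0 ?rdist_ge0 ?shepard_le ?(ltW e0)//.
by rewrite lef_pV2 ?posrE ?rdist_gt0 ?sqrtr_gt0// ler_wsqrtr// lerDr sqr_ge0.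
Qed.

Lemma measurable_qdist e d (T : measurableType d) (f g : T -> 'rV[R]_n) :
  measurable_fun setT f -> measurable_fun setT g ->
  measurable_fun setT (fun a => qdist e (f a) (g a)).
Proof.
move=> mf mg; apply: measurable_funD => //; apply: measurable_funX.
by apply: measurable_enorm; exact: measurable_sub_rV.
Qed.

Lemma measurable_shepard e d (T : measurableType d) (f g : T -> 'rV[R]_n) :
  measurable_fun setT f -> measurable_fun setT g ->
  measurable_fun setT (fun a => shepard e (f a) (g a)).
Proof.
move=> mf mg; apply: measurable_funX.
apply: (measurableT_comp (@measurable_invr R)); exact: measurable_qdist.
Qed.

Lemma measurable_dshepard v e d (T : measurableType d) (f g : T -> 'rV[R]_n) :
  measurable_fun setT f -> measurable_fun setT g ->
  measurable_fun setT (fun a => dshepard v e (f a) (g a)).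
Proof.
move=> mf mg; apply: measurableT_comp => //; apply: measurable_funM.
  by apply: measurable_funM => //; apply: measurable_dotv; exact: measurable_sub_rV.
apply: measurable_funX.
apply: (measurableT_comp (@measurable_invr R)); exact: measurable_qdist.
Qed.

End kernel.

(** * Pointwise estimates for the Shepard average *)

Lemma powRDp (R : realType) (x r s : R) : 0 < x -> x `^ (r + s) = x `^ r * x `^ s.
Proof. by move=> x0; rewrite powRD//; apply/implyP => _; rewrite gt_eqF. Qed.

Section shepard_extension.
Variables (R : realType) (n N : nat).
Variables (nu : {measure set 'rV[R]_n -> \bar R}) (E : set 'rV[R]_n).
Hypothesis mE : measurable E.
Hypothesis nuE : (nu E < +oo)%E.
Implicit Types (u : 'rV[R]_n -> R) (x y z v : 'rV[R]_n) (e : R).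

Local Notation II f := (\int[nu]_(y in E) f y)%R.
Local Notation K := (shepard N).
Local Notation dK := (dshepard N).
Local Notation M := ((2 * N)%:R : R).

Definition mass e x := \int[nu]_(y in E) K e x y.
Definition shepard_ext e u x := (\int[nu]_(y in E) (u y * K e x y)) / mass e x.
(** The quotient rule, with the derivative of the denominator multiplied by the value of the
    quotient. For e > 0 this is the derivative along [v]; at e = 0 it enters only as the limit of
    those derivatives. *)
Definition shepard_dext v e u x :=
  ((\int[nu]_(y in E) (u y * dK v e x y)) -
   shepard_ext e u x * \int[nu]_(y in E) dK v e x y) / mass e x.
(** A probability density on [E] with respect to [nu], which is what Jensen's inequality asks
    for. *)
Definition shepard_weight e x y := K e x y / mass e x.
Local Notation sext := shepard_ext.
Local Notation dsext := shepard_dext.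
Local Notation weight := shepard_weight.

(* [x] stays away from [E], or [e > 0]: the kernels are bounded on [E]. *)
Definition away e x := 0 <= e /\ exists2 eta, 0 < eta & forall y, E y -> eta <= qdist e x y.

Lemma away_gt0 e x : 0 < e -> away e x.
Proof. by move=> e0; split; [exact: ltW|exists e => // y _; rewrite lerDr sqr_ge0]. Qed.

Lemma away_le e e' x : e <= e' -> away e x -> away e' x.
Proof.
move=> ee [e0 [eta eta0 h]]; split; first exact: le_trans ee.
by exists eta => // y /h /le_trans; apply; rewrite lerD2l.
Qed.

Lemma away_closed x : closed E -> ~ E x -> away 0 x.
Proof.
move=> cE nEx; split => //.
have /nbhs_ballP[r /= r0 rE] : nbhs x (~` E).
  by apply: open_nbhs_nbhs; split => //; exact: closed_openC.
exists (r ^+ 2); first by rewrite exprn_gt0.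
move=> y Ey; rewrite /qdist addr0 ler_pXn2r// ?nnegrE ?enorm_ge0 ?(ltW r0)//.
rewrite leNgt; apply/negP => xy; apply: (rE y) => //.
by rewrite -ball_normE/=; exact: (le_lt_trans (ler_norm_enorm _)).
Qed.

Lemma away_qdist e x y : away e x -> E y -> 0 < qdist e x y.
Proof. by move=> [_ [eta eta0 h]] /h; exact: lt_le_trans. Qed.

Lemma away_shepard_le e x : away e x -> exists C, forall y, E y -> `|K e x y| <= C.
Proof.
move=> [e0 [eta eta0 h]]; exists (eta ^- N) => y Ey.
rewrite ger0_norm ?shepard_ge0// /shepard exprVn lef_pV2 ?posrE ?exprn_gt0//.
  by rewrite lerXn2r ?nnegrE ?(ltW eta0) ?qdist_ge0 ?h.
exact: lt_le_trans (h y Ey).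
Qed.

Lemma away_rdistV_le e x : away e x -> exists C, forall y, E y -> `|(rdist e x y)^-1| <= C.
Proof.
move=> [e0 [eta eta0 h]]; exists (Num.sqrt eta)^-1 => y Ey.
have q0 : 0 < qdist e x y := lt_le_trans eta0 (h y Ey).
rewrite ger0_norm ?invr_ge0 ?rdist_ge0// lef_pV2 ?posrE ?rdist_gt0 ?sqrtr_gt0//.
by rewrite ler_wsqrtr// h.
Qed.

Lemma away_dshepard_le v e x : away e x -> exists C, forall y, E y -> `|dK v e x y| <= C.
Proof.
move=> a; have [C hC] := away_shepard_le a; have [C' hC'] := away_rdistV_le a.
exists (M * enorm v * (C * C')) => y Ey.
rewrite (le_trans (normr_dshepard _ _ _ (away_qdist a Ey))) ?(a.1)//.
rewrite ler_wpM2l ?mulr_ge0 ?enorm_ge0//.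
apply: ler_pM; rewrite ?shepard_ge0 ?invr_ge0 ?rdist_ge0 ?a.1//.
  by rewrite (le_trans _ (hC y Ey))// ler_norm.
by rewrite (le_trans _ (hC' y Ey))// ler_norm.
Qed.

Lemma measurable_shepard_r e x : measurable_fun E (K e x).
Proof. by apply: measurable_funTS; apply: (@measurable_shepard R n N). Qed.

Lemma measurable_dshepard_r v e x : measurable_fun E (dK v e x).
Proof. by apply: measurable_funTS; apply: (@measurable_dshepard R n N). Qed.

Lemma measurable_rdist_r e x : measurable_fun setT (rdist e x).
Proof.
apply: (measurableT_comp (continuous_measurable_fun (@sqrt_continuous R))).
exact: measurable_qdist.
Qed.

Lemma integrable_cst1 : nu.-integrable E (EFin \o (cst (1 : R))).
Proof.
by apply: (@integrable_bounded _ _ _ nu E mE _ 1) => // y _; rewrite normr1.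
Qed.

Lemma integrable_mul_shepard e u x : away e x -> nu.-integrable E (EFin \o u) ->
  nu.-integrable E (EFin \o (fun y => u y * K e x y)).
Proof.
move=> a iu; have [C hC] := away_shepard_le a.
by apply: integrable_mul_bounded hC => //; exact: measurable_shepard_r.
Qed.

Lemma integrable_shepard e x : away e x -> nu.-integrable E (EFin \o K e x).
Proof.
move=> a; apply: eq_integrable (integrable_mul_shepard a integrable_cst1) => // y _.
by rewrite /= mul1r.
Qed.

Lemma integrable_mul_dshepard v e u x : away e x -> nu.-integrable E (EFin \o u) ->
  nu.-integrable E (EFin \o (fun y => u y * dK v e x y)).
Proof.
move=> a iu; have [C hC] := away_dshepard_le v a.
by apply: integrable_mul_bounded hC => //; exact: measurable_dshepard_r.
Qed.

Lemma integrable_dshepard v e x : away e x -> nu.-integrable E (EFin \o dK v e x).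
Proof.
move=> a; apply: eq_integrable (integrable_mul_dshepard v a integrable_cst1) => // y _.
by rewrite /= mul1r.
Qed.

Lemma weight_ge0 e x y : 0 <= e -> 0 <= weight e x y.
Proof.
move=> e0; rewrite divr_ge0 ?shepard_ge0//.
by apply: Rintegral_ge0 => z _; exact: shepard_ge0.
Qed.

Lemma measurable_weight e x : measurable_fun E (weight e x).
Proof. by apply: measurable_funM => //; exact: measurable_shepard_r. Qed.

Lemma away_weight_le e x : away e x -> exists C, forall y, E y -> `|weight e x y| <= C.
Proof.
move=> a; have [C hC] := away_shepard_le a; exists (C * `|(mass e x)^-1|) => y Ey.
by rewrite normrM ler_wpM2r// hC.
Qed.

Lemma integrable_mul_weight e u x : away e x -> nu.-integrable E (EFin \o u) ->
  nu.-integrable E (EFin \o (fun y => u y * weight e x y)).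
Proof.
move=> a iu; have [C hC] := away_weight_le a.
by apply: integrable_mul_bounded hC => //; exact: measurable_weight.
Qed.

Lemma sext_weight e u x : away e x -> nu.-integrable E (EFin \o u) ->
  sext e u x = II (fun y => u y * weight e x y).
Proof.
move=> a iu; rewrite /shepard_ext -RintegralZr//; last exact: integrable_mul_shepard.
by apply: eq_Rintegral => y _; rewrite mulrA.
Qed.

Lemma weight_int1 e x : away e x -> 0 < mass e x ->
  (\int[nu]_(y in E) (weight e x y)%:E = 1)%E.
Proof.
move=> a m0; rewrite -EFin_Rintegral//; last first.
  apply: eq_integrable (integrable_mul_weight a integrable_cst1) => // y _.
  by rewrite /= mul1r.
by rewrite RintegralZr//; [rewrite -/(mass e x) divff ?gt_eqF|exact: integrable_shepard].
Qed.

(** The weights have integral one, so constants are reproduced by the average. *)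
Lemma subr_sext e u x c : away e x -> 0 < mass e x -> nu.-integrable E (EFin \o u) ->
  c - sext e u x = II (fun z => (c - u z) * weight e x z).
Proof.
move=> a m0 iu; rewrite sext_weight//.
have ic : nu.-integrable E (EFin \o cst c).
  by apply: (@integrable_bounded _ _ _ nu E mE _ `|c|).
transitivity (II (fun z => c * weight e x z) - II (fun z => u z * weight e x z)).
  rewrite RintegralZl//.
    by rewrite [X in _ * X - _](_ : _ = 1) ?mulr1// /Rintegral weight_int1.
  apply: eq_integrable (integrable_mul_weight a integrable_cst1) => // y _.
  by rewrite /= mul1r.
rewrite -RintegralB//.
- by apply: eq_Rintegral => z _; rewrite mulrBl.
- exact: (integrable_mul_weight a ic).
- exact: integrable_mul_weight.
Qed.

(** A rearrangement of the quotient rule that brings in the differences of [u] with its average: the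
    gradient is governed by the oscillation of [u] and not by its size. *)
Lemma dsext_sub v e u x : away e x -> nu.-integrable E (EFin \o u) ->
  dsext v e u x = II (fun y => (u y - sext e u x) * dK v e x y) / mass e x.
Proof.
move=> a iu; rewrite /shepard_dext -RintegralZl//; last exact: integrable_dshepard.
congr (_ / _); rewrite -RintegralB//.
- by apply: eq_Rintegral => y _; rewrite mulrBl.
- exact: integrable_mul_dshepard.
- apply: (@integrable_mul_dshepard _ _ (cst (sext e u x))) => //.
  by apply: (@integrable_bounded _ _ _ nu E mE _ `|sext e u x|).
Qed.

Lemma powR_sext_le e u x (p : R) : away e x -> 0 < mass e x -> 1 < p ->
  nu.-integrable E (EFin \o u) ->
  ((`|sext e u x| `^ p)%:E <= \int[nu]_(y in E) (`|u y| `^ p * weight e x y)%:E)%E.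
Proof.
move=> a m0 p1 iu.
have iau := integrable_norm iu.
apply: (@le_trans _ _ ((II (fun y => `|u y| * weight e x y)) `^ p)%:E).
  rewrite lee_fin ge0_ler_powR ?nnegrE//; first lra.
    by apply: Rintegral_ge0 => y _; rewrite mulr_ge0 ?weight_ge0// a.1.
  rewrite sext_weight// (le_trans (le_normr_Rintegral _ _))//.
    exact: integrable_mul_weight.
  rewrite le_eqVlt; apply/orP; left; apply/eqP; apply: eq_Rintegral => y _.
  by rewrite normrM [`|weight _ _ _|]ger0_norm// weight_ge0// a.1.
apply: powR_jensen => //.
- exact: measurable_weight.
- by apply: measurable_of_integrable iau.
- by move=> y _; rewrite weight_ge0// a.1.
- exact: weight_int1.
- exact: integrable_mul_weight.
Qed.

(** The bound on the kernel derivative turns it back into the weight at the price of one inverse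
    distance. *)
Lemma normr_dsext_le v e u x : away e x -> 0 < mass e x -> nu.-integrable E (EFin \o u) ->
  `|dsext v e u x| <= M * enorm v *
    II (fun y => `|u y - sext e u x| * (rdist e x y)^-1 * weight e x y).
Proof.
move=> a m0 iu; rewrite dsext_sub//.
have ic : nu.-integrable E (EFin \o cst (sext e u x)).
  by apply: (@integrable_bounded _ _ _ nu E mE _ `|sext e u x|).
have id : nu.-integrable E (EFin \o (fun y => u y - sext e u x)).
  exact: integrable_subr.
have [C hC] := away_rdistV_le a.
have mr : measurable_fun E (fun y => (rdist e x y)^-1).
  apply: (measurableT_comp (@measurable_invr R)).
  by apply: measurable_funTS; exact: measurable_rdist_r.
have iw : nu.-integrable E (EFin \o (fun y => `|u y - sext e u x| * (rdist e x y)^-1 * weight e x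
  y)).
  apply: integrable_mul_weight => //; apply: integrable_mul_bounded hC => //.
  exact: (integrable_norm id).
rewrite -RintegralZr//; last exact: integrable_mul_dshepard.
rewrite -RintegralZl//.
have i1 : nu.-integrable E (EFin \o (fun y => (u y - sext e u x) * dK v e x y / mass e x)).
  by apply: integrable_mulr => //; exact: integrable_mul_dshepard.
rewrite (le_trans (le_normr_Rintegral _ _))//; apply: le_Rintegral => //.
- exact: (integrable_norm i1).
- apply: eq_integrable (integrable_mulr mE (M * enorm v) iw) => // y _.
  by rewrite /= mulrC.
- move=> y Ey /=; rewrite normrM normrM [`|(mass _ _)^-1|]ger0_norm ?invr_ge0 ?(ltW m0)//.
  rewrite [leRHS](_ : _ = `|u y - sext e u x| * (M * enorm v * (K e x y / rdist e x y)) / mass e x).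
    rewrite ler_wpM2r ?invr_ge0 ?(ltW m0)// ler_wpM2l// normr_dshepard ?(a.1)//.
    exact: away_qdist.
  by rewrite /shepard_weight; ring.
Qed.

(** Only the ball about [y] with radius r = rdist e x y is kept in the integral: on it the kernel is
    at least (3r)^(-M), and its measure is at least cl r^Q. *)
Lemma mass_lower (Q T cl : R) e x y : 0 < cl ->
  (forall y (r : R), E y -> 0 < r <= T ->
    ((cl * r `^ Q)%:E <= nu (E `&` eball y r))%E) ->
  away e x -> E y -> rdist e x y <= T ->
  (3 `^ M / cl)^-1 * rdist e x y `^ (Q - M) <= mass e x.
Proof.
move=> cl0 nu_low a Ey rT; have e0 := a.1; have q0 := away_qdist a Ey.
have r0 : 0 < rdist e x y := rdist_gt0 q0.
have m30 : 0 < 3 * rdist e x y by rewrite mulr_gt0.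
rewrite -lee_fin EFin_Rintegral//; last exact: integrable_shepard.
have mEb : measurable (E `&` eball y (rdist e x y)).
  by apply: measurableI => //; exact: measurable_eball.
apply: (@le_trans _ _ (\int[nu]_(z in E `&` eball y (rdist e x y))
    (((3 * rdist e x y) `^ (- M))%:E))%E); last first.
  apply: (@le_trans _ _ (\int[nu]_(z in E `&` eball y (rdist e x y)) (K e x z)%:E)%E).
    apply: ge0_le_integral => //.
    - by move=> z _; rewrite lee_fin powR_ge0.
    - apply/measurable_EFinP; apply: (@measurable_funS _ _ _ _ E) => //.
      exact: measurable_shepard_r.
    - move=> z [Ez yz]; rewrite lee_fin shepardE// ?(away_qdist a)//.
      apply: powRN_anti; rewrite ?rdist_gt0 ?(away_qdist a)//.
      by apply: rdist_le3 => //; exact: ltW.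
  apply: ge0_subset_integral => //.
  - by apply/measurable_EFinP; exact: measurable_shepard_r.
  - by move=> z _; rewrite lee_fin shepard_ge0.
rewrite integral_cst//.
have ry : 0 < rdist e x y <= T by rewrite r0.
apply: le_trans (lee_wpmul2l _ (nu_low y (rdist e x y) Ey ry)).
  rewrite -EFinM lee_fin powRM ?(ltW r0)// powRDp//.
  rewrite invf_div powRN (powRN _ M) le_eqVlt; apply/orP; left; apply/eqP; ring.
by rewrite lee_fin powR_ge0.
Qed.

(** * Consequences of the lower bound on the mass *)

Section lower_bounded_mass.
Variables (Q T p Cm : R).
Hypothesis Q0 : 0 < Q.
Hypothesis Cm0 : 0 < Cm.
Hypothesis mass_low : forall e x y, away e x -> E y -> rdist e x y <= T ->
  Cm^-1 * rdist e x y `^ (Q - M) <= mass e x.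
Hypothesis p1 : 1 < p.
Hypothesis Mp : p + 2 * Q <= M.

Lemma mass_gt0 e x y : away e x -> E y -> rdist e x y <= T -> 0 < mass e x.
Proof.
move=> a Ey rT; apply: lt_le_trans (mass_low a Ey rT).
by rewrite mulr_gt0 ?invr_gt0 ?Cm0// powR_gt0// rdist_gt0// (away_qdist a).
Qed.

Lemma massV_le e x y : away e x -> E y -> rdist e x y <= T ->
  (mass e x)^-1 <= Cm * rdist e x y `^ (M - Q).
Proof.
move=> a Ey rT; have r0 : 0 < rdist e x y := rdist_gt0 (away_qdist a Ey).
rewrite -[leRHS]invrK lef_pV2 ?posrE ?invr_gt0 ?mulr_gt0 ?Cm0 ?powR_gt0 ?(mass_gt0 a Ey)//.
rewrite invfM -powRN opprB.
exact: mass_low.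
Qed.

(** The same distance r controls the kernel, r^(-M), and the inverse mass, r^(M-Q), so that M
    cancels. *)
Lemma weight_le e x y : away e x -> E y -> rdist e x y <= T ->
  weight e x y <= Cm * rdist e x y `^ (- Q).
Proof.
move=> a Ey rT; have q0 := away_qdist a Ey; have r0 := rdist_gt0 q0.
rewrite /shepard_weight shepardE ?(a.1)//.
rewrite (le_trans (ler_wpM2l (powR_ge0 _ _) (massV_le a Ey rT)))//.
rewrite mulrCA -powRDp//.
by rewrite addrA addNr add0r.
Qed.

(** Let r be the smaller of the two distances and s the larger one. Bounding the inverse mass
    through the nearer point gives Cm^2 r^(M-2Q-p) s^(-M), and r may be replaced by s because the
    exponent M - 2Q - p is nonnegative. *)
Lemma weight2_le e x y z : away e x -> E y -> E z -> rdist e x y <= T -> rdist e x z <= T ->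
  (rdist e x y) `^ (- p) * weight e x y * weight e x z <=
  Cm ^+ 2 * (Num.max (rdist e x y) (rdist e x z)) `^ (- (p + 2 * Q)).
Proof.
move=> a Ey Ez yT zT; have qy := away_qdist a Ey; have qz := away_qdist a Ez.
have ry := rdist_gt0 qy; have rz := rdist_gt0 qz; have e0 := a.1.
rewrite /shepard_weight !shepardE//.
have m0 := mass_gt0 a Ey yT.
have key r s : 0 < r -> r <= s -> (mass e x)^-1 <= Cm * r `^ (M - Q) ->
    r `^ (- p) * (r `^ (- M) / mass e x) * (s `^ (- M) / mass e x) <=
    Cm ^+ 2 * s `^ (- (p + 2 * Q)).
  move=> r0 rs h; have s0 : 0 < s by exact: lt_le_trans rs.
  have h2 : (mass e x)^-1 ^+ 2 <= (Cm * r `^ (M - Q)) ^+ 2.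
    rewrite ler_pXn2r ?nnegrE ?invr_ge0 ?(ltW m0)//.
    by rewrite mulr_ge0 ?powR_ge0 ?ltW ?Cm0.
  rewrite [leLHS](_ : _ = r `^ (- p) * r `^ (- M) * s `^ (- M) * (mass e x)^-1 ^+ 2); last by ring.
  rewrite (le_trans (ler_wpM2l _ h2)) ?mulr_ge0 ?powR_ge0//.
  rewrite [leLHS](_ : _ = Cm ^+ 2 * (r `^ (M - 2 * Q - p) * s `^ (- M))); last first.
    rewrite exprMn -[(r `^ _) ^+ 2]powR_mulrn ?powR_ge0// -powRrM.
    rewrite (_ : M - 2 * Q - p = - p + (- M) + (M - Q) * 2%:R); last by ring.
    by rewrite !(powRDp _ _ r0); ring.
  rewrite ler_wpM2l ?sqr_ge0//.
  rewrite (_ : - (p + 2 * Q) = (M - 2 * Q - p) + - M); last by ring.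
  rewrite (powRDp _ _ s0).
  by rewrite ler_wpM2r ?powR_ge0// ge0_ler_powR ?nnegrE ?(ltW r0) ?(ltW s0)//; move: Mp; lra.
have [yz|zy] := leP (rdist e x y) (rdist e x z).
  by apply: key => //; exact: massV_le.
(* When [z] is the nearer point, replacing the distance to [y] by the distance to [z] in the factor
   of power -p only increases it; then [key] applies with the roles exchanged. *)
apply: (@le_trans _ _ (rdist e x z `^ (- p) * (rdist e x z `^ (- M) / mass e x) *
    (rdist e x y `^ (- M) / mass e x))); last first.
  by apply: key => //; [exact: ltW|exact: massV_le].
have fin (f g h k : R) : 0 <= h * k -> f <= g -> f * h * k <= g * k * h.
  by move=> hk fg; rewrite -!mulrA [k * h]mulrC ler_wpM2r.
apply: fin; first by rewrite !mulr_ge0 ?powR_ge0 ?invr_ge0 ?(ltW m0).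
by apply: powRN_anti => //; [move: p1; lra|exact: ltW].
Qed.

(** A majorant of the product of two weights that no longer contains [e]. The truncation at |y - z|
    / 2 removes the singularity at x = y, so that its integral in x is finite for y != z. *)
Definition offdiag x (yz : 'rV[R]_n * 'rV[R]_n) :=
  Num.max (enorm (yz.1 - yz.2) / 2) (enorm (x - yz.1)) `^ (- (p + 2 * Q)).

(** Both terms of the maximum in [offdiag] are at most the larger regularised distance, by the
    triangle inequality. The points must differ: at x = y = z the maximum is 0 and its negative
    power is 0 by convention. *)
Lemma weight2_offdiag e x y z : away e x -> E y -> E z -> rdist e x y <= T ->
  rdist e x z <= T -> y != z ->
  (rdist e x y) `^ (- p) * weight e x y * weight e x z <= Cm ^+ 2 * offdiag x (y, z).
Proof.
move=> a Ey Ez yT zT yz; have e0 := a.1.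
rewrite (le_trans (weight2_le a Ey Ez yT zT))// ler_wpM2l ?sqr_ge0//.
have n0 : 0 < enorm (y - z).
  rewrite lt_def enorm_ge0 andbT; apply: contra yz => /eqP h.
  by have := ler_norm_enorm (y - z); rewrite h normr_le0 subr_eq0.
apply: powRN_anti; first by move: p1 Q0; lra.
  by rewrite lt_max divr_gt0.
have h1 := enorm_le_rdist x y e0; have h2 := enorm_le_rdist x z e0.
rewrite ge_max; apply/andP; split; last by rewrite le_max h1.
have := enorm_distD x y z; rewrite (enormC y x) => h3.
have [r12|r12] := leP (rdist e x y) (rdist e x z); lra.
Qed.

Lemma measurable_offdiag (u : 'rV[R]_n -> R) : measurable_fun setT u ->
  measurable_fun setT (fun w : 'rV[R]_n * ('rV[R]_n * 'rV[R]_n) =>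
    (`|u w.2.1 - u w.2.2| `^ p * offdiag w.1 w.2)%:E).
Proof.
move=> mu; apply/measurable_EFinP; apply: measurable_funM.
  apply: (measurableT_comp (measurable_powR _)); apply: measurableT_comp => //.
  apply: measurable_funB; apply: (measurableT_comp mu).
  - by apply: (measurableT_comp measurable_fst); exact: measurable_snd.
  - by apply: (measurableT_comp measurable_snd); exact: measurable_snd.
apply: (measurableT_comp (measurable_powR _)); apply: measurable_maxr.
  apply: measurable_funM => //; apply: measurable_enorm; apply: measurable_sub_rV.
  - by apply: (measurableT_comp measurable_fst); exact: measurable_snd.
  - by apply: (measurableT_comp measurable_snd); exact: measurable_snd.
apply: measurable_enorm; apply: measurable_sub_rV; first exact: measurable_fst.
by apply: (measurableT_comp measurable_fst); exact: measurable_snd.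
Qed.

Lemma measurable_offdiag_r (u : 'rV[R]_n -> R) x : measurable_fun setT u ->
  measurable_fun setT (fun w : 'rV[R]_n * 'rV[R]_n =>
    (`|u w.1 - u w.2| `^ p * offdiag x w)%:E).
Proof.
move=> mu; exact: (measurableT_comp (measurable_offdiag mu) (pair1_measurable x)).
Qed.

(** Jensen's inequality is applied twice: to the average over [y] in the gradient bound, and to the
    difference of [u y] with the average of [u], which is itself the average of u y - u z over
    [z]. *)
Lemma powR_dsext_le v e u x : away e x -> (forall y, E y -> rdist e x y <= T) ->
  measurable_fun setT u -> nu.-integrable E (EFin \o u) ->
  ((`|dsext v e u x| `^ p)%:E <= ((M * enorm v) `^ p * Cm ^+ 2)%:E *
    \int[nu]_(y in E) (\int[nu]_(z in E) (`|u y - u z| `^ p * offdiag x (y, z))%:E))%E.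
Proof.
move=> a xT mu iu.
have p0 : 0 <= p by move: p1; lra.
have e0 := a.1.
(* For empty [E] the mass is 0 and so is its inverse, hence [dsext] vanishes. *)
have [[y0 Ey0]|E0] := pselect (exists y, E y); last first.
  have -> : dsext v e u x = 0.
    by rewrite /shepard_dext /mass (_ : E = set0) ?Rintegral_set0 ?invr0 ?mulr0//; apply/seteqP;
      split => // y Ey; apply: E0; exists y.
  have P0 : 0 <= (M * enorm v) `^ p * Cm ^+ 2 by apply: mulr_ge0; rewrite ?powR_ge0 ?sqr_ge0.
  rewrite normr0 powR0; last by rewrite gt_eqF//; move: p1; lra.
  apply: mule_ge0; first by rewrite lee_fin.
  by apply: integral_ge0 => y _; apply: integral_ge0 => z _; rewrite lee_fin mulr_ge0 ?powR_ge0.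
have m0 := mass_gt0 a Ey0 (xT _ Ey0).
have ic c : nu.-integrable E (EFin \o cst c).
  by apply: (@integrable_bounded _ _ _ nu E mE _ `|c|).
have id c : nu.-integrable E (EFin \o (fun y => u y - c)).
  exact: (integrable_subr mE iu (ic _)).
have id' c : nu.-integrable E (EFin \o (fun y => c - u y)).
  exact: (integrable_subr mE (ic _) iu).
have [C hC] := away_rdistV_le a.
have mr : measurable_fun E (fun y => (rdist e x y)^-1).
  apply: (measurableT_comp (@measurable_invr R)).
  by apply: measurable_funTS; exact: measurable_rdist_r.
have ig : nu.-integrable E (EFin \o (fun y => `|u y - sext e u x| * (rdist e x y)^-1)).
  by apply: integrable_mul_bounded hC => //; exact: (integrable_norm (id _)).
set I1 := II (fun y => `|u y - sext e u x| * (rdist e x y)^-1 * weight e x y).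
have I10 : 0 <= I1.
  by apply: Rintegral_ge0 => y _; apply: mulr_ge0; [apply: mulr_ge0 => //; rewrite invr_ge0
    rdist_ge0|exact: weight_ge0].
apply: (@le_trans _ _ ((M * enorm v) `^ p * I1 `^ p)%:E).
  rewrite lee_fin -powRM ?mulr_ge0 ?enorm_ge0// ge0_ler_powR ?nnegrE ?mulr_ge0 ?enorm_ge0//.
  exact: normr_dsext_le.
rewrite !EFinM -muleA lee_wpmul2l ?lee_fin ?powR_ge0//.
apply: (@le_trans _ _ (\int[nu]_(y in E)
    ((`|u y - sext e u x| * (rdist e x y)^-1) `^ p * weight e x y)%:E)%E).
  apply: powR_jensen => //.
  - exact: measurable_weight.
  - exact: measurable_of_integrable ig.
  - by move=> y _; exact: weight_ge0.
  - by move=> y _; rewrite mulr_ge0// invr_ge0 rdist_ge0.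
  - exact: weight_int1.
  - exact: integrable_mul_weight.
have mo := measurable_offdiag_r x mu.
have o0 w : (0 <= (`|u w.1 - u w.2| `^ p * offdiag x w)%:E)%E.
  by rewrite lee_fin mulr_ge0 ?powR_ge0.
have mi := measurable_ge0_integral_param mE nuE mo o0.
rewrite -ge0_integralZl_EFin ?sqr_ge0//; last 2 first.
- by move=> y _; apply: integral_ge0 => z _; exact: (o0 (y, z)).
- exact: measurable_funTS mi.
have mgw : measurable_fun E (fun y => (`|u y - sext e u x| * (rdist e x y)^-1) `^ p * weight e x y).
  apply: measurable_funM; last exact: measurable_weight.
  by apply: (measurableT_comp (measurable_powR _)); exact: measurable_of_integrable ig.
apply: ge0_le_integral => //.
- by move=> y _; rewrite lee_fin mulr_ge0 ?powR_ge0 ?weight_ge0.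
- exact/measurable_EFinP.
- by apply: measurable_funeM; exact: measurable_funTS mi.
move=> y Ey.
have ry : 0 < rdist e x y by rewrite rdist_gt0// (away_qdist a).
rewrite powRM ?invr_ge0 ?rdist_ge0// -powR_inv1 ?rdist_ge0// -powRrM mulN1r.
set c := rdist e x y `^ (- p) * weight e x y.
have c0 : 0 <= c by rewrite mulr_ge0 ?powR_ge0 ?weight_ge0.
have mz : measurable_fun E (fun z => `|u y - u z|).
  by apply: measurable_of_integrable (integrable_norm (id' _)).
have mzp : measurable_fun E (fun z => `|u y - u z| `^ p * weight e x z).
  by apply: measurable_funM; [exact: (measurableT_comp (measurable_powR _))|exact:
    measurable_weight].
have ym : measurable_fun E (fun z => (`|u y - u z| `^ p * offdiag x (y, z))%:E).
  by apply: measurable_funTS; exact: (measurableT_comp mo (pair1_measurable y)).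
apply: (@le_trans _ _ (c%:E * \int[nu]_(z in E) (`|u y - u z| `^ p * weight e x z)%:E)%E).
  rewrite -mulrA -/c mulrC EFinM.
  rewrite lee_wpmul2l ?lee_fin//.
  apply: (@le_trans _ _ ((II (fun z => `|u y - u z| * weight e x z)) `^ p)%:E).
    rewrite lee_fin ge0_ler_powR ?nnegrE//.
      by apply: Rintegral_ge0 => z _; rewrite mulr_ge0 ?weight_ge0.
    rewrite (subr_sext _ a m0 iu) (le_trans (le_normr_Rintegral _ _))//.
      exact: (integrable_mul_weight a (id' _)).
    rewrite le_eqVlt; apply/orP; left; apply/eqP; apply: eq_Rintegral => z _.
    by rewrite normrM [`|weight _ _ _|]ger0_norm// weight_ge0.
  apply: powR_jensen => //.
  - exact: measurable_weight.
  - by move=> z _; exact: weight_ge0.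
  - exact: weight_int1.
  - exact: (integrable_mul_weight a (integrable_norm (id' _))).
rewrite -!ge0_integralZl_EFin ?sqr_ge0//; last 2 first.
- by move=> z _; rewrite lee_fin mulr_ge0 ?powR_ge0 ?weight_ge0.
- exact/measurable_EFinP.
apply: ge0_le_integral => //.
- by move=> z _; apply: mule_ge0; rewrite lee_fin// mulr_ge0 ?powR_ge0 ?weight_ge0.
- by apply: measurable_funeM; exact/measurable_EFinP.
- exact: measurable_funeM.
- move=> z Ez; rewrite -!EFinM lee_fin mulrCA [leRHS]mulrCA.
  have [->|yz] := eqVneq y z.
    by rewrite subrr normr0 powR0 ?mul0r// gt_eqF//; move: p1; lra.
  rewrite ler_wpM2l ?powR_ge0//; apply: weight2_offdiag => //; exact: xT.
- by move=> z _; exact: (o0 (y, z)).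
Qed.

End lower_bounded_mass.

End shepard_extension.

(** * Energy estimates *)

(** The integral of a nonnegative function is a supremum over the simple functions below it, which
    is monotone without any measurability. This allows comparison with the Besov integrand, where
    the measure of a ball depends on the variables. *)
Lemma ge0_le_integral_nomeas d (T : measurableType d) (R : realType)
    (mu : {measure set T -> \bar R}) (D : set T) (f g : T -> \bar R) :
  (forall x, D x -> 0 <= f x)%E -> (forall x, D x -> f x <= g x)%E ->
  (\int[mu]_(x in D) f x <= \int[mu]_(x in D) g x)%E.
Proof.
move=> f0 fg; rewrite !ge0_integralE//; last first.
  by move=> x Dx; rewrite (le_trans (f0 x Dx))// fg.
apply: ge_ereal_sup => _ [h /= hf <-]; apply: ereal_sup_ubound; exists h => //= x.
rewrite (le_trans (hf x))// !patchE; case: ifPn => // /set_mem; exact: fg.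
Qed.

Section energy.
Variables (R : realType) (n : nat).
Variables (nu P : {measure set 'rV[R]_n -> \bar R}) (E B : set 'rV[R]_n).
Variables (Q p theta T CP Cu : R).
Hypothesis mE : measurable E.
Hypothesis nuE : (nu E < +oo)%E.
Hypothesis mB : measurable B.
Hypothesis PB : (P B < +oo)%E.
Hypothesis Q0 : 0 < Q.
Hypothesis p1 : 1 < p.
Hypothesis theta01 : 0 < theta < 1.
Hypothesis T0 : 0 < T.
Hypothesis BET : forall x y, B x -> E y -> enorm (x - y) < T.
Hypothesis CP0 : 0 <= CP.
Hypothesis Cu0 : 0 < Cu.
Local Notation s := (Q + p * (1 - theta)).
Hypothesis growth : forall y (r : R), E y -> 0 < r ->
  (P (B `&` eball y r) <= (CP * r `^ s)%:E)%E.
Hypothesis nu_up : forall y (r : R), E y -> 0 < r ->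
  (0 < nu (eball y r) <= (Cu * r `^ Q)%:E)%E.
Implicit Types (u : 'rV[R]_n -> R) (x y z v : 'rV[R]_n).

Lemma measurable_dist y : measurable_fun setT (fun x : 'rV[R]_n => enorm (y - x)).
Proof. by apply: measurable_enorm; apply: measurable_sub_rV. Qed.

Definition potential_const := CP * 2 `^ Q / (1 - 2^-1 `^ (s - Q)) * T `^ (s - Q).

(** After Tonelli the integral in x falls under [integral_near] with exponent Q, and Q < s because
    theta < 1. *)
Lemma integral_potential u : measurable_fun setT u ->
  (\int[P]_(x in B) \int[nu]_(y in E) (`|u y| `^ p * enorm (x - y) `^ (- Q))%:E <=
   potential_const%:E * \int[nu]_(y in E) (`|u y| `^ p)%:E)%E.
Proof.
move=> mu.
have mup : measurable_fun setT (fun y => `|u y| `^ p).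
  by apply: (measurableT_comp (measurable_powR _)); exact: measurableT_comp.
have mf : measurable_fun setT (fun xy : 'rV[R]_n * 'rV[R]_n =>
    (`|u xy.2| `^ p * enorm (xy.1 - xy.2) `^ (- Q))%:E).
  apply/measurable_EFinP; apply: measurable_funM.
    exact: (measurableT_comp mup measurable_snd).
  apply: (measurableT_comp (measurable_powR _)); apply: measurable_enorm.
  by apply: measurable_sub_rV; [exact: measurable_fst|exact: measurable_snd].
have /andP[t0 t1] := theta01.
have ps : 0 < p * (1 - theta) by rewrite mulr_gt0//; [move: p1|]; lra.
have pc0 : 0 <= potential_const.
  rewrite !mulr_ge0 ?powR_ge0// invr_ge0 subr_ge0.
  rewrite -[leRHS](powRr0 (2^-1:R)) addrAC subrr add0r.
  by apply: ger_powR; [apply/andP; split; lra|exact: ltW].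
have := @tonelli_on _ _ _ _ R P nu B E _ mB PB mE nuE mf.
move=> -> /=; last by move=> z; rewrite lee_fin mulr_ge0 ?powR_ge0.
rewrite -ge0_integralZl_EFin//; last first.
  by apply/measurable_EFinP; exact: measurable_funTS.
apply: ge0_le_integral => //.
- by move=> y _; apply: integral_ge0 => x _; rewrite lee_fin mulr_ge0 ?powR_ge0.
- have mf' : measurable_fun setT (fun yx : 'rV[R]_n * 'rV[R]_n =>
    (`|u yx.1| `^ p * enorm (yx.2 - yx.1) `^ (- Q))%:E).
    exact: (measurableT_comp mf (@measurable_swap _ _ _ _)).
  have := @measurable_ge0_integral_param _ _ _ _ R P B _ mB PB mf'.
  move=> h; apply: measurable_funTS; apply: h => z.
  by rewrite lee_fin mulr_ge0 ?powR_ge0.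
- by apply: measurable_funeM; apply/measurable_EFinP; exact: measurable_funTS.
move=> y Ey; under eq_integral do rewrite EFinM enormC.
rewrite ge0_integralZl_EFin ?powR_ge0//; last 2 first.
- by move=> x _; rewrite lee_fin powR_ge0.
- apply/measurable_EFinP; apply: (measurableT_comp (measurable_powR _)).
  by apply: measurable_funTS; exact: measurable_dist.
rewrite muleC lee_wpmul2r ?lee_fin ?powR_ge0//.
apply: (integral_near mB (measurable_dist y) CP0 T0).
- by rewrite Q0 ltrDl.
- by move=> x Bx; rewrite enorm_ge0 enormC BET.
- by move=> r r0; exact: growth.
Qed.

(** The first factors are the constant of [integral_far] for the exponent p + 2Q; the power 2^(Q +
    theta p) comes from the truncation radius |y - z| / 2, and [Cu] from exchanging |y - z|^Q for
    the measure of a ball. *)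
Definition offdiag_const :=
  CP * 2 `^ (p + 2 * Q) / (1 - 2 `^ (s - (p + 2 * Q))) * 2 `^ (Q + theta * p) * Cu.

Lemma offdiag_const_ge0 : 0 <= offdiag_const.
Proof.
have /andP[t0 t1] := theta01.
have pt : 0 < p * theta by rewrite mulr_gt0//; move: p1; lra.
rewrite !mulr_ge0 ?powR_ge0 ?(ltW Cu0)// invr_ge0 subr_ge0.
rewrite -[leRHS](powRr0 (2:R)); apply: ler_powR; first lra.
by rewrite mulrBr; move: Q0; lra.
Qed.

(** Integrating in x first, [integral_far] with del = |y - z| / 2 leaves the power s - (p + 2Q) =
    -(Q + theta p) of |y - z|. The upper bound on [nu] then replaces |y - z|^(-Q) by the inverse
    measure of the ball about y. *)
Lemma integral_offdiag u : measurable_fun setT u ->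
  (\int[P]_(x in B) \int[nu]_(y in E) \int[nu]_(z in E)
      (`|u y - u z| `^ p * offdiag Q p x (y, z))%:E <=
   offdiag_const%:E * besov_energy nu p theta E u)%E.
Proof.
move=> mu; have /andP[t0 t1] := theta01.
have pt : 0 < p * theta by rewrite mulr_gt0//; move: p1; lra.
have mo := measurable_offdiag Q p mu.
have mo1 : measurable_fun setT (fun w : ('rV[R]_n * 'rV[R]_n) * 'rV[R]_n =>
    (`|u w.1.2 - u w.2| `^ p * offdiag Q p w.1.1 (w.1.2, w.2))%:E).
  have ma : measurable_fun setT (fun w : ('rV[R]_n * 'rV[R]_n) * 'rV[R]_n => (w.1.1, (w.1.2, w.2))).
    apply: measurable_fun_pair.
      exact: (measurableT_comp measurable_fst measurable_fst).
    apply: measurable_fun_pair => //.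
    exact: (measurableT_comp measurable_snd measurable_fst).
  exact: (measurableT_comp mo ma).
have o0 a b c : (0 <= (`|u a - u b| `^ p * offdiag Q p c (a, b))%:E)%E.
  by rewrite lee_fin mulr_ge0 ?powR_ge0.
have mF : measurable_fun setT (fun w : 'rV[R]_n * 'rV[R]_n =>
   \int[nu]_(z in E) (`|u w.2 - u z| `^ p * offdiag Q p w.1 (w.2, z))%:E)%E.
  by apply: (measurable_ge0_integral_param mE nuE mo1) => -[[a b] c] /=; exact: o0.
have -> := @tonelli_on _ _ _ _ R P nu B E _ mB PB mE nuE mF; last first.
  by move=> -[a b]; apply: integral_ge0 => z _ /=; exact: o0.
(* [k] is the Besov integrand with the measure of the ball replaced by its upper bound, a function
   whose joint measurability is evident. *)
pose k (y z : 'rV[R]_n) := `|u y - u z| `^ p * (enorm (y - z) `^ (- (Q + theta * p)) / Cu).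
have k0 y z : 0 <= k y z by rewrite !mulr_ge0 ?powR_ge0 ?invr_ge0 ?(ltW Cu0).
have mk : measurable_fun setT (fun w : 'rV[R]_n * 'rV[R]_n => (k w.1 w.2)%:E).
  apply/measurable_EFinP; apply: measurable_funM.
    apply: (measurableT_comp (measurable_powR _)); apply: measurableT_comp => //.
    by apply: measurable_funB; apply: (measurableT_comp mu).
  apply: measurable_funM => //; apply: (measurableT_comp (measurable_powR _)).
  by apply: measurable_enorm; exact: measurable_sub_rV.
have mk1 y : measurable_fun setT (fun z => (k y z)%:E).
  exact: (measurableT_comp mk (pair1_measurable y)).
have mki : measurable_fun setT (fun y => \int[nu]_(z in E) (k y z)%:E)%E.
  by apply: (measurable_ge0_integral_param mE nuE mk) => -[a b]; rewrite lee_fin.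
have c0 := offdiag_const_ge0.
apply: (@le_trans _ _ (offdiag_const%:E * \int[nu]_(y in E) \int[nu]_(z in E) (k y z)%:E)%E);
  last first.
  rewrite lee_wpmul2l ?lee_fin// /besov_energy.
  apply: ge0_le_integral_nomeas => y Ey; first by apply: integral_ge0 => z _; rewrite lee_fin.
  apply: ge0_le_integral_nomeas => z Ez; rewrite lee_fin// /k distrC.
  have [->|yz] := eqVneq y z.
    by rewrite subrr normr0 powR0 ?mul0r// gt_eqF//; move: p1; lra.
  have r0 : 0 < enorm (y - z).
    rewrite lt_def enorm_ge0 andbT; apply: contra yz => /eqP h.
    by have := ler_norm_enorm (y - z); rewrite h normr_le0 subr_eq0.
  rewrite ler_wpM2l ?powR_ge0//.
  (* Positivity and finiteness both matter: for a ball of measure 0 or infinity, [fine] followed by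
     inversion would give 0. *)
  have /andP[n0 nC] := nu_up Ey r0.
  have nfin : nu (eball y (enorm (y - z))) \is a fin_num.
    by rewrite ge0_fin_numE ?(ltW n0)// (le_lt_trans nC)// ltry.
  have f0 : 0 < fine (nu (eball y (enorm (y - z)))).
    by rewrite fine_gt0// n0/= -ge0_fin_numE ?(ltW n0).
  rewrite powRN -invfM lef_pV2 ?posrE ?mulr_gt0 ?powR_gt0//.
  rewrite [Q + _]addrC powRDp// -mulrA ler_wpM2l ?powR_ge0//.
  by rewrite -lee_fin fineK// mulrC.
rewrite -ge0_integralZl_EFin//; last 2 first.
- by move=> y _; apply: integral_ge0 => z _; rewrite lee_fin.
- exact: measurable_funTS.
apply: ge0_le_integral_nomeas => y Ey.
  by apply: integral_ge0 => x _; apply: integral_ge0 => z _ /=; exact: o0.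
have mG : measurable_fun setT (fun w : 'rV[R]_n * 'rV[R]_n =>
    (`|u y - u w.2| `^ p * offdiag Q p w.1 (y, w.2))%:E).
  have ma : measurable_fun setT (fun w : 'rV[R]_n * 'rV[R]_n => ((w.1, y), w.2)).
    apply: measurable_fun_pair => //; exact: measurable_fun_pair.
  exact: (measurableT_comp mo1 ma).
have /= -> := @tonelli_on _ _ _ _ R P nu B E _ mB PB mE nuE mG; last by move=> -[a b] /=; exact: o0.
rewrite -ge0_integralZl_EFin//; last 2 first.
- by move=> z _; rewrite lee_fin.
- exact: measurable_funTS.
apply: ge0_le_integral_nomeas => z Ez; first by apply: integral_ge0 => x _; exact: o0.
rewrite /k; have [->|yz] := eqVneq y z.
  rewrite (eq_integral (cst 0%E)) ?integral0.
    by rewrite subrr normr0 powR0 ?mul0r ?mule0// gt_eqF//; move: p1; lra.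
  by move=> x _; rewrite subrr normr0 powR0 ?mul0r// gt_eqF//; move: p1; lra.
have r0 : 0 < enorm (y - z).
  rewrite lt_def enorm_ge0 andbT; apply: contra yz => /eqP h.
  by have := ler_norm_enorm (y - z); rewrite h normr_le0 subr_eq0.
under eq_integral do rewrite EFinM.
have m1 : measurable_fun B (fun x => offdiag Q p x (y, z)).
  apply: measurable_funTS; apply: (measurableT_comp (measurable_powR _)).
  apply: measurable_maxr => //; apply: measurable_enorm; exact: measurable_sub_rV.
rewrite ge0_integralZl_EFin ?powR_ge0//; last 2 first.
- by move=> x _; rewrite lee_fin powR_ge0.
- exact/measurable_EFinP.
rewrite [X in (_ <= _ * X)%E]EFinM muleCA lee_wpmul2l ?lee_fin ?powR_ge0//.
have ha : 0 <= s < p + 2 * Q.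
  apply/andP; split; last by rewrite mulrBr; move: Q0; lra.
  by rewrite addr_ge0 ?(ltW Q0)// mulr_ge0; move: p1; lra.
have r20 : 0 < enorm (y - z) / 2 by rewrite divr_gt0.
rewrite (eq_integral (fun x =>
  (Num.max (enorm (y - z) / 2) (enorm (y - x)) `^ (- (p + 2 * Q)))%:E)); last first.
  by move=> x _; rewrite /offdiag/= (enormC x y).
apply: (le_trans (integral_far mB (measurable_dist y) CP0 r20 ha (fun r r0 => growth Ey r0))).
rewrite -EFinM lee_fin /offdiag_const.
rewrite (_ : s - (p + 2 * Q) = - (Q + theta * p)); last by ring.
rewrite -half_double_powRN// le_eqVlt; apply/orP; left; apply/eqP.
have fin (f g h c : R) : c != 0 -> f * (g * h) = f * g * c * (h / c) by move=> c0'; field.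
by apply: fin; rewrite gt_eqF.
Qed.

End energy.

(** * Integration by parts on boxes *)

Section lebesgue_rows.
Variable R : realType.

Lemma rV_cons0 n (tv : R * 'rV[R]_n) : rV_cons tv 0 ord0 = tv.1.
Proof.
transitivity (row_mx tv.1%:M tv.2 0 (lshift n 0 : 'I_(1 + n))).
  by congr (fun_of_matrix _ _ _); exact: val_inj.
by rewrite row_mxEl mxE eqxx.
Qed.

Lemma rV_consS n (tv : R * 'rV[R]_n) (k : 'I_n) : rV_cons tv 0 (lift ord0 k) = tv.2 0 k.
Proof.
transitivity (row_mx tv.1%:M tv.2 0 (rshift 1 k : 'I_(1 + n))).
  by congr (fun_of_matrix _ _ _); exact: val_inj.
by rewrite row_mxEr.
Qed.

Lemma rV_cons_basis0 n (t s : R) (v : 'rV[R]_n) :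
  rV_cons (t, v) + s *: basis_rV R ord0 = rV_cons (t + s, v).
Proof.
apply/rowP => j; rewrite [LHS]mxE [X in _ + X]mxE [X in _ + _ * X]mxE.
have [k ->|->] := unliftP ord0 j.
  by rewrite !rV_consS/= mulr0 addr0.
by rewrite !rV_cons0/= mulr1.
Qed.

Lemma rV_cons_basisS n (t s : R) (v : 'rV[R]_n) (k : 'I_n) :
  rV_cons (t, v) + s *: basis_rV R (lift ord0 k) = rV_cons (t, v + s *: basis_rV R k).
Proof.
apply/rowP => j; rewrite [LHS]mxE [X in _ + X]mxE [X in _ + _ * X]mxE.
have [l ->|->] := unliftP ord0 j.
  by rewrite !rV_consS/= !mxE (inj_eq lift_inj).
by rewrite !rV_cons0/= mulr0 addr0.
Qed.

Definition box n (w : 'I_n -> R) (r : R) : set 'rV[R]_n :=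
  [set v | forall i, `|v 0 i - w i| < r].

Lemma measurable_box n (w : 'I_n -> R) r : measurable (box w r).
Proof.
rewrite (_ : box w r = \bigcap_(i in [set: 'I_n]) [set v | `|v 0 i - w i| < r]).
  apply: fin_bigcap_measurable => // i _; rewrite -[X in measurable X]setTI.
  rewrite [X in _ `&` X](_ : _ = (fun v : 'rV[R]_n => `|v 0 i - w i|) @^-1` `]-oo, r[%classic).
    apply: measurableT_comp => //; apply: measurable_funB => //.
    exact: measurable_coord.
  by apply/seteqP; split => t /=; rewrite in_itv.
by apply/seteqP; split => [v vB i _|v vB i]; [exact: vB|exact: vB].
Qed.

Lemma lebesgue_box n (w : 'I_n -> R) r : 0 < r ->
  (lebesgue_rV R n (box w r) <= ((2 * r) ^+ n)%:E)%E.
Proof.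
move=> r0; elim: n w => [|n IH] w.
  by rewrite expr0 /= diracE; case: (_ \in _); rewrite lee_fin.
have -> : lebesgue_rV R n.+1 (box w r) =
    (lebesgue_measure \x lebesgue_rV R n)%E (@rV_cons R n @^-1` box w r) by [].
have -> : @rV_cons R n @^-1` box w r =
    `]w ord0 - r, w ord0 + r[%classic `*` box (w \o lift ord0) r.
  apply/seteqP; split => [[t v] /= h|[t v] [/= h1 h2] i].
    split => [|k] /=; last by have := h (lift ord0 k); rewrite rV_consS.
    by have := h ord0; rewrite rV_cons0/= in_itv/= ltr_distl.
  have [k ->|->] := unliftP ord0 i; first by rewrite rV_consS; exact: h2.
  by rewrite rV_cons0/= ltr_distl; move: h1; rewrite in_itv.
rewrite product_measure1E//; last exact: measurable_box.
have e : @lebesgue_measure R `]w ord0 - r, w ord0 + r[%classic = (2 * r)%:E.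
  rewrite lebesgue_measure_itv/= lte_fin ltrD2l gtrN// -EFinB.
  by congr EFin; ring.
rewrite [X in (X * _)%E]e exprS [leRHS]EFinM lee_wpmul2l// lee_fin; lra.
Qed.

(** Induction on the dimension along the product structure of [lebesgue_rV]. Only a derivative along
    the lines of the one direction [i] is assumed, together with boundedness, measurability and
    bounded support. *)
Lemma integral_partial_eq0 n (i : 'I_n) (F dF : 'rV[R]_n -> R) (C M : R) :
  measurable_fun setT dF -> (forall x : 'rV[R]_n, `|dF x| <= C) ->
  (forall x : 'rV[R]_n, (exists j, M <= `|x 0 j|) -> F x = 0 /\ dF x = 0) ->
  (forall (x : 'rV[R]_n) (t : R), is_derive t (1 : R) (fun t : R => F (x + t *: basis_rV R i))
     (dF (x + t *: basis_rV R i))) ->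
  (forall x : 'rV[R]_n, continuous (fun t : R => dF (x + t *: basis_rV R i))) ->
  (\int[lebesgue_rV R n]_x (dF x)%:E = 0)%E.
Proof.
elim: n i F dF => [[]//|n IH] i F dF mdF dFC dF0 dder dcont.
(* A positive number that is at least [M], so that the box of half-width [B] has finite measure and
   contains the support. *)
pose B : R := `|M| + 1.
have B0 : 0 < B by rewrite ltr_pwDr.
pose f := (dF \o @rV_cons R n).
have mf : measurable_fun setT f := measurableT_comp mdF (@measurable_rV_cons R n).
have mbox : measurable (@rV_cons R n @^-1` box (fun=> 0) B).
  rewrite -[X in measurable X]setTI; apply: (@measurable_rV_cons R n) => //.
  exact: measurable_box.
have out z : ~ (@rV_cons R n @^-1` box (fun=> 0) B) z -> f z = 0.
  move=> /existsNP[j /negP]; rewrite subr0 -leNgt => h.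
  apply: (dF0 _ _).2; exists j; apply: le_trans h.
  by rewrite /B (le_trans (ler_norm _))// lerDl.
have C0 : 0 <= C by apply: le_trans (dFC 0).
have if_ : (lebesgue_measure \x lebesgue_rV R n)%E.-integrable setT (EFin \o f).
  have h : (lebesgue_measure \x lebesgue_rV R n)%E.-integrable setT (EFin \o (f \_ (@rV_cons R n
    @^-1` box (fun=> 0) B))).
    rewrite -restrict_EFin.
    apply: (@integrable_mkcond _ _ _ (lebesgue_measure \x lebesgue_rV R n)%E _ (EFin \o f) mbox).1.
    apply: (@integrable_bounded _ _ R (lebesgue_measure \x lebesgue_rV R n)%E _ mbox f C).
    - exact: le_lt_trans (@lebesgue_box n.+1 (fun=> 0) B B0) (ltry _).
    - exact: measurable_funTS.
    - by move=> z _; exact: dFC.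
  apply: eq_integrable h => // z _ /=; rewrite patchE; case: ifPn => // /negP nz.
  by rewrite out// => zz; apply: nz; rewrite inE.
have -> : (\int[lebesgue_rV R n.+1]_x (dF x)%:E =
    \int[(lebesgue_measure \x lebesgue_rV R n)%E]_z (f z)%:E)%E.
  have mdF' : measurable_fun setT (EFin \o dF) by exact/measurable_EFinP.
  have mc : measurable_fun [set: (g_sigma_algebraType R.-ocitv.-measurable * 'rV[R]_n)%type]
    (fun z => @rV_cons R n z) by exact: measurable_rV_cons.
  have := integral_pushforward mc mdF' if_ measurableT.
  rewrite preimage_setT => h; apply: etrans h.
  by apply: eq_measure_integral => A mA _.
(* In direction [ord0] the integral over t is taken first, by the fundamental theorem of calculus on
   [-B, B], at whose endpoints F vanishes. In any other direction t is frozen and the induction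
   hypothesis applies. *)
have [k ik|i0] := unliftP ord0 i; last first.
  rewrite -(integral21_prod_meas1 if_) /fubini_G.
  rewrite (eq_integral (cst 0%E)) ?integral0// => v _.
  pose g (t : R) := dF (rV_cons (t, v)); pose G (t : R) := F (rV_cons (t, v)).
  have lineE t : rV_cons (0, v) + t *: basis_rV R i = rV_cons (t, v).
    by rewrite i0 rV_cons_basis0 add0r.
  have cg : continuous g.
    rewrite /g (_ : (fun t => _) = fun t : R => dF (rV_cons (0, v) + t *: basis_rV R i)) //.
    by apply/funext => t; rewrite lineE.
  have dG (t : R) : is_derive t (1 : R) G (g t).
    have := dder (rV_cons (0, v)) t; rewrite lineE.
    by under eq_fun do rewrite lineE.
  have zero (t : R) : B <= `|t| -> G t = 0 /\ g t = 0.
    move=> Bt; apply: dF0; exists ord0; rewrite rV_cons0/=.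
    by apply: le_trans Bt; rewrite /B (le_trans (ler_norm _))// lerDl.
  have cG : continuous G.
    by move=> t; apply/differentiable_continuous/derivable1_diffP; have [] := dG t.
  have BB : - B < B by rewrite gtrN.
  transitivity (\int[lebesgue_measure]_(t in `[(- B)%R, B]) (g t)%:E)%E.
    rewrite [RHS]integral_mkcond; apply: eq_integral => t _; rewrite patchE.
    case: ifPn => [//|/negP tB].
    have Bt : B <= `|t|.
      rewrite leNgt; apply/negP => Bt; apply: tB.
      by rewrite inE/= in_itv/= -ler_norml ltW.
    by have [_ gt0] := zero t Bt; rewrite /f/= -/(g t) gt0.
  rewrite (@continuous_FTC2 _ g G _ _ BB).
  - by rewrite (zero B _).1 ?(zero (- B) _).1 ?normrN ?sube0 ?ger0_norm ?(ltW B0).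
  - exact: continuous_subspaceT.
  - split => [t _||]; first by have [] := dG t.
      exact: cvg_at_right_filter (cG _).
    exact: cvg_at_left_filter (cG _).
  - by move=> t _; rewrite derive1E; have := dG t => ?; rewrite derive_val.
rewrite -(integral12_prod_meas1 if_) /fubini_F.
rewrite (eq_integral (cst 0%E)) ?integral0// => t _.
apply: (IH k (fun v => F (rV_cons (t, v))) (fun v => dF (rV_cons (t, v)))).
- exact: (measurableT_comp mf (pair1_measurable t)).
- by move=> v; exact: dFC.
- by move=> v [j Mj]; apply: dF0; exists (lift ord0 j); rewrite rV_consS.
- move=> v s; have := dder (rV_cons (t, v)) s; rewrite ik rV_cons_basisS.
  by under eq_fun do rewrite rV_cons_basisS.
- move=> v; have := dcont (rV_cons (t, v)); rewrite ik.
  by under eq_fun do rewrite rV_cons_basisS.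
Qed.

End lebesgue_rows.

(** * Weak gradients of limits of smooth functions *)

Section test_functions.
Variables (R : realType) (n : nat).
Implicit Types (f phi : 'rV[R]_n -> R) (x v : 'rV[R]_n).

Lemma continuous_measurable_rV f : continuous f -> measurable_fun setT f.
Proof.
move=> cf; apply: (measurability _ (RGenOpens.measurableE R)).
move=> _ [_ [a [b ->]] <-]; rewrite setTI; apply: open_measurable_rV.
by apply: open_comp => [v _|]; [exact: cf|exact: interval_open].
Qed.

Lemma is_derive_line f x v (t : R) : derivable f (x + t *: v) v ->
  is_derive t (1 : R) (fun t : R => f (x + t *: v)) ('D_v f (x + t *: v)).
Proof.
move=> d; have e : (fun h : R => h^-1 *: (((fun t : R => f (x + t *: v)) \o shift t) (h *: (1 :
  R)) - f (x + t *: v))) =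
    (fun h => h^-1 *: ((f \o shift (x + t *: v)) (h *: v) - f (x + t *: v))).
  apply/funext => h /=; congr (_ *: (f _ - _)).
  by rewrite [_ *: 1]mulr1 scalerDl addrCA.
apply: DeriveDef; first by rewrite /derivable e.
by rewrite /derive e.
Qed.

Lemma continuous_line f x v : continuous f -> continuous (fun t : R => f (x + t *: v)).
Proof.
move=> cf t; apply: (@continuous_comp R 'rV[R]_n R (fun t : R => x + t *: v) f t); last exact: cf.
apply: cvgD; first exact: cvg_cst.
exact: scalel_continuous.
Qed.

Lemma compact_rV_bounded (K : set 'rV[R]_n) : compact K ->
  exists2 M : R, 0 < M & forall x j, K x -> `|x 0 j| < M.
Proof.
move=> /compact_bounded[M0 [_ hM]]; exists (`|M0| + 2); first by rewrite ltr_wpDl.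
move=> x j Kx.
have : `|x| <= `|M0| + 1 by apply: hM => //; rewrite (le_lt_trans (ler_norm _))// ltrDl.
move=> xM; rewrite (@le_lt_trans _ _ (`|M0| + 1))// ?ltrD2l ?ltr1n//.
apply: le_trans xM; rewrite [leRHS]/Num.norm/= mx_normrE.
exact: (le_bigmax _ (fun ij : 'I_1 * 'I_n => `|x ij.1 ij.2|) (0, j)).
Qed.

Lemma continuous_compact_le f (K : set 'rV[R]_n) : continuous f -> compact K ->
  (forall x, ~ K x -> f x = 0) -> exists C, forall x, `|f x| <= C.
Proof.
move=> cf cK f0.
have cfK : compact (f @` K) by apply: continuous_compact => //; exact: continuous_subspaceT.
have [M0 [_ hM]] := compact_bounded cfK; exists (`|M0| + 1) => x.
have [Kx|nKx] := pselect (K x); last by rewrite f0// normr0 addr_ge0.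
apply: (hM (`|M0| + 1)); last by exists x.
by rewrite (le_lt_trans (ler_norm _))// ltrDl.
Qed.

Lemma derive_off_support phi (K : set 'rV[R]_n) v x : compact K ->
  (forall x, ~ K x -> phi x = 0) -> ~ K x -> 'D_v phi x = 0.
Proof.
move=> cK phi0 nKx.
rewrite (@near_eq_derive _ _ _ phi (cst 0)); first exact: derive_cst.
have oK : open (~` K).
  by apply: closed_openC; apply: compact_closed cK; exact: norm_hausdorff.
have : nbhs x (~` K) by exact: open_nbhs_nbhs.
by apply: filterS => y /phi0.
Qed.

End test_functions.

Section weak_gradient_limit.
Variables (R : realType) (n : nat).
Local Notation m := (lebesgue_rV R n).
Local Notation e_ := (basis_rV R).

(** The functions [F k] are differentiable along all lines, those through [E] included, so partial
    integration against a test function is classical for each k. Convergence and the common majorant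
    [G] are required off the null set [E] only. *)
Lemma weak_gradient_of_cvg (U E : set 'rV[R]_n) (F : nat -> 'rV[R]_n -> R)
    (dF : nat -> 'I_n -> 'rV[R]_n -> R) (f : 'rV[R]_n -> R) (g : 'rV[R]_n -> 'rV[R]_n)
    (G : 'rV[R]_n -> R) :
  open U -> measurable E -> m E = 0%E ->
  (forall k, measurable_fun setT (F k)) ->
  (forall k i, measurable_fun setT (dF k i)) ->
  (forall k i x (t : R), is_derive t (1 : R) (fun t : R => F k (x + t *: e_ i))
    (dF k i (x + t *: e_ i))) ->
  (forall k i x, continuous (fun t : R => dF k i (x + t *: e_ i))) ->
  (forall k, exists C, forall x i, U x -> `|F k x| <= C /\ `|dF k i x| <= C) ->
  measurable_fun U f -> (forall i, measurable_fun U (fun x => g x 0 i)) ->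
  (forall x, U x -> ~ E x -> (fun k => F k x) @ \oo --> f x) ->
  (forall i x, U x -> ~ E x -> (fun k => dF k i x) @ \oo --> g x 0 i) ->
  (forall k x, U x -> ~ E x -> `|F k x| <= G x) ->
  (forall k i x, U x -> ~ E x -> `|dF k i x| <= G x) ->
  m.-integrable (U `\` E) (EFin \o G) ->
  weak_gradient U f g.
Proof.
move=> oU mE mE0 mF mdF derF cdF bF mf mg cF cG FG dFG iG.
have mU := open_measurable_rV oU.
have mD : measurable (U `\` E) by exact: measurableD.
have DU : U `\` E `<=` U by move=> x [].
have fG x : U x -> ~ E x -> `|f x| <= G x.
  move=> Ux nEx; have /(@cvg_lim _) <- // : (fun k => `|F k x|) @ \oo --> `|f x|.
    by apply: cvg_norm; exact: cF.
  apply: limr_le; first by apply/cvg_ex; exists `|f x|; apply: cvg_norm; exact: cF.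
  by apply: nearW => k; exact: FG.
have gG i x : U x -> ~ E x -> `|g x 0 i| <= G x.
  move=> Ux nEx; have /(@cvg_lim _) <- // : (fun k => `|dF k i x|) @ \oo --> `|g x 0 i|.
    by apply: cvg_norm; exact: cG.
  apply: limr_le; first by apply/cvg_ex; exists `|g x 0 i|; apply: cvg_norm; exact: cG.
  by apply: nearW => k; exact: dFG.
(* Since [E] is null, integrability and integrals over U and over U without [E] agree. *)
have toU (a : 'rV[R]_n -> R) : measurable_fun U a ->
    m.-integrable (U `\` E) (EFin \o a) ->
    m.-integrable U (EFin \o a) /\
    (\int[m]_(x in U) (a x)%:E = \int[m]_(x in U `\` E) (a x)%:E)%E.
  move=> ma ia.
  have iU : m.-integrable U (EFin \o a).
    by apply/(negligible_integrable mE mU _ mE0) => //; exact/measurable_EFinP.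
  by split => //; rewrite (negligible_integral mE mU iU mE0).
have intU (a : 'rV[R]_n -> R) : measurable_fun U a ->
    (forall x, U x -> ~ E x -> `|a x| <= G x) -> m.-integrable U (EFin \o a).
  move=> ma aG; apply: (toU a ma _).1.
  apply: (integrable_dom mD _ _ iG); first exact: measurable_funS ma.
  by move=> x [Ux nEx]; exact: aG.
have locU (a : 'rV[R]_n -> R) : measurable_fun U a ->
    (forall x, U x -> ~ E x -> `|a x| <= G x) -> loc_integrable m U a.
  move=> ma aG; split => // K cK KU.
  have iU := intU a ma aG.
  have /integrableP[_] : m.-integrable K (EFin \o a).
    by apply: integrableS iU => //; exact: compact_measurable_rV.
  exact.
split; [exact: locU|by move=> i; exact: (locU _ (mg i) (gG i))|].
move=> phi [Ckphi [K [cK KU phi0]]] i.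
have [cphi dphi] := Ckphi 1%N.
have [derphi cDphi] := dphi i.
pose D x := 'D_(e_ i) phi x.
have D0 x : ~ K x -> D x = 0 by move=> nKx; exact: derive_off_support cK phi0 nKx.
have [C1 hC1] := continuous_compact_le cphi cK phi0.
have [C2 hC2] := continuous_compact_le cDphi cK D0.
have [M M0 KM] := compact_rV_bounded cK.
have C10 : 0 <= C1 := le_trans (normr_ge0 _) (hC1 0).
have C20 : 0 <= C2 := le_trans (normr_ge0 _) (hC2 0).
have mphi := continuous_measurable_rV cphi.
have mDphi : measurable_fun setT D by exact: continuous_measurable_rV.
pose h k x := F k x * D x + dF k i x * phi x.
have mh k : measurable_fun setT (h k).
  by apply: measurable_funD; apply: measurable_funM.
have h0 k x : ~ K x -> h k x = 0.
  by move=> nKx; rewrite /h D0// phi0// !mulr0 addr0.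
(* The bounds on [F k] and [dF k] are known on [U] alone; this suffices because the product vanishes
   off [K], a subset of [U]. *)
have hint k : (\int[m]_x (h k x)%:E = 0)%E.
  have [C hC] := bF k.
  have C0 : 0 <= `|C| by [].
  apply: (@integral_partial_eq0 R n i (fun x => F k x * phi x) (h k) (`|C| * C2 + `|C| * C1) M)
    => //.
  - move=> x; have [Kx|nKx] := pselect (K x); last first.
      by rewrite h0// normr0 addr_ge0// mulr_ge0.
    have [F1 F2] := hC x i (KU _ Kx).
    rewrite (le_trans (ler_normD _ _))// !normrM lerD//.
      by rewrite ler_pM// ?(le_trans F1)// ?ler_norm ?hC2.
    by rewrite ler_pM// ?(le_trans F2)// ?ler_norm ?hC1.
  - move=> x [j Mj]; have nKx : ~ K x.
      by move=> Kx; have := KM x j Kx; rewrite ltNge Mj.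
    by rewrite h0// phi0// mulr0.
  - move=> x t; have d1 := derF k i x t.
    have d2 := is_derive_line (derphi (x + t *: e_ i)).
    have := is_deriveM d1 d2; rewrite /GRing.scale/= => dd.
    rewrite (_ : h k _ = F k (x + t *: e_ i) * 'D_(e_ i) phi (x + t *: e_ i) +
       phi (x + t *: e_ i) * dF k i (x + t *: e_ i)); first exact: dd.
    by rewrite /h [phi _ * _]mulrC.
  - move=> x t; apply: cvgD; apply: cvgM.
    + apply/differentiable_continuous/derivable1_diffP.
      by have [] := derF k i x t.
    + exact: (continuous_line cDphi).
    + exact: cdF.
    + exact: (continuous_line cphi).
pose hl x := f x * D x + g x 0 i * phi x.
have hG k x : (U `\` E) x -> `|h k x| <= G x * (C2 + C1).
  move=> [Ux nEx]; rewrite (le_trans (ler_normD _ _))// !normrM mulrDr lerD//.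
    by rewrite ler_pM// ?FG ?hC2.
  by rewrite ler_pM// ?dFG ?hC1.
have iGC : m.-integrable (U `\` E) (EFin \o (fun x => G x * (C2 + C1))) by exact: integrable_mulr.
have hintD k : (\int[m]_(x in U `\` E) (h k x)%:E = 0)%E.
  have ihD : m.-integrable (U `\` E) (EFin \o h k).
    by apply: (integrable_dom mD _ (hG k)) => //; exact: measurable_funTS.
  have [_ <-] := toU (h k) (measurable_funTS (mh k)) ihD.
  rewrite -[RHS](hint k) integral_mkcond; apply: eq_integral => x _.
  rewrite patchE; case: ifPn => // /negP nUx.
  by rewrite h0// => Kx; apply: nUx; rewrite inE; exact: KU.
have lim0 : (\int[m]_(x in U `\` E) (hl x)%:E = 0)%E.
  have := @dominated_cvg _ _ _ m _ mD (fun k x => (h k x)%:E) (fun x => (hl x)%:E)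
    (fun x => (G x * (C2 + C1))%:E).
  move=> H; have {H} : (fun k => \int[m]_(x in U `\` E) (h k x)%:E)%E @ \oo -->
     (\int[m]_(x in U `\` E) (hl x)%:E)%E.
    apply: H => //.
    - by move=> k; apply/measurable_EFinP; exact: measurable_funTS.
    - move=> x [Ux nEx]; apply: cvg_EFin; first exact: nearW.
      have h1 : (fun k => F k x * D x) @ \oo --> f x * D x.
        by apply: cvgM; [exact: cF|exact: cvg_cst].
      have h2 : (fun k => dF k i x * phi x) @ \oo --> g x 0 i * phi x.
        by apply: cvgM; [exact: cG|exact: cvg_cst].
      exact: (cvgD h1 h2).
  rewrite (_ : (fun k => _) = cst 0%E); last by apply/funext => k; rewrite hintD.
  by move=> /(cvg_lim (@ereal_hausdorff R)); rewrite lim_cst => [<-|]; [|exact: ereal_hausdorff].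
have i1 : m.-integrable (U `\` E) (EFin \o (fun x => f x * D x)).
  apply: (integrable_dom mD _ _ (integrable_mulr mD C2 iG)).
    apply: measurable_funM; first exact: measurable_funS mf.
    exact: measurable_funTS.
  by move=> x [Ux nEx]; rewrite normrM; apply: ler_pM => //; [exact: fG|exact: hC2].
have i2 : m.-integrable (U `\` E) (EFin \o (fun x => g x 0 i * phi x)).
  apply: (integrable_dom mD _ _ (integrable_mulr mD C1 iG)).
    apply: measurable_funM; first exact: measurable_funS (mg i).
    exact: measurable_funTS.
  by move=> x [Ux nEx]; rewrite normrM; apply: ler_pM => //; exact: gG.
have [_ ->] := toU (fun x => f x * D x) (measurable_funM mf (measurable_funTS mDphi)) i1.
have [_ ->] := toU (fun x => g x 0 i * phi x) (measurable_funM (mg i) (measurable_funTS mphi)) i2.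
rewrite -!EFin_Rintegral// -EFinN; congr EFin; apply/eqP.
rewrite -subr_eq0 opprK -RintegralD//.
by rewrite /Rintegral lim0.
Qed.

End weak_gradient_limit.

(** * Smoothness and convergence of the regularised averages *)

Lemma continuous_is_derive (R : realType) (f df : R -> R) :
  (forall t : R, is_derive t (1 : R) f (df t)) -> continuous f.
Proof.
move=> d t; apply/differentiable_continuous/derivable1_diffP.
by have [] := d t.
Qed.

Section smooth_extension.
Variables (R : realType) (n N : nat).
Variables (nu : {measure set 'rV[R]_n -> \bar R}) (E : set 'rV[R]_n).
Hypothesis mE : measurable E.
Hypothesis nuE : (0 < nu E < +oo)%E.
Implicit Types (u : 'rV[R]_n -> R) (x y z v : 'rV[R]_n) (e : R).
Local Notation K := (@shepard R n N).
Local Notation dK := (@dshepard R n N).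
Local Notation mass := (mass N nu E).
Local Notation sext := (shepard_ext N nu E).
Local Notation dsext := (shepard_dext N nu E).

(** If the integral vanished, the strictly positive kernel would be 0 almost everywhere on [E],
    against nu E > 0. *)
Lemma mass_pos e x : away E e x -> 0 < mass e x.
Proof.
move=> a; have /andP[nu0 nuoo] := nuE.
have K0 y : E y -> 0 < K e x y by move=> Ey; rewrite shepard_gt0// (away_qdist a).
have m0 : 0 <= mass e x by apply: Rintegral_ge0 => y Ey; rewrite ltW// K0.
rewrite lt_def m0 andbT; apply/eqP => /eqP.
rewrite -eqe /mass EFin_Rintegral//; last exact: integrable_shepard.
move=> /eqP h.
have mK : measurable_fun E (EFin \o K e x) by apply/measurable_EFinP; exact: measurable_shepard_r.
have : (\int[nu]_(y in E) `|(EFin \o K e x) y| = 0)%E.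
  rewrite -[RHS]h; apply: eq_integral => y /set_mem Ey /=.
  by rewrite ger0_norm// ltW// K0.
move=> /(ae_eq_integral_abs nu mE mK)[Z [mZ Z0 EZ]].
have : (nu E <= nu Z)%E.
  apply: le_measure; rewrite ?inE// => y Ey; apply: EZ => /(_ Ey) /= [] k0.
  by have := K0 y Ey; rewrite k0 ltxx.
by rewrite Z0 leNgt nu0.
Qed.

Lemma is_derive_mass v e x (t : R) : 0 < e ->
  is_derive t (1 : R) (fun t : R => mass e (x + t *: v))
    (\int[nu]_(y in E) dK v e (x + t *: v) y).
Proof.
move=> e0; have /andP[_ nuoo] := nuE.
(* One constant has to dominate both the kernel and its derivative, hence the sum of their two
   bounds. *)
have := @is_derive_Rintegral _ _ R nu E (cst 1)
  (fun (t : R) y => K e (x + t *: v) y) (fun (t : R) y => dK v e (x + t *: v) y)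
  (e ^- N + (2 * N)%:R * enorm v * (e ^- N / Num.sqrt e)) mE (integrable_cst1 mE nuoo).
have eN : 0 <= e ^- N by rewrite invr_ge0 exprn_ge0 ?ltW.
move=> H; have {}H := H _ _ _ _ t.
have e1 : (fun t : R => mass e (x + t *: v)) =
    fun t : R => \int[nu]_(y in E) (cst 1 y * K e (x + t *: v) y).
  by apply/funext => s; apply: eq_Rintegral => y _; rewrite mul1r.
rewrite e1 (_ : \int[nu]_(y in E) dK v e (x + t *: v) y =
  \int[nu]_(y in E) (cst 1 y * dK v e (x + t *: v) y)); last first.
  by apply: eq_Rintegral => y _; rewrite mul1r.
apply: H.
- by move=> s; exact: measurable_shepard_r.
- by move=> s y _; apply: is_derive_shepard; rewrite gt_eqF// ltr_wpDl ?sqr_ge0.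
- move=> s y _; rewrite ger0_norm ?shepard_ge0 ?(ltW e0)//.
  by rewrite (le_trans (shepard_le _ _ _ e0))// lerDl !mulr_ge0 ?invr_ge0 ?enorm_ge0 ?sqrtr_ge0
    ?exprn_ge0 ?(ltW e0).
- by move=> s y _; rewrite (le_trans (dshepard_le _ _ _ _ e0))// lerDr.
Qed.

Lemma is_derive_num v e u x (t : R) : 0 < e -> nu.-integrable E (EFin \o u) ->
  is_derive t (1 : R) (fun t : R => \int[nu]_(y in E) (u y * K e (x + t *: v) y))
    (\int[nu]_(y in E) (u y * dK v e (x + t *: v) y)).
Proof.
move=> e0 iu; have eN : 0 <= e ^- N by rewrite invr_ge0 exprn_ge0 ?ltW.
apply: (@is_derive_Rintegral _ _ R nu E u
  (fun (t : R) y => K e (x + t *: v) y) (fun (t : R) y => dK v e (x + t *: v) y)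
  (e ^- N + (2 * N)%:R * enorm v * (e ^- N / Num.sqrt e)) mE iu).
- by move=> s; exact: measurable_shepard_r.
- by move=> s y _; apply: is_derive_shepard; rewrite gt_eqF// ltr_wpDl ?sqr_ge0.
- move=> s y _; rewrite ger0_norm ?shepard_ge0 ?(ltW e0)//.
  by rewrite (le_trans (shepard_le _ _ _ e0))// lerDl !mulr_ge0 ?invr_ge0 ?enorm_ge0 ?sqrtr_ge0
    ?exprn_ge0 ?(ltW e0).
- by move=> s y _; rewrite (le_trans (dshepard_le _ _ _ _ e0))// lerDr.
Qed.

Lemma is_derive_sext v e u x (t : R) : 0 < e -> nu.-integrable E (EFin \o u) ->
  is_derive t (1 : R) (fun t : R => sext e u (x + t *: v)) (dsext v e u (x + t *: v)).
Proof.
move=> e0 iu.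
have m0 s : mass e (x + s *: v) != 0 by rewrite gt_eqF// mass_pos//; exact: away_gt0.
have d1 := is_derive_num v x t e0 iu.
have d2 := is_deriveV (m0 t) (is_derive_mass v x t e0).
have := is_deriveM d1 d2; rewrite /GRing.scale/= => dd.
rewrite /shepard_dext [X in is_derive _ _ _ X](_ : _ =
  \int[nu]_(y in E) (u y * K e (x + t *: v) y) *
         (- mass e (x + t *: v) ^- 2 * \int[nu]_(y in E) dK v e (x + t *: v) y) +
         (mass e (x + t *: v))^-1 * \int[nu]_(y in E) (u y * dK v e (x + t *: v) y)).
  exact: dd.
by rewrite /shepard_ext; move: (m0 t) => mt; field.
Qed.

Lemma continuous_dsext v e u x : 0 < e -> nu.-integrable E (EFin \o u) ->
  continuous (fun t : R => dsext v e u (x + t *: v)).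
Proof.
move=> e0 iu; have /andP[_ nuoo] := nuE.
have m0 s : mass e (x + s *: v) != 0 by rewrite gt_eqF// mass_pos//; exact: away_gt0.
have cK w : nu.-integrable E (EFin \o w) ->
    continuous (fun t : R => \int[nu]_(y in E) (w y * dK v e (x + t *: v) y)).
  move=> iw; apply: (@continuous_Rintegral _ _ R nu E w
    (fun (t : R) y => dK v e (x + t *: v) y) _ mE iw).
  - by move=> t; exact: measurable_dshepard_r.
  - by move=> y _; exact: continuous_dshepard.
  - by move=> t y _; exact: dshepard_le.
have c1 : continuous (fun t : R => \int[nu]_(y in E) dK v e (x + t *: v) y).
  have := cK _ (integrable_cst1 mE nuoo).
  rewrite (_ : (fun t : R => _) = fun t : R => \int[nu]_(y in E) dK v e (x + t *: v) y)//.
  by apply/funext => s; apply: eq_Rintegral => y _; rewrite mul1r.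
move=> t; apply: cvgM; last first.
  apply: cvgV; first exact: m0.
  exact: (continuous_is_derive (fun t => is_derive_mass v x t e0)).
apply: cvgB; first exact: cK.
apply: cvgM; last exact: c1.
exact: (continuous_is_derive (fun t => is_derive_sext v x t e0 iu)).
Qed.

Lemma measurable_mass e : measurable_fun setT (mass e).
Proof.
have /andP[_ nuoo] := nuE.
apply: (@measurable_Rintegral_param _ _ _ _ R nu E (fun w => K e w.1 w.2) mE nuoo).
exact: measurable_shepard.
Qed.

Lemma measurable_sext e u : measurable_fun setT u -> measurable_fun setT (sext e u).
Proof.
move=> mu; have /andP[_ nuoo] := nuE.
apply: measurable_funM; last first.
  by apply: (measurableT_comp (@measurable_invr R)); exact: measurable_mass.
apply: (@measurable_Rintegral_param _ _ _ _ R nu E (fun w => u w.2 * K e w.1 w.2) mE nuoo).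
apply: measurable_funM; first exact: (measurableT_comp mu measurable_snd).
exact: measurable_shepard.
Qed.

Lemma measurable_dsext v e u : measurable_fun setT u -> measurable_fun setT (dsext v e u).
Proof.
move=> mu; have /andP[_ nuoo] := nuE.
apply: measurable_funM; last first.
  by apply: (measurableT_comp (@measurable_invr R)); exact: measurable_mass.
apply: measurable_funB.
  apply: (@measurable_Rintegral_param _ _ _ _ R nu E (fun w => u w.2 * dK v e w.1 w.2) mE nuoo).
  apply: measurable_funM; first exact: (measurableT_comp mu measurable_snd).
  exact: measurable_dshepard.
apply: measurable_funM; first exact: measurable_sext.
apply: (@measurable_Rintegral_param _ _ _ _ R nu E (fun w => dK v e w.1 w.2) mE nuoo).
exact: measurable_dshepard.
Qed.

Lemma cvg_Rintegral u (k_ : nat -> 'rV[R]_n -> R) (k : 'rV[R]_n -> R) (C : R) :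
  nu.-integrable E (EFin \o u) -> (forall j, measurable_fun E (k_ j)) ->
  (forall j y, E y -> `|k_ j y| <= C) ->
  (forall y, E y -> (fun j => k_ j y) @ \oo --> k y) ->
  (fun j => \int[nu]_(y in E) (u y * k_ j y)) @ \oo --> \int[nu]_(y in E) (u y * k y).
Proof.
move=> iu mk kC kcv.
have cvp y : E y -> (fun j => u y * k_ j y) @ \oo --> u y * k y.
  by move=> Ey; apply: cvgM; [exact: cvg_cst|exact: kcv].
have ig : nu.-integrable E (EFin \o (fun y => `|u y| * C)).
  by apply: integrable_mulr => //; exact: (integrable_norm iu).
have mj j : measurable_fun E (fun y => (u y * k_ j y)%:E).
  by apply/measurable_EFinP; apply: measurable_funM => //; exact: measurable_of_integrable iu.
have cvE y : E y -> (fun j => (u y * k_ j y)%:E) @ \oo --> (u y * k y)%:E.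
  by move=> Ey; apply: cvg_EFin; [exact: nearW|exact: cvp].
have dom j y : E y -> (`|(u y * k_ j y)%:E| <= (`|u y| * C)%:E)%E.
  by move=> Ey; rewrite lee_fin normrM ler_wpM2l// kC.
have H := @dominated_cvg _ _ _ nu E mE (fun j y => (u y * k_ j y)%:E) (fun y => (u y * k y)%:E)
  (fun y => (`|u y| * C)%:E) mj cvE (fun _ _ => isT) ig dom.
have ilim : nu.-integrable E (EFin \o (fun y => u y * k y)).
  have mlim := emeasurable_fun_cvg _ _ mj cvE.
  by have [] := @dominated_convergence _ _ _ nu E mE (fun j y => (u y * k_ j y)%:E)
    (fun y => (u y * k y)%:E) (fun y => (`|u y| * C)%:E) mj mlim (aeW _ cvE) ig
    (aeW _ (fun y j Ey => dom j y Ey)).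
apply: fine_cvg; rewrite fineK//; exact: integrable_fin_num.
Qed.

Definition eps (j : nat) : R := j.+1%:R^-1.

Lemma eps_gt0 j : 0 < eps j. Proof. by rewrite invr_gt0. Qed.

Lemma eps_le1 j : eps j <= 1.
Proof. by rewrite invf_le1// ler1n. Qed.

Lemma cvg_qdistV x y N' : away E 0 x -> E y ->
  (fun j => (qdist (eps j) x y)^-1 ^+ N') @ \oo --> (qdist 0 x y)^-1 ^+ N'.
Proof.
move=> a Ey; have q0 := away_qdist a Ey.
have : (fun j => (qdist (eps j) x y)^-1) @ \oo --> (qdist 0 x y)^-1.
  apply: cvgV; first by rewrite gt_eqF.
  apply: cvgD; first exact: cvg_cst.
  exact: cvg_harmonic.
move=> h; elim: N' => [|k IH].
  by rewrite expr0; under eq_fun do rewrite expr0; exact: cvg_cst.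
by rewrite exprS; under eq_fun do rewrite exprS; exact: cvgM.
Qed.

(** The kernel increases as e decreases, so away from [E] the kernel at e = 0 dominates all the
    others in the limit. *)
Lemma shepard_le0 e x y : 0 <= e -> away E 0 x -> E y -> K e x y <= K 0 x y.
Proof.
move=> e0 a Ey; have q0 := away_qdist a Ey.
rewrite /shepard lerXn2r ?nnegrE ?invr_ge0 ?qdist_ge0//.
by rewrite lef_pV2 ?posrE ?lerD2l// (lt_le_trans q0)// lerD2l.
Qed.

Lemma dshepard_le0 v e x y : 0 <= e -> away E 0 x -> E y -> `|dK v e x y| <= `|dK v 0 x y|.
Proof.
move=> e0 a Ey; have q0 := away_qdist a Ey.
rewrite /dshepard !normrN !normrM ler_wpM2l ?mulr_ge0//.
rewrite !ger0_norm ?exprn_ge0 ?invr_ge0 ?qdist_ge0//.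
rewrite lerXn2r ?nnegrE ?invr_ge0 ?qdist_ge0//.
by rewrite lef_pV2 ?posrE ?lerD2l// (lt_le_trans q0)// lerD2l.
Qed.

Lemma cvg_mass x : away E 0 x -> (fun j => mass (eps j) x) @ \oo --> mass 0 x.
Proof.
move=> a; have /andP[_ nuoo] := nuE; have [C hC] := away_shepard_le N a.
have e1 e : mass e x = \int[nu]_(y in E) (cst 1 y * K e x y).
  by apply: eq_Rintegral => y _; rewrite mul1r.
rewrite e1; under eq_fun do rewrite e1.
apply: (@cvg_Rintegral _ _ _ C (integrable_cst1 mE nuoo)).
- by move=> j; exact: measurable_shepard_r.
- move=> j y Ey; rewrite ger0_norm ?shepard_ge0 ?(ltW (eps_gt0 _))//.
  rewrite (le_trans (shepard_le0 (ltW (eps_gt0 _)) a Ey))//.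
  by rewrite (le_trans (ler_norm _)) ?hC.
- by move=> y Ey; exact: cvg_qdistV.
Qed.

Lemma cvg_sext u x : away E 0 x -> nu.-integrable E (EFin \o u) ->
  (fun j => sext (eps j) u x) @ \oo --> sext 0 u x.
Proof.
move=> a iu; have [C hC] := away_shepard_le N a.
apply: cvgM; last by apply: cvgV; [rewrite gt_eqF// mass_pos|exact: cvg_mass].
apply: (@cvg_Rintegral _ _ _ C iu).
- by move=> j; exact: measurable_shepard_r.
- move=> j y Ey; rewrite ger0_norm ?shepard_ge0 ?(ltW (eps_gt0 _))//.
  rewrite (le_trans (shepard_le0 (ltW (eps_gt0 _)) a Ey))//.
  by rewrite (le_trans (ler_norm _)) ?hC.
- by move=> y Ey; exact: cvg_qdistV.
Qed.

Lemma cvg_dsext v u x : away E 0 x -> nu.-integrable E (EFin \o u) ->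
  (fun j => dsext v (eps j) u x) @ \oo --> dsext v 0 u x.
Proof.
move=> a iu; have /andP[_ nuoo] := nuE; have [C hC] := away_dshepard_le N v a.
have cd w : nu.-integrable E (EFin \o w) ->
    (fun j => \int[nu]_(y in E) (w y * dK v (eps j) x y)) @ \oo -->
      \int[nu]_(y in E) (w y * dK v 0 x y).
  move=> iw; apply: (@cvg_Rintegral _ _ _ C iw).
  - by move=> j; exact: measurable_dshepard_r.
  - by move=> j y Ey; rewrite (le_trans (dshepard_le0 _ (ltW (eps_gt0 _)) a Ey)) ?hC.
  - move=> y Ey; apply: cvgN; apply: cvgM; first exact: cvg_cst.
    exact: cvg_qdistV.
apply: cvgM; last by apply: cvgV; [rewrite gt_eqF// mass_pos|exact: cvg_mass].
apply: cvgB; first exact: cd.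
apply: cvgM; first exact: cvg_sext.
have e1 e : \int[nu]_(y in E) dK v e x y = \int[nu]_(y in E) (cst 1 y * dK v e x y).
  by apply: eq_Rintegral => y _; rewrite mul1r.
rewrite e1; under eq_fun do rewrite e1.
by apply: cd; exact: integrable_cst1.
Qed.

End smooth_extension.

(** * Lipschitz estimates *)

Section lipschitz_extension.
Variables (R : realType) (n N : nat).
Variables (nu : {measure set 'rV[R]_n -> \bar R}) (E B : set 'rV[R]_n).
Variables (Q T Cm Cu : R).
Hypothesis cE : compact E.
Hypothesis E0 : E !=set0.
Hypothesis nuE : (0 < nu E < +oo)%E.
Hypothesis Q0 : 0 < Q.
Hypothesis MQ : Q + 1 < (2 * N)%:R.
Hypothesis Cm0 : 0 < Cm.
Hypothesis Cu0 : 0 <= Cu.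
Hypothesis mass_low : forall e x y, away E e x -> E y -> rdist e x y <= T ->
  Cm^-1 * rdist e x y `^ (Q - (2 * N)%:R) <= mass N nu E e x.
Hypothesis nu_up : forall x (r : R), 0 < r -> (nu (E `&` eball x r) <= (Cu * r `^ Q)%:E)%E.
Hypothesis BT : forall e x y, 0 < e <= 1 -> B x -> E y -> rdist e x y <= T.
Implicit Types (u : 'rV[R]_n -> R) (x y z v : 'rV[R]_n) (e L : R).
Local Notation M := ((2 * N)%:R : R).
Local Notation weight := (shepard_weight N nu E).
Local Notation sext := (shepard_ext N nu E).
Local Notation dsext := (shepard_dext N nu E).

Let mE : measurable E. Proof. exact: compact_measurable_rV. Qed.

(** The constant of [integral_far], used with [nu] in the role of the growing measure: growth
    exponent Q against decay exponent M - 1, times the constant of the inverse mass. *)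
Definition spread_const := Cm * (Cu * 2 `^ (M - 1) / (1 - 2 `^ (Q - (M - 1)))).

Lemma spread_const_ge0 : 0 <= spread_const.
Proof.
rewrite mulr_ge0 ?(ltW Cm0)// !mulr_ge0 ?powR_ge0// invr_ge0 subr_ge0.
rewrite -[leRHS](powRr0 (2:R)); apply: ler_powR; first lra.
by move: MQ; lra.
Qed.

(** Let d be the distance to the nearest point. The first moment of the kernel decays with exponent
    M - 1 > Q, so [integral_far] gives d^(Q-M+1); the inverse mass contributes d^(M-Q), and the
    product is a multiple of d. *)
Lemma integral_rdist_weight e x y0 : 0 < e <= 1 -> B x -> E y0 ->
  (forall y, E y -> rdist e x y0 <= rdist e x y) ->
  nu.-integrable E (EFin \o (fun z => rdist e x z * weight e x z)) /\
  \int[nu]_(z in E) (rdist e x z * weight e x z) <= spread_const * rdist e x y0.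
Proof.
move=> e01 Bx Ey0 ymin; have /andP[e0 _] := e01; have a := away_gt0 E x e0.
have /andP[_ nuoo] := nuE.
have rT y : E y -> rdist e x y <= T by exact: BT.
set d := rdist e x y0.
have d0 : 0 < d by apply: rdist_gt0; exact: (away_qdist a).
have ir : nu.-integrable E (EFin \o rdist e x).
  apply: (@integrable_bounded _ _ _ nu E mE _ T) => //.
    by apply: measurable_funTS; exact: measurable_rdist_r.
  by move=> y Ey; rewrite ger0_norm ?rdist_ge0 ?rT.
have iw : nu.-integrable E (EFin \o (fun z => rdist e x z * weight e x z)).
  exact: integrable_mul_weight.
split => //; rewrite -lee_fin EFin_Rintegral//.
have mdist : measurable_fun setT (fun z : 'rV[R]_n => enorm (x - z)).
  by apply: measurable_enorm; exact: measurable_sub_rV.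
have mfar : measurable_fun setT (fun z => (Num.max d (enorm (x - z)) `^ (- (M - 1)))%:E).
  apply/measurable_EFinP; apply: (measurableT_comp (measurable_powR _)).
  exact: measurable_maxr.
apply: (@le_trans _ _ ((Cm * d `^ (M - Q))%:E *
  \int[nu]_(z in E) (Num.max d (enorm (x - z)) `^ (- (M - 1)))%:E)%E).
  rewrite -ge0_integralZl_EFin//; last 3 first.
  - by move=> z _; rewrite lee_fin powR_ge0.
  - exact: measurable_funTS.
  - by rewrite mulr_ge0 ?powR_ge0 ?(ltW Cm0).
  apply: ge0_le_integral => //.
  - by move=> z _; rewrite lee_fin mulr_ge0 ?rdist_ge0 ?weight_ge0 ?(ltW e0).
  - by have /integrableP[] := iw.
  - by apply: measurable_funeM; exact: measurable_funTS.
  move=> z Ez; rewrite -EFinM lee_fin.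
  have rz : 0 < rdist e x z by apply: rdist_gt0; exact: (away_qdist a).
  have := massV_le Cm0 mass_low a Ey0 (rT _ Ey0); rewrite -/d => mV.
  have m0 : 0 < mass N nu E e x by exact: mass_pos.
  rewrite /shepard_weight (shepardE _ (ltW e0)) ?(away_qdist a)//.
  have fin (r k iv c w : R) : 0 <= iv -> 0 <= r * k -> r * k <= w -> iv <= c ->
      r * (k * iv) <= c * w.
    by move=> *; rewrite mulrA mulrC; apply: ler_pM.
  apply: fin; [by rewrite invr_ge0; exact: ltW|by apply: mulr_ge0; [exact: rdist_ge0|exact:
    powR_ge0]| |exact: mV].
  rewrite -[X in X * _](powRr1 (rdist_ge0 e x z)) -powRDp//.
  rewrite (_ : 1 + - M = - (M - 1)); last by ring.
  apply: powRN_anti; [by move: MQ Q0; lra|by rewrite lt_max d0|].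
  by rewrite ge_max ymin//= enorm_le_rdist// ltW.
apply: (@le_trans _ _ ((Cm * d `^ (M - Q))%:E *
   (Cu * 2 `^ (M - 1) / (1 - 2 `^ (Q - (M - 1))) * d `^ (Q - (M - 1)))%:E)%E).
  apply: lee_wpmul2l; first by rewrite lee_fin mulr_ge0 ?powR_ge0 ?(ltW Cm0).
  apply: (integral_far mE mdist Cu0 d0).
    by apply/andP; split; [exact: ltW|move: MQ; lra].
  by move=> r r0; exact: nu_up.
rewrite -EFinM lee_fin /spread_const.
have dd : d = d `^ (M - Q) * d `^ (Q - (M - 1)).
  by rewrite -powRDp// (_ : M - Q + (Q - (M - 1)) = 1) ?powRr1 ?(ltW d0)//; ring.
have fin (f g h k : R) : f * g * (h * k) = f * h * (g * k) by ring.
by rewrite fin -dd.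
Qed.

(** Since [y0] is nearest to [x], |y0 - z| is at most twice rdist e x z, and the average of |u y0 -
    u z| is bounded by a first moment of the weight. *)
Lemma lipschitz_sum_weight e x y0 L u : 0 < e <= 1 -> B x -> E y0 ->
  (forall y, E y -> rdist e x y0 <= rdist e x y) ->
  nu.-integrable E (EFin \o u) -> 0 <= L -> lipschitz_eucl L E u ->
  `|u y0 - sext e u x| <= 2 * L * spread_const * rdist e x y0.
Proof.
move=> e01 Bx Ey0 ymin iu L0 uL; have /andP[e0 _] := e01; have a := away_gt0 E x e0.
have /andP[_ nuoo] := nuE.
have [iw wle] := integral_rdist_weight e01 Bx Ey0 ymin.
have m0 : 0 < mass N nu E e x by exact: mass_pos.
have ic : nu.-integrable E (EFin \o cst (u y0)).
  by apply: (@integrable_bounded _ _ _ nu E mE _ `|u y0|).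
have id : nu.-integrable E (EFin \o (fun z => (u y0 - u z) * weight e x z)).
  by apply: integrable_mul_weight => //; exact: (integrable_subr mE ic iu).
rewrite (subr_sext mE nuoo _ a m0 iu) (le_trans (le_normr_Rintegral _ _))//.
apply: (@le_trans _ _ (\int[nu]_(z in E) (rdist e x z * weight e x z * (2 * L)))).
  apply: le_Rintegral => //.
  - exact: (integrable_norm id).
  - exact: integrable_mulr.
  move=> z Ez; rewrite /= normrM [`|weight _ _ _|]ger0_norm ?weight_ge0 ?(ltW e0)//.
  rewrite mulrAC ler_wpM2r ?weight_ge0 ?(ltW e0)//.
  rewrite (le_trans (uL _ _ Ey0 Ez))//.
  have h1 := enorm_distD x y0 z; have h2 := enorm_le_rdist x z (ltW e0).
  have h3 := enorm_le_rdist x y0 (ltW e0); have h4 := ymin _ Ez.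
  rewrite [leRHS](_ : _ = L * (2 * rdist e x z)); last by ring.
  by rewrite ler_wpM2l//; move: h1; rewrite (enormC y0 x); lra.
rewrite RintegralZr//; rewrite [leRHS](_ : _ = spread_const * rdist e x y0 * (2 * L)); last by ring.
by rewrite ler_wpM2r ?mulr_ge0.
Qed.

Lemma normr_dsext_lipschitz v e x y0 L u : 0 < e <= 1 -> B x -> E y0 ->
  (forall y, E y -> rdist e x y0 <= rdist e x y) ->
  nu.-integrable E (EFin \o u) -> 0 <= L -> lipschitz_eucl L E u ->
  `|dsext v e u x| <= M * (4 * spread_const) * L * enorm v.
Proof.
move=> e01 Bx Ey0 ymin iu L0 uL; have /andP[e0 _] := e01; have a := away_gt0 E x e0.
have /andP[_ nuoo] := nuE.
have [iw wle] := integral_rdist_weight e01 Bx Ey0 ymin.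
have m0 : 0 < mass N nu E e x by exact: mass_pos.
have us := lipschitz_sum_weight e01 Bx Ey0 ymin iu L0 uL.
have sc0 := spread_const_ge0.
set d := rdist e x y0 in us wle.
have d0 : 0 < d by apply: rdist_gt0; exact: (away_qdist a).
rewrite (le_trans (normr_dsext_le mE nuoo v a m0 iu))//.
rewrite [leRHS](_ : _ = M * enorm v * (4 * spread_const * L)); last by ring.
rewrite ler_wpM2l ?mulr_ge0 ?enorm_ge0//.
have iwt : nu.-integrable E (EFin \o weight e x).
  have := @integrable_mul_weight R n N nu E mE e (cst 1) x a (integrable_cst1 mE nuoo).
  by apply: eq_integrable => // y _; rewrite /= mul1r.
have w1 : \int[nu]_(y in E) weight e x y = 1.
  by rewrite /Rintegral (weight_int1 mE nuoo a m0).
have ic : nu.-integrable E (EFin \o cst (sext e u x)).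
  by apply: (@integrable_bounded _ _ _ nu E mE _ `|sext e u x|).
have id : nu.-integrable E (EFin \o (fun y => u y - sext e u x)).
  exact: integrable_subr.
have [C hC] := away_rdistV_le a.
have mr : measurable_fun E (fun y => (rdist e x y)^-1).
  apply: (measurableT_comp (@measurable_invr R)).
  by apply: measurable_funTS; exact: measurable_rdist_r.
have il : nu.-integrable E (EFin \o (fun y => `|u y - sext e u x| * (rdist e x y)^-1 * weight e x
  y)).
  apply: (@integrable_mul_weight R n N nu E mE e _ x a).
  by apply: integrable_mul_bounded hC => //; exact: (integrable_norm id).
have i1 : nu.-integrable E (EFin \o (fun y => rdist e x y * weight e x y * (2 * L / d))).
  exact: integrable_mulr.
have i2 : nu.-integrable E (EFin \o (fun y => weight e x y * (2 * L * spread_const))).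
  exact: integrable_mulr.
(* The difference is split at [u y0]. Divided by r = rdist e x y, the first part is at most 2L; it
   is enlarged by r/d >= 1 so that it, too, integrates to a multiple of [spread_const]. The two
   parts give the factor 4. *)
apply: (@le_trans _ _ (\int[nu]_(y in E) (rdist e x y * weight e x y * (2 * L / d) +
    weight e x y * (2 * L * spread_const)))).
  apply: le_Rintegral; [by []|exact: il|exact: (integrable_addr mE i1 i2)|].
  move=> y Ey.
  have ry : d <= rdist e x y := ymin y Ey.
  have ry0 : 0 < rdist e x y := lt_le_trans d0 ry.
  have w0 : 0 <= weight e x y by apply: weight_ge0; exact: ltW.
  have h1 := enorm_distD x y y0; have h2 := enorm_le_rdist x y (ltW e0).
  have h3 := enorm_le_rdist x y0 (ltW e0).
  have h4 : `|u y - u y0| <= L * (2 * rdist e x y).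
    apply: (le_trans (uL _ _ Ey Ey0)); apply: ler_wpM2l; first exact: L0.
    by move: h1 h2 h3; rewrite (enormC y x) -/d; lra.
  have h5 : `|u y - sext e u x| <= L * (2 * rdist e x y) + 2 * L * spread_const * d.
    by apply: (le_trans (ler_distD (u y0) _ _)); exact: lerD.
  have fin (a' r w q : R) : 0 <= w -> 0 < r -> d <= r -> 0 <= q ->
      a' <= L * (2 * r) + 2 * L * q * d ->
      a' * r^-1 * w <= r * w * (2 * L / d) + w * (2 * L * q).
    move=> w0' r0 dr q0 h.
    rewrite (_ : r * w * (2 * L / d) + w * (2 * L * q) = (2 * L * r / d + 2 * L * q) * w); last
      by ring.
    apply: ler_wpM2r; first exact: w0'.
    rewrite ler_pdivrMr; last exact: r0.
    apply: (le_trans h); rewrite [leRHS]mulrDl; apply: lerD.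
      rewrite (_ : L * (2 * r) = 2 * L * r * 1); last by ring.
      rewrite -[leRHS]mulrA; apply: ler_wpM2l; first by rewrite !mulr_ge0// ltW.
      by rewrite mulrC ler_pdivlMr// mul1r.
    by apply: ler_wpM2l => //; rewrite !mulr_ge0.
  exact: fin.
rewrite RintegralD//.
rewrite RintegralZr//; rewrite RintegralZr// w1.
have fin (I q : R) : I <= q * d -> I * (2 * L / d) + 1 * (2 * L * q) <= 4 * q * L.
  move=> h; rewrite (_ : 4 * q * L = q * d * (2 * L / d) + 1 * (2 * L * q)).
    by apply: lerD => //; apply: ler_wpM2r => //; rewrite !mulr_ge0// invr_ge0 ltW.
  by field; rewrite gt_eqF.
exact: fin.
Qed.

Lemma continuous_enorm_subl x : continuous (fun y => enorm (x - y)).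
Proof.
move=> y; apply/(@cvgrPdist_lt _ _ _ (nbhs y) (nbhs_filter y)) => e e0.
have : nbhs y (eball y e).
  by apply: open_nbhs_nbhs; split; [exact: open_eball|rewrite /eball/= subrr enorm0].
apply: filterS => z; apply: le_lt_trans.
have h1 := enorm_distD z x y; have h2 := enorm_distD y x z.
by rewrite ler_norml; move: h1 h2; rewrite (enormC z y); lra.
Qed.

Definition lipschitz_const := M * (4 * spread_const).

Lemma rdist_argmin x : exists2 y0, E y0 & forall e y, 0 <= e -> E y -> rdist e x y0 <= rdist e x y.
Proof.
have [|y0 /set_mem Ey0 hmin] := @EVT_min_rV R n (fun y => enorm (x - y)) E E0 cE.
  by apply: continuous_subspaceT; exact: continuous_enorm_subl.
exists y0 => // e y e0 Ey; rewrite /rdist ler_wsqrtr// /qdist lerD2r.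
by rewrite ler_pXn2r ?nnegrE ?enorm_ge0// hmin// inE.
Qed.

(** The segment from y to x may meet [E]; for e > 0 the average is differentiable there as well. The
    direction x - y makes its length appear as the norm of [v] in the gradient bound. *)
Lemma lipschitz_sext e L u : 0 < e <= 1 ->
  (forall x y (t : R), B x -> B y -> 0 <= t <= 1 -> B (x + t *: (y - x))) ->
  nu.-integrable E (EFin \o u) -> 0 <= L -> lipschitz_eucl L E u ->
  lipschitz_eucl (lipschitz_const * L) B (sext e u).
Proof.
move=> e01 Bc iu L0 uL x y Bx By; have /andP[e0 _] := e01.
have d t := is_derive_sext N mE nuE (x - y) y t e0 iu.
have [|c c01 h] := @MVT R (fun t : R => sext e u (y + t *: (x - y)))
  (fun t : R => dsext (x - y) e u (y + t *: (x - y))) 0 1 ltr01.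
  by apply: continuous_subspaceT; exact: (continuous_is_derive d).
move: h; rewrite subr0 mulr1 scale1r scale0r addr0 subrKC => ->.
have Bz : B (y + c *: (x - y)).
  by apply: Bc => //; move: c01; rewrite in_itv/= => /andP[/ltW -> /ltW ->].
have [y0 Ey0 ymin] := rdist_argmin (y + c *: (x - y)).
have := normr_dsext_lipschitz (x - y) e01 Bz Ey0 (fun y => ymin e y (ltW e0)) iu L0 uL.
by [].
Qed.

Definition shepard_extend u x := if `[< E x >] then u x else sext 0 u x.
Local Notation extend := shepard_extend.

(** A point of [E] is its own nearest point, at regularised distance sqrt e, so
    [lipschitz_sum_weight] gives convergence to [u x] at the rate sqrt e. *)
Lemma cvg_extend L u x : B x -> nu.-integrable E (EFin \o u) -> 0 <= L -> lipschitz_eucl L E u ->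
  (fun j => sext (eps R j) u x) @ \oo --> extend u x.
Proof.
move=> Bx iu L0 uL; rewrite /shepard_extend; case: asboolP => Ex; last first.
  apply: cvg_sext => //; apply: away_closed => //.
  by apply: compact_closed cE; exact: norm_hausdorff.
have sq : (fun j => 2 * L * spread_const * Num.sqrt (eps R j)) @ \oo --> (0 : R).
  rewrite -[X in _ --> X](mulr0 (2 * L * spread_const)); apply: cvgM; first exact: cvg_cst.
  rewrite -[X in _ --> X](@sqrtr0 R).
  by apply: continuous_cvg; [exact: sqrt_continuous|exact: cvg_harmonic].
apply/cvgrPdist_le => r r0.
move/cvgrPdist_le : sq => /(_ r r0); apply: filterS => j.
rewrite sub0r normrN => h.
have e01 : 0 < eps R j <= 1 by rewrite eps_gt0 eps_le1.
have xx : rdist (eps R j) x x <= Num.sqrt (eps R j).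
  by rewrite (le_trans (rdist_le _ _ _)) ?(ltW (eps_gt0 _ _))// subrr enorm0 add0r.
apply: (le_trans (@lipschitz_sum_weight _ x x L u e01 Bx Ex _ iu L0 uL)).
  move=> y Ey; rewrite /rdist ler_wsqrtr// /qdist lerD2r subrr enorm0 expr0n/=.
  by rewrite sqr_ge0.
apply: le_trans (ler_norm _) (le_trans _ h).
rewrite !normrM ler_wpM2l// !ger0_norm ?rdist_ge0 ?sqrtr_ge0//.
Qed.

Lemma lipschitz_extend L u :
  (forall x y (t : R), B x -> B y -> 0 <= t <= 1 -> B (x + t *: (y - x))) ->
  nu.-integrable E (EFin \o u) -> 0 <= L -> lipschitz_eucl L E u ->
  lipschitz_eucl (lipschitz_const * L) B (extend u).
Proof.
move=> Bc iu L0 uL x y Bx By.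
have cx := cvg_extend Bx iu L0 uL; have cy := cvg_extend By iu L0 uL.
apply: (cvgr_to_le (cvg_norm (cvgB cx cy))).
by apply: nearW => j; apply: lipschitz_sext => //; rewrite eps_gt0 eps_le1.
Qed.

End lipschitz_extension.

(** * Sobolev estimates for the extension *)

Lemma Lp_onP (R : realType) (n : nat) (P : {measure set 'rV[R]_n -> \bar R}) (p : R)
    (U : set 'rV[R]_n) (f : 'rV[R]_n -> R) : measurable U -> 1 < p ->
  Lp_on P p U f <->
  measurable_fun U f /\ (\int[P]_(x in U) (`|f x| `^ p)%:E < +oo)%E.
Proof.
move=> mU p1; have p0 : 0 < p by lra.
have e1 : (\int[P]_x (`|(f \_ U) x| `^ p)%:E = \int[P]_(x in U) (`|f x| `^ p)%:E)%E.
  rewrite [RHS]integral_mkcond; apply: eq_integral => x _; rewrite !patchE.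
  by case: ifP => // _; rewrite normr0 powR0// gt_eqF.
rewrite /Lp_on -e1; split.
  move=> /andP[]; rewrite !inE/= => mf fin; split.
    exact/(measurable_restrictT _ mU).
  move: fin; rewrite /finite_norm unlock/= => /(lty_poweRy _) h.
  by apply: h; rewrite invr_eq0 gt_eqF.
move=> [mf fin]; apply/andP; split; rewrite !inE/=.
  exact/(measurable_restrictT _ mU).
by rewrite /finite_norm unlock/= poweR_lty.
Qed.

Section sobolev_extension.
Variables (R : realType) (n N : nat).
Variables (nu : {measure set 'rV[R]_n -> \bar R}) (E B : set 'rV[R]_n).
Variables (Q p theta T Cm Cu : R).
Hypothesis cE : compact E.
Hypothesis nuE : (0 < nu E < +oo)%E.
Hypothesis oB : open B.
Hypothesis Q0 : 0 < Q.
Hypothesis p1 : 1 < p.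
Hypothesis theta01 : 0 < theta < 1.
Hypothesis Mp : p + 2 * Q <= (2 * N)%:R.
Hypothesis Cm0 : 0 < Cm.
Hypothesis Cu0 : 0 < Cu.
Hypothesis T0 : 0 < T.
Hypothesis mass_low : forall e x y, away E e x -> E y -> rdist e x y <= T ->
  Cm^-1 * rdist e x y `^ (Q - (2 * N)%:R) <= mass N nu E e x.
Hypothesis nu_up : forall y (r : R), E y -> 0 < r ->
  (0 < nu (eball y r) <= (Cu * r `^ Q)%:E)%E.
Hypothesis BT : forall (e : R) x y, 0 <= e <= 1 -> B x -> E y -> rdist e x y <= T.
Hypothesis BET : forall x y, B x -> E y -> enorm (x - y) < T.
Implicit Types (u : 'rV[R]_n -> R) (x y z v : 'rV[R]_n) (e : R).
Local Notation M := ((2 * N)%:R : R).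
Local Notation sext := (shepard_ext N nu E).
Local Notation dsext := (shepard_dext N nu E).
Local Notation extend := (shepard_extend N nu E).

Let mE : measurable E. Proof. exact: compact_measurable_rV. Qed.
Let mB : measurable B. Proof. exact: open_measurable_rV. Qed.
Let clE : closed E. Proof. by apply: compact_closed cE; exact: norm_hausdorff. Qed.
Let nuoo : (nu E < +oo)%E. Proof. by have /andP[] := nuE. Qed.
Let p0 : 0 < p. Proof. by move: p1; lra. Qed.

Definition potential u x : \bar R :=
  (\int[nu]_(y in E) (`|u y| `^ p * enorm (x - y) `^ (- Q))%:E)%E.

Definition local_energy u x : \bar R :=
  (\int[nu]_(y in E) \int[nu]_(z in E)
    (`|u y - u z| `^ p * offdiag Q p x (y, z))%:E)%E.

(** The value 0 on [E] is arbitrary, [E] being null for the measures considered. *)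
Definition extend_grad u x : 'rV[R]_n :=
  \row_i (if `[< E x >] then 0 else dsext (basis_rV R i) 0 u x).

Lemma potential_ge0 u x : (0 <= potential u x)%E.
Proof. by apply: integral_ge0 => y _; rewrite lee_fin mulr_ge0 ?powR_ge0. Qed.

Lemma local_energy_ge0 u x : (0 <= local_energy u x)%E.
Proof.
by apply: integral_ge0 => y _; apply: integral_ge0 => z _; rewrite lee_fin mulr_ge0 ?powR_ge0.
Qed.

Lemma measurable_potential u : measurable_fun setT u -> measurable_fun setT (potential u).
Proof.
move=> mu.
apply: (@measurable_ge0_integral_param _ _ _ _ R nu E
  (fun w : 'rV[R]_n * 'rV[R]_n => (`|u w.2| `^ p * enorm (w.1 - w.2) `^ (- Q))%:E)) => //.
  apply/measurable_EFinP; apply: measurable_funM.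
    apply: (measurableT_comp (measurable_powR _)); apply: measurableT_comp => //.
    exact: (measurableT_comp mu measurable_snd).
  apply: (measurableT_comp (measurable_powR _)).
  by apply: measurable_enorm; apply: measurable_sub_rV.
by move=> w; rewrite lee_fin mulr_ge0 ?powR_ge0.
Qed.

Lemma measurable_local_energy u : measurable_fun setT u ->
  measurable_fun setT (local_energy u).
Proof.
move=> mu.
have o0 (w : 'rV[R]_n * ('rV[R]_n * 'rV[R]_n)) :
  (0 <= (`|u w.2.1 - u w.2.2| `^ p * offdiag Q p w.1 w.2)%:E)%E.
  by rewrite lee_fin mulr_ge0 ?powR_ge0.
apply: (@measurable_ge0_integral_param _ _ _ _ R nu E
  (fun w => \int[nu]_(z in E) (`|u w.2 - u z| `^ p * offdiag Q p w.1 (w.2, z))%:E)%E) => //.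
  apply: (@measurable_ge0_integral_param _ _ _ _ R nu E
    (fun w : 'rV[R]_n * 'rV[R]_n * 'rV[R]_n =>
      (`|u w.1.2 - u w.2| `^ p * offdiag Q p w.1.1 (w.1.2, w.2))%:E)) => //.
    have ma : measurable_fun setT
       (fun w : 'rV[R]_n * 'rV[R]_n * 'rV[R]_n => (w.1.1, (w.1.2, w.2))).
      apply: measurable_fun_pair; first exact: (measurableT_comp measurable_fst).
      apply: measurable_fun_pair; last exact: measurable_snd.
      exact: (measurableT_comp measurable_snd measurable_fst).
    exact: (measurableT_comp (measurable_offdiag Q p mu) ma).
  by move=> w; exact: (o0 (w.1.1, (w.1.2, w.2))).
by move=> w; apply: integral_ge0 => z _; exact: (o0 (w.1, (w.2, z))).
Qed.

(** Off [E] the distance |x - y| is positive. For x in [E] the majorant would lose the point y = x,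
    where a negative power of 0 counts as 0. *)
Lemma powR_sext_potential e u x : 0 <= e <= 1 -> B x -> ~ E x ->
  nu.-integrable E (EFin \o u) -> measurable_fun setT u ->
  ((`|sext e u x| `^ p)%:E <= Cm%:E * potential u x)%E.
Proof.
move=> e01 Bx nEx iu mu; have /andP[e0 _] := e01.
have a0 : away E 0 x by exact: away_closed.
have a : away E e x by exact: away_le a0.
have m0 : 0 < mass N nu E e x by exact: mass_pos.
apply: (le_trans (powR_sext_le mE nuoo a m0 p1 iu)).
have mpot : measurable_fun setT (fun y => (`|u y| `^ p * enorm (x - y) `^ (- Q))%:E).
  apply/measurable_EFinP; apply: measurable_funM.
    by apply: (measurableT_comp (measurable_powR _)); exact: measurableT_comp.
  apply: (measurableT_comp (measurable_powR _)).
  by apply: measurable_enorm; apply: measurable_sub_rV.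
rewrite /potential -ge0_integralZl_EFin ?(ltW Cm0)//; last 2 first.
- by move=> y _; rewrite lee_fin mulr_ge0 ?powR_ge0.
- exact: measurable_funTS.
apply: ge0_le_integral_nomeas => y Ey.
  by rewrite lee_fin mulr_ge0 ?powR_ge0 ?weight_ge0.
rewrite -[leRHS]EFinM lee_fin [leRHS]mulrCA ler_wpM2l ?powR_ge0//.
have xy0 : 0 < enorm (x - y) by rewrite -rdist0 rdist_gt0// (away_qdist a0).
apply: (le_trans (weight_le Cm0 mass_low a Ey (BT e01 Bx Ey))).
rewrite ler_wpM2l ?(ltW Cm0)//; apply: powRN_anti => //; first exact: ltW.
exact: enorm_le_rdist.
Qed.

Lemma powR_dsext_local_energy e u x i : 0 <= e <= 1 -> B x -> ~ E x ->
  nu.-integrable E (EFin \o u) -> measurable_fun setT u ->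
  ((`|dsext (basis_rV R i) e u x| `^ p)%:E <= (M `^ p * Cm ^+ 2)%:E * local_energy u x)%E.
Proof.
move=> e01 Bx nEx iu mu; have /andP[e0 _] := e01.
have a0 : away E 0 x by exact: away_closed.
have a : away E e x by exact: away_le a0.
have := powR_dsext_le mE nuoo Q0 Cm0 mass_low p1 Mp (basis_rV R i) a
  (fun y Ey => BT e01 Bx Ey) mu iu.
by rewrite enorm_basis mulr1.
Qed.

Lemma measurable_asboolE : measurable_fun setT (fun x => `[< E x >]).
Proof.
apply: (@measurable_fun_bool _ _ setT _ true).
rewrite setTI (_ : _ @^-1` _ = E)//; apply/seteqP; split => x /=.
  by move/asboolP.
by move/asboolP.
Qed.

Lemma measurable_extend u : measurable_fun setT u -> measurable_fun setT (extend u).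
Proof.
move=> mu; apply: measurable_fun_ifT => //; first exact: measurable_asboolE.
exact: measurable_sext.
Qed.

Lemma measurable_extend_grad i u : measurable_fun setT u ->
  measurable_fun setT (fun x => extend_grad u x 0 i).
Proof.
move=> mu; under eq_fun do rewrite mxE.
apply: measurable_fun_ifT => //; first exact: measurable_asboolE.
exact: measurable_dsext.
Qed.

(** The sup norm of the gradient is attained at one component, for which the bound on a single
    partial derivative applies; the return to the Euclidean norm costs the factor n. *)
Lemma enorm_extend_grad_le u x : B x -> ~ E x ->
  nu.-integrable E (EFin \o u) -> measurable_fun setT u ->
  ((enorm (extend_grad u x) `^ p)%:E <=
    (n%:R `^ p)%:E * ((M `^ p * Cm ^+ 2)%:E * local_energy u x))%E.
Proof.
move=> Bx nEx iu mu.
have h0 : (0 <= (n%:R `^ p)%:E * ((M `^ p * Cm ^+ 2)%:E * local_energy u x))%E.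
  apply: mule_ge0; first by rewrite lee_fin powR_ge0.
  apply: mule_ge0; last exact: local_energy_ge0.
  by rewrite lee_fin; apply: mulr_ge0; rewrite ?powR_ge0 ?sqr_ge0.
have gle := enorm_le_norm (extend_grad u x).
have [g0|/mx_norm_neq0[[j i] /= gi]] := eqVneq (mx_norm (extend_grad u x)) 0.
  have -> : enorm (extend_grad u x) = 0.
    apply/eqP; rewrite eq_le enorm_ge0 andbT (le_trans gle)//.
    by rewrite [X in _ * X]g0 mulr0.
  by rewrite powR0// gt_eqF.
apply: (@le_trans _ _ ((n%:R * `|extend_grad u x|) `^ p)%:E).
  by rewrite lee_fin ge0_ler_powR ?nnegrE ?enorm_ge0 ?mulr_ge0// ltW.
rewrite powRM// EFinM lee_wpmul2l ?lee_fin ?powR_ge0//.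
rewrite [X in X `^ p]gi mxE asboolF//.
by apply: powR_dsext_local_energy => //; rewrite lexx/=.
Qed.

Section growth_measure.
Variables (P : {measure set 'rV[R]_n -> \bar R}) (CP : R).
Hypothesis PB : (P B < +oo)%E.
Hypothesis CP0 : 0 <= CP.
Hypothesis growth : forall y (r : R), E y -> 0 < r ->
  (P (B `&` eball y r) <= (CP * r `^ (Q + p * (1 - theta)))%:E)%E.
Hypothesis PE : P E = 0%E.

Lemma integral_extend u : nu.-integrable E (EFin \o u) -> measurable_fun setT u ->
  (\int[P]_(x in B) (`|extend u x| `^ p)%:E <=
   (Cm * potential_const Q p theta T CP)%:E * \int[nu]_(y in E) (`|u y| `^ p)%:E)%E.
Proof.
move=> iu mu.
rewrite (@ge0_negligible_integral _ _ R P B E)//; last first.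
  apply/measurable_EFinP; apply: (measurableT_comp (measurable_powR _)).
  by apply: measurableT_comp => //; apply: measurable_funTS; exact: measurable_extend.
apply: (@le_trans _ _ (\int[P]_(x in B `\` E) (Cm%:E * potential u x))%E).
  apply: ge0_le_integral_nomeas => x [Bx nEx]; first by rewrite lee_fin powR_ge0.
  rewrite /shepard_extend asboolF//.
  by apply: powR_sext_potential => //; rewrite lexx/=.
apply: (@le_trans _ _ (\int[P]_(x in B) (Cm%:E * potential u x))%E).
  apply: ge0_subset_integral => //; first exact: measurableD.
    by apply: measurable_funeM; apply: measurable_funTS; exact: measurable_potential.
  by move=> x _; apply: mule_ge0; [rewrite lee_fin ltW|exact: potential_ge0].
rewrite ge0_integralZl_EFin ?(ltW Cm0)//; last 2 first.
- by move=> x _; exact: potential_ge0.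
- by apply: measurable_funTS; exact: measurable_potential.
rewrite EFinM -muleA lee_wpmul2l ?lee_fin ?(ltW Cm0)//.
exact: (integral_potential mE nuoo mB PB Q0 p1 theta01 T0 BET CP0 growth).
Qed.

Lemma integral_local_energy u : measurable_fun setT u ->
  (\int[P]_(x in B) local_energy u x <=
    (offdiag_const Q p theta CP Cu)%:E * besov_energy nu p theta E u)%E.
Proof.
move=> mu.
exact: (integral_offdiag mE nuoo mB PB Q0 p1 theta01 CP0 Cu0 growth nu_up mu).
Qed.

Lemma integral_extend_grad u : nu.-integrable E (EFin \o u) -> measurable_fun setT u ->
  (\int[P]_(x in B) (enorm (extend_grad u x) `^ p)%:E <=
   (n%:R `^ p * (M `^ p * Cm ^+ 2) * offdiag_const Q p theta CP Cu)%:E *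
     besov_energy nu p theta E u)%E.
Proof.
move=> iu mu.
have c0 : 0 <= n%:R `^ p * (M `^ p * Cm ^+ 2).
  by apply: mulr_ge0; [exact: powR_ge0|apply: mulr_ge0; rewrite ?powR_ge0 ?sqr_ge0].
have mg : measurable_fun setT (extend_grad u).
  by apply: measurable_fun_rV => i; exact: measurable_extend_grad.
rewrite (@ge0_negligible_integral _ _ R P B E)//; last 2 first.
- apply/measurable_EFinP; apply: (measurableT_comp (measurable_powR _)).
  by apply: measurable_funTS; exact: measurable_enorm.
- by move=> x _; rewrite lee_fin powR_ge0.
apply: (@le_trans _ _ (\int[P]_(x in B `\` E)
    ((n%:R `^ p * (M `^ p * Cm ^+ 2))%:E * local_energy u x))%E).
  apply: ge0_le_integral_nomeas => x [Bx nEx]; first by rewrite lee_fin powR_ge0.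
  by rewrite EFinM -muleA; exact: enorm_extend_grad_le.
apply: (@le_trans _ _ (\int[P]_(x in B)
    ((n%:R `^ p * (M `^ p * Cm ^+ 2))%:E * local_energy u x))%E).
  apply: ge0_subset_integral => //; first exact: measurableD.
    by apply: measurable_funeM; apply: measurable_funTS; exact: measurable_local_energy.
  by move=> x _; apply: mule_ge0; [rewrite lee_fin|exact: local_energy_ge0].
rewrite ge0_integralZl_EFin//; last 2 first.
- by move=> x _; exact: local_energy_ge0.
- by apply: measurable_funTS; exact: measurable_local_energy.
rewrite [X in (_ <= X * _)%E]EFinM -[leRHS]muleA lee_wpmul2l ?lee_fin//.
exact: integral_local_energy.
Qed.

End growth_measure.

Lemma normr_Rintegral_mul_le u (h : 'rV[R]_n -> R) (C : R) :
  nu.-integrable E (EFin \o u) -> measurable_fun E h -> (forall y, E y -> `|h y| <= C) ->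
  `|\int[nu]_(y in E) (u y * h y)| <= (\int[nu]_(y in E) `|u y|) * C.
Proof.
move=> iu mh hC; have iau := integrable_norm iu.
have iuh : nu.-integrable E (EFin \o (fun y => u y * h y)) by exact: integrable_mul_bounded hC.
rewrite (le_trans (le_normr_Rintegral _ _))//.
rewrite -RintegralZr//; apply: le_Rintegral => //.
- exact: (integrable_norm iuh).
- exact: integrable_mulr.
- by move=> y Ey; rewrite normrM ler_wpM2l// hC.
Qed.

(** The bound may blow up as e tends to 0: it serves, for each e separately, to make the products
    with test functions integrable. *)
Lemma ext_bounded e u : 0 < e <= 1 -> nu.-integrable E (EFin \o u) ->
  exists C, forall x i, B x -> `|sext e u x| <= C /\ `|dsext (basis_rV R i) e u x| <= C.
Proof.
move=> e01 iu; have /andP[e0 e1] := e01.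
have [y0 Ey0] : exists y, E y.
  apply: contrapT => nE; move: nuE; rewrite (_ : E = set0) ?measure0 ?ltxx//.
  by apply/seteqP; split => // y Ey; apply: nE; exists y.
have eN0 : 0 <= e ^- N by rewrite invr_ge0 exprn_ge0// ltW.
set I := \int[nu]_(y in E) `|u y|.
set J := \int[nu]_(y in E) `|cst (1:R) y|.
(* [W] bounds the inverse mass on all of [B], because distances are at most [T] and M - Q is
   nonnegative. *)
set W := Cm * T `^ (M - Q).
set D := M * 1 * (e ^- N / Num.sqrt e).
have I0 : 0 <= I by apply: Rintegral_ge0.
have J0 : 0 <= J by apply: Rintegral_ge0.
have D0 : 0 <= D by rewrite !mulr_ge0// invr_ge0.
have W0 : 0 <= W by rewrite mulr_ge0 ?powR_ge0 ?(ltW Cm0).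
have mW x : B x -> 0 <= (mass N nu E e x)^-1 <= W.
  move=> Bx; have a := away_gt0 E x e0.
  have e01' : 0 <= e <= 1 by rewrite ltW.
  have rT := BT e01' Bx Ey0.
  apply/andP; split; first by rewrite invr_ge0 ltW// (mass_gt0 Cm0 mass_low a Ey0).
  apply: (le_trans (massV_le Cm0 mass_low a Ey0 rT)).
  rewrite ler_wpM2l ?(ltW Cm0)// ge0_ler_powR ?nnegrE ?rdist_ge0 ?(ltW T0)//.
  by move: Mp p1 Q0; lra.
have sB x : B x -> `|sext e u x| <= I * e ^- N * W.
  move=> Bx; have /andP[m0 mw] := mW x Bx.
  rewrite /shepard_ext normrM [`|_^-1|]ger0_norm//; apply: ler_pM => //.
  apply: normr_Rintegral_mul_le => //; first exact: measurable_shepard_r.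
  by move=> y _; rewrite ger0_norm ?shepard_ge0 ?shepard_le// ltW.
exists (I * e ^- N * W + (I * D + I * e ^- N * W * (J * D)) * W) => x i Bx; split.
  apply: (le_trans (sB x Bx)); rewrite lerDl; apply: mulr_ge0 => //.
  have fin (a b c d f : R) : 0 <= a -> 0 <= b -> 0 <= c -> 0 <= d -> 0 <= f ->
      0 <= a * b + a * c * d * (f * b) by move=> *; rewrite addr_ge0 ?mulr_ge0.
  exact: fin.
rewrite -[leLHS]add0r; apply: lerD.
  by apply: mulr_ge0 => //; exact: mulr_ge0.
have /andP[m0 mw] := mW x Bx.
rewrite /shepard_dext normrM [`|_^-1|]ger0_norm//; apply: ler_pM => //.
have dD y : E y -> `|dshepard N (basis_rV R i) e x y| <= D.
  by move=> _; rewrite (le_trans (dshepard_le _ _ _ _ e0))// enorm_basis.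
rewrite (le_trans (ler_normB _ _))//; apply: lerD.
  by apply: normr_Rintegral_mul_le => //; exact: measurable_dshepard_r.
rewrite normrM; apply: ler_pM => //; first exact: sB.
rewrite (_ : Rintegral _ _ _ = \int[nu]_(y in E) (cst 1 y * dshepard N (basis_rV R i) e x y)).
  apply: normr_Rintegral_mul_le => //; last exact: measurable_dshepard_r.
  exact: integrable_cst1.
by apply: eq_Rintegral => y _; rewrite mul1r.
Qed.

(** On a set of finite measure this turns an integrable bound on the p-th power into an integrable
    bound on the function itself. *)
Lemma normr_le_1D_powR (a b : R) : `|a| `^ p <= b -> `|a| <= 1 + b.
Proof.
move=> ab; have [a1|a1] := leP `|a| 1.
  by rewrite (le_trans a1)// lerDl (le_trans _ ab)// powR_ge0.
rewrite (@le_trans _ _ b)//; last by rewrite lerDr.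
by rewrite (le_trans _ ab)// -[leLHS](powRr1 (normr_ge0 _)) ler_powR ?ltW.
Qed.

(** The majorant is 1 + H, where H adds the pointwise bounds on the p-th powers of the averages and
    of their partial derivatives. The energy estimates, applied to Lebesgue measure, make it
    integrable over [B]. *)
Lemma weak_gradient_extend (CP : R) u :
  (lebesgue_rV R n B < +oo)%E -> 0 <= CP ->
  (forall y (r : R), E y -> 0 < r ->
    (lebesgue_rV R n (B `&` eball y r) <= (CP * r `^ (Q + p * (1 - theta)))%:E)%E) ->
  lebesgue_rV R n E = 0%E ->
  measurable_fun setT u -> nu.-integrable E (EFin \o u) ->
  (\int[nu]_(y in E) (`|u y| `^ p)%:E < +oo)%E ->
  (besov_energy nu p theta E u < +oo)%E ->
  weak_gradient B (extend u) (extend_grad u).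
Proof.
move=> PB CP0 growth PE mu iu up ub; set m := lebesgue_rV R n.
pose H x := (Cm%:E * potential u x + (M `^ p * Cm ^+ 2)%:E * local_energy u x)%E.
have c0 : 0 <= M `^ p * Cm ^+ 2 by apply: mulr_ge0; rewrite ?powR_ge0 ?sqr_ge0.
have h1 x : (0 <= Cm%:E * potential u x)%E.
  by apply: mule_ge0; [rewrite lee_fin ltW|exact: potential_ge0].
have h2 x : (0 <= (M `^ p * Cm ^+ 2)%:E * local_energy u x)%E.
  by apply: mule_ge0; [rewrite lee_fin|exact: local_energy_ge0].
have H0 x : (0 <= H x)%E by rewrite adde_ge0.
have mp := measurable_potential mu; have me := measurable_local_energy mu.
have mH : measurable_fun setT H by apply: emeasurable_funD; exact: measurable_funeM.
have iH : m.-integrable B H.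
  apply/integrableP; split; first exact: measurable_funTS.
  rewrite (eq_integral (fun x => H x)); last by move=> x _; rewrite gee0_abs.
  rewrite ge0_integralD//; last 2 first.
  - by apply: measurable_funTS; exact: measurable_funeM.
  - by apply: measurable_funTS; exact: measurable_funeM.
  apply: lte_add_pinfty.
    rewrite ge0_integralZl_EFin ?(ltW Cm0)//; last 2 first.
    - by move=> x _; exact: potential_ge0.
    - exact: measurable_funTS.
    rewrite lte_mul_pinfty ?lee_fin ?(ltW Cm0)//.
    apply: (le_lt_trans (integral_potential mE nuoo mB PB Q0 p1 theta01 T0 BET CP0 growth mu)).
    have up0 : (0 <= \int[nu]_(y in E) (`|u y| `^ p)%:E)%E.
      by apply: integral_ge0 => y _; rewrite lee_fin powR_ge0.
    by rewrite -[X in (_ * X)%E]fineK ?ge0_fin_numE// -EFinM ltry.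
  rewrite ge0_integralZl_EFin//; last 2 first.
  - by move=> x _; exact: local_energy_ge0.
  - exact: measurable_funTS.
  rewrite lte_mul_pinfty ?lee_fin//.
  apply: (le_lt_trans (integral_local_energy PB CP0 growth mu)).
  rewrite lte_mul_pinfty ?lee_fin//.
  exact: offdiag_const_ge0.
(* [fine] turns an infinite majorant into 0, so its infinity set joins the exceptional set. *)
have [Z [mZ Z0 HZ]] := integrable_ae mB iH.
have fin x : B x -> ~ (E `|` Z) x -> [/\ ~ E x & (fine (H x))%:E = H x].
  move=> Bx nEZ; split; first by move=> Ex; apply: nEZ; left.
  rewrite fineK//; apply: contrapT => nf; apply: nEZ; right; apply: HZ => /=.
  by move=> /(_ Bx).
have e01 k : 0 <= eps R k <= 1 by rewrite eps_le1 ltW// eps_gt0.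
apply: (@weak_gradient_of_cvg _ _ B (E `|` Z) (fun k => sext (eps R k) u)
  (fun k i => dsext (basis_rV R i) (eps R k) u) _ _ (fun x => 1 + fine (H x))).
- exact: oB.
- exact: measurableU.
- by rewrite measureU0.
- by move=> k; exact: measurable_sext.
- by move=> k i; exact: measurable_dsext.
- by move=> k i x t; apply: is_derive_sext => //; exact: eps_gt0.
- by move=> k i x; apply: continuous_dsext => //; exact: eps_gt0.
- move=> k; have [|C hC] := @ext_bounded (eps R k) u _ iu.
    by rewrite eps_gt0 eps_le1.
  by exists C => x i Bx; exact: hC.
- by apply: measurable_funTS; exact: measurable_extend.
- by move=> i; apply: measurable_funTS; exact: measurable_extend_grad.
- move=> x Bx /(fin x Bx)[nEx _]; rewrite /shepard_extend asboolF//.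
  by apply: cvg_sext => //; exact: away_closed.
- move=> i x Bx /(fin x Bx)[nEx _]; rewrite mxE asboolF//.
  by apply: cvg_dsext => //; exact: away_closed.
- move=> k x Bx /(fin x Bx)[nEx HE]; apply: normr_le_1D_powR.
  rewrite -lee_fin HE (le_trans (powR_sext_potential (e01 k) Bx nEx iu mu))//.
  by rewrite leeDl.
- move=> k i x Bx /(fin x Bx)[nEx HE]; apply: normr_le_1D_powR.
  rewrite -lee_fin HE (le_trans (powR_dsext_local_energy i (e01 k) Bx nEx iu mu))//.
  by rewrite leeDr.
- have mBZ : measurable (B `\` (E `|` Z)) by apply: measurableD => //; exact: measurableU.
  have i1 : m.-integrable (B `\` (E `|` Z)) (fun x => 1%:E + H x)%E.
    apply: integrableD => //; last exact: integrableS iH.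
    apply/integrableP; split => //.
    under eq_integral do rewrite /= normr1.
    rewrite integral_cst// mul1e (le_lt_trans _ PB)// le_measure ?inE//.
  apply: eq_integrable i1 => // x /set_mem[Bx /(fin x Bx)[_ HE]].
  by rewrite /= EFinD HE.
Qed.

End sobolev_extension.

(** * Ahlfors regular sets *)

Lemma le_measure_subset d (T : measurableType d) (R : realType)
    (mu : {measure set T -> \bar R}) (A B : set T) :
  measurable A -> measurable B -> A `<=` B -> (mu A <= mu B)%E.
Proof. by move=> mA mB AB; apply: le_measure => //; exact: mem_set. Qed.

Section ahlfors_measure.
Variables (R : realType) (n : nat).
Variables (nu : {measure set 'rV[R]_n -> \bar R}) (E : set 'rV[R]_n).
Variables (Q delta C : R).
Hypothesis cE : compact E.
Hypothesis Q0 : 0 < Q.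
Hypothesis delta0 : 0 < delta.
Hypothesis C0 : 0 < C.
Hypothesis regE : forall y (r : R), E y -> 0 < r <= delta ->
  ((C^-1 * r `^ Q)%:E <= nu (E `&` eball y r) <= (C * r `^ Q)%:E)%E.
Implicit Types (x y z : 'rV[R]_n).

Let mE : measurable E. Proof. exact: compact_measurable_rV. Qed.

Let mEball y r : measurable (E `&` eball y r).
Proof. by apply: measurableI => //; exact: measurable_eball. Qed.

(** By compactness finitely many balls of radius [delta], the largest scale at which regularity is
    assumed, cover [E]. *)
Lemma ahlfors_finite : (nu E < +oo)%E.
Proof.
have := cE; rewrite compact_cover => /(_ 'rV[R]_n E (fun x => eball x delta)).
case=> [x _|x Ex|D DE ED].
- exact: open_eball.
- by exists x => //; rewrite /eball/= subrr enorm0.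
pose X := [set` finmap.enum_fset D].
have h := @content_sub_fsum _ _ _ nu _ X E (fun x => E `&` eball x delta)
  (finite_seq _) (fun i _ => mEball i delta) mE.
apply: (le_lt_trans (h _)).
  by move=> x Ex; have [y Dy xy] := ED _ Ex; exists y.
rewrite -fsbig_seq ?finmap.fset_uniq// big_seq; apply: lte_sum_pinfty => x Dx.
have /set_mem Ex := DE _ Dx.
have dd : 0 < delta <= delta by rewrite delta0 lexx.
by have /andP[_ le] := regE Ex dd; exact: le_lt_trans le (ltry _).
Qed.

(** The second term takes care of radii above [delta], where the total measure is the best available
    bound. *)
Definition ahlfors_upper_const := C + fine (nu E) / delta `^ Q.

Lemma ahlfors_upper_const_gt0 : 0 < ahlfors_upper_const.
Proof. by rewrite ltr_pwDl// divr_ge0 ?powR_ge0 ?fine_ge0. Qed.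

Lemma ahlfors_upper y r : E y -> 0 < r ->
  (0 < nu (E `&` eball y r) <= (ahlfors_upper_const * r `^ Q)%:E)%E.
Proof.
move=> Ey r0; apply/andP; split.
  have m0 : 0 < Num.min r delta by rewrite lt_min r0.
  have md : 0 < Num.min r delta <= delta by rewrite m0 ge_min lexx orbT.
  have /andP[low _] := regE Ey md.
  apply: (@lt_le_trans _ _ (C^-1 * (Num.min r delta) `^ Q)%:E).
    by rewrite lte_fin mulr_gt0 ?powR_gt0 ?invr_gt0.
  apply: (le_trans low).
  apply: le_measure_subset => // => z [Ez yz]; split => //.
  by apply: lt_le_trans yz _; rewrite ge_min lexx.
have [rd|dr] := leP r delta.
  have rr : 0 < r <= delta by rewrite r0.
  have /andP[_ up] := regE Ey rr.
  rewrite (le_trans up)// lee_fin ler_wpM2r ?powR_ge0//.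
  by rewrite lerDl divr_ge0 ?powR_ge0 ?fine_ge0.
apply: (@le_trans _ _ (nu E)); first by apply: le_measure_subset => // => z [].
rewrite -(fineK (_ : nu E \is a fin_num)); last by rewrite ge0_fin_numE ?ahlfors_finite.
rewrite lee_fin mulrDl (le_trans _ (_ : fine (nu E) / delta `^ Q * r `^ Q <= _))//; last first.
  by rewrite lerDr mulr_ge0 ?powR_ge0 ?(ltW C0).
rewrite mulrAC ler_pdivlMr ?powR_gt0// ler_wpM2l ?fine_ge0//.
by rewrite ge0_ler_powR ?nnegrE ?(ltW Q0) ?(ltW delta0) ?(ltW r0) ?(ltW dr).
Qed.

(** A ball that meets [E] lies in a ball of twice the radius centred at a point of [E], whence
    2^Q. *)
Lemma ahlfors_upper_any x r : 0 < r ->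
  (nu (E `&` eball x r) <= (ahlfors_upper_const * 2 `^ Q * r `^ Q)%:E)%E.
Proof.
move=> r0; have [[y [Ey xy]]|no] := pselect (E `&` eball x r !=set0); last first.
  rewrite (_ : _ `&` _ = set0) ?measure0 ?lee_fin ?mulr_ge0 ?powR_ge0 ?(ltW
    ahlfors_upper_const_gt0)//.
  by apply/seteqP; split => // y Ey; apply: no; exists y.
have r20 : 0 < 2 * r by rewrite mulr_gt0.
have /andP[_ up] := ahlfors_upper Ey r20.
rewrite -mulrA -powRM ?(ltW r0)// (le_trans _ up)// le_measure_subset// => z [Ez xz]; split => //.
rewrite /eball/= in xy xz *; have := enorm_distD x y z.
by rewrite (enormC y x); lra.
Qed.

(** The radius is shrunk by delta / T, which brings every r <= T into the range where regularity is
    assumed. *)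
Lemma ahlfors_lower T : delta <= T -> forall y r, E y -> 0 < r <= T ->
  ((C^-1 * (delta / T) `^ Q * r `^ Q)%:E <= nu (E `&` eball y r))%E.
Proof.
move=> dT y r Ey /andP[r0 rT]; have T0 : 0 < T := lt_le_trans delta0 dT.
have dT0 : 0 < delta / T by rewrite divr_gt0.
have rr0 : 0 < delta / T * r by rewrite mulr_gt0.
have rd : delta / T * r <= delta by rewrite mulrAC ler_pdivrMr// ler_wpM2l// ltW.
have rr : 0 < delta / T * r <= delta by rewrite rr0.
have /andP[low _] := regE Ey rr.
rewrite -mulrA -powRM ?(ltW r0) ?(ltW dT0)// (le_trans low)//.
apply: le_measure_subset => // => z [Ez yz]; split => //.
apply: lt_le_trans yz _; rewrite -[leRHS]mul1r ler_wpM2r ?(ltW r0)//.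
by rewrite ler_pdivrMr// mul1r.
Qed.

(** The pairs of points of [E] at distance less than r are measured by P and [nu] in both orders.
    Lower regularity and the growth of P give C^-1 r^Q P(E) <= CP r^s nu(E), so P(E) is at most a
    multiple of r^(s-Q) for all small r. *)
Lemma ahlfors_null (P : {measure set 'rV[R]_n -> \bar R}) (B : set 'rV[R]_n) (CP s : R) :
  E `<=` B -> measurable B -> (P B < +oo)%E -> Q < s -> 0 <= CP ->
  (forall y r, E y -> 0 < r -> (P (B `&` eball y r) <= (CP * r `^ s)%:E)%E) ->
  P E = 0%E.
Proof.
move=> EB mB PB Qs CP0 growth; have nuoo := ahlfors_finite.
have PEoo : (P E < +oo)%E by apply: le_lt_trans PB; exact: le_measure_subset.
have main r : 0 < r <= delta ->
    ((C^-1 * r `^ Q)%:E * P E <= (CP * r `^ s)%:E * nu E)%E.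
  move=> /andP[r0 rd].
  pose D : set ('rV[R]_n * 'rV[R]_n) := [set w | enorm (w.1 - w.2) < r].
  have mD : measurable D.
    rewrite (_ : D = (fun w : 'rV[R]_n * 'rV[R]_n => enorm (w.1 - w.2)) @^-1` `]-oo, r[%classic).
      rewrite -[X in measurable X]setTI; apply: measurable_enorm => //.
      exact: measurable_sub_rV.
    by apply/seteqP; split => w /=; rewrite in_itv.
  have md : measurable_fun setT (fun w => (\1_D w : R)%:E).
    by apply/measurable_EFinP; exact: measurable_indic.
  have slice (mm : {measure set 'rV[R]_n -> \bar R}) (f : 'rV[R]_n -> R) y :
      (forall z, f z = \1_(eball y r) z) ->
      (\int[mm]_(z in E) (f z)%:E = mm (E `&` eball y r))%E.
    move=> fE; under eq_integral do rewrite fE.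
    by rewrite integral_indic; [rewrite setIC|exact: mE|exact: measurable_eball].
  have e1 x z : \1_D (x, z) = \1_(eball x r) z :> R by [].
  have e2 x z : \1_D (x, z) = \1_(eball z r) x :> R.
    rewrite !indicE; congr (_%:R); congr (nat_of_bool _).
    have ->: (x, z) \in D = (enorm (x - z) < r) by apply/idP/idP => [/set_mem|h] //; exact: mem_set.
    rewrite (enormC x z).
    by apply/idP/idP => [h|/set_mem]//; exact: mem_set.
  apply: (@le_trans _ _ (\int[P]_(x in E) \int[nu]_(z in E) (\1_D (x, z))%:E)%E).
    rewrite -integral_cst//; apply: ge0_le_integral_nomeas => x Ex.
      by rewrite lee_fin mulr_ge0 ?powR_ge0 ?invr_ge0 ?(ltW C0).
    rewrite (slice _ _ x)//.
    have rr : 0 < r <= delta by rewrite r0.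
    by have /andP[] := regE Ex rr.
  rewrite (tonelli_on mE PEoo mE nuoo md)//.
  rewrite -integral_cst//; apply: ge0_le_integral_nomeas => z Ez.
    by apply: integral_ge0 => x _; rewrite lee_fin.
  rewrite (slice _ _ z)//.
  apply: le_trans (growth z r Ez r0); apply: le_measure_subset => //.
    by apply: measurableI => //; exact: measurable_eball.
  by move=> x [Ex ?]; split => //; exact: EB.
apply/eqP; rewrite eq_le measure_ge0 andbT.
have PEf : P E \is a fin_num by rewrite ge0_fin_numE.
have nuf : nu E \is a fin_num by rewrite ge0_fin_numE.
rewrite -(fineK PEf) lee_fin leNgt; apply/negP => a0.
set a := fine (P E) in a0; set K := C * CP * fine (nu E).
have K0 : 0 <= K by rewrite !mulr_ge0 ?fine_ge0 ?(ltW C0).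
have main' r : 0 < r <= delta -> a <= K * r `^ (s - Q).
  move=> /[dup] rd /andP[r0 _]; have := main r rd.
  rewrite -(fineK PEf) -(fineK nuf) -!EFinM lee_fin -/a => h.
  have rQ : 0 < r `^ Q by rewrite powR_gt0.
  have : (C * (r `^ Q)^-1) * (C^-1 * r `^ Q * a) <= (C * (r `^ Q)^-1) * (CP * r `^ s * fine (nu E)).
    by rewrite ler_wpM2l// mulr_ge0 ?invr_ge0 ?ltW.
  rewrite [leLHS](_ : _ = a); last by field; rewrite !gt_eqF.
  by rewrite powRDp// powRN /K => /le_trans; apply; rewrite le_eqVlt; apply/orP; left; apply/eqP;
    ring.
(* This radius makes K r^(s-Q) smaller than a/2; K + 1 stands in for K, which may be 0. *)
pose r := Num.min delta ((a / (2 * (K + 1))) `^ (s - Q)^-1).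
have b0 : 0 < a / (2 * (K + 1)) by rewrite divr_gt0// mulr_gt0// ltr_wpDl.
have r0 : 0 < r by rewrite lt_min delta0 powR_gt0.
have rd : 0 < r <= delta by rewrite r0 ge_min lexx.
have sQ : 0 < s - Q by rewrite subr_gt0.
have : r `^ (s - Q) <= a / (2 * (K + 1)).
  have -> : a / (2 * (K + 1)) = ((a / (2 * (K + 1))) `^ (s - Q)^-1) `^ (s - Q).
    by rewrite -powRrM mulVf ?gt_eqF// powRr1// ltW.
  rewrite ge0_ler_powR ?nnegrE ?powR_ge0 ?(ltW sQ) ?(ltW r0)//.
  by rewrite ge_min lexx orbT.
move=> h; have := main' r rd => h2.
have : a <= K * (a / (2 * (K + 1))) by rewrite (le_trans h2)// ler_wpM2l.
rewrite mulrA ler_pdivlMr ?mulr_gt0 ?ltr_wpDl//.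
have aK : 0 <= a * K by rewrite mulr_ge0 ?(ltW a0).
move=> h3; have : a * (2 * (K + 1)) = 2 * (a * K) + 2 * a by ring.
by move: h3; rewrite (mulrC K a); lra.
Qed.

End ahlfors_measure.

(** For r <= 1 lowering the exponent from t to s only weakens the bound; for r > 1 the finite
    measure of [B] is enough, since then r^s >= 1. *)
Lemma growth_of_local (R : realType) (n : nat) (P : {measure set 'rV[R]_n -> \bar R})
    (E B : set 'rV[R]_n) (c s t : R) : measurable B -> (P B < +oo)%E ->
  0 <= s <= t -> 0 <= c ->
  (forall y r, E y -> 0 < r <= 1 -> (P (eball y r) <= (c * r `^ t)%:E)%E) ->
  forall y r, E y -> 0 < r -> (P (B `&` eball y r) <= ((c + fine (P B)) * r `^ s)%:E)%E.
Proof.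
move=> mB PB /andP[s0 st] c0 loc y r Ey r0.
have mb : measurable (B `&` eball y r) by apply: measurableI => //; exact: measurable_eball.
have [r1|r1] := leP r 1.
  apply: (@le_trans _ _ (P (eball y r))).
    by apply: le_measure_subset => //; exact: measurable_eball.
  have rr : 0 < r <= 1 by rewrite r0.
  apply: (le_trans (loc _ _ Ey rr)).
  rewrite lee_fin; apply: ler_pM => //; rewrite ?powR_ge0//.
    by rewrite lerDl fine_ge0.
  by apply: ger_powR => //; rewrite r0.
apply: (@le_trans _ _ (P B)); first by exact: le_measure_subset.
rewrite -(fineK (_ : P B \is a fin_num)); last by rewrite ge0_fin_numE.
rewrite lee_fin -[leLHS]mulr1; apply: ler_pM => //; rewrite ?fine_ge0//.
  by rewrite lerDr.
by rewrite -[leLHS](powRr0 r) ler_powR// ltW.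
Qed.

Section lebesgue_balls.
Variables (R : realType) (n : nat).
Implicit Types (x y v : 'rV[R]_n) (r : R).

Lemma normr_coord_le_enorm v i : `|v 0 i| <= enorm v.
Proof.
rewrite -sqrtr_sqr ler_wsqrtr// (bigD1 i)//= lerDl sumr_ge0// => k _.
by rewrite sqr_ge0.
Qed.

Lemma eball_sub_box x r : eball x r `<=` box (fun i => x 0 i) r.
Proof.
move=> y xy i; apply: le_lt_trans xy.
rewrite -normrN opprB; have := normr_coord_le_enorm (x - y) i.
by rewrite !mxE.
Qed.

Lemma lebesgue_eball x r : 0 < r -> (lebesgue_rV R n (eball x r) <= (2 ^+ n * r `^ n%:R)%:E)%E.
Proof.
move=> r0; apply: (le_trans (le_measure_subset (lebesgue_rV R n) _ _ (@eball_sub_box x r))).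
- exact: measurable_eball.
- exact: measurable_box.
apply: (le_trans (lebesgue_box _ r0)).
by rewrite lee_fin exprMn powR_mulrn// ltW.
Qed.

(** The ball lies in a closed box, which is compact, and there the density is integrable. *)
Lemma weighted_lebesgue_eball (mu : {measure set 'rV[R]_n -> \bar R}) x r :
  weighted_lebesgue mu -> (mu (eball x r) < +oo)%E.
Proof.
move=> [w [w0 [mw wK] muE]].
pose K := [set v : 'rV[R]_n | forall i, `[x 0 i - r, x 0 i + r]%classic (v ord0 i)].
have cK : compact K by exact: (rV_compact (fun i => @segment_compact R (x 0 i - r) (x 0 i + r))).
have sub : eball x r `<=` K.
  move=> y xy i; have := eball_sub_box xy i => /ltW.
  by rewrite /= in_itv/= ler_norml; lra.
have mK := compact_measurable_rV cK.
apply: (@le_lt_trans _ _ (mu K)).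
  by apply: le_measure_subset => //; exact: measurable_eball.
rewrite muE//; have := wK K cK (fun _ _ => I).
by congr (_ < _)%E; apply: eq_integral => y _; rewrite ger0_norm.
Qed.

Lemma weighted_lebesgue_null (mu : {measure set 'rV[R]_n -> \bar R}) A :
  weighted_lebesgue mu -> measurable A -> lebesgue_rV R n A = 0%E -> mu A = 0%E.
Proof.
move=> [w [w0 [mw _] muE]] mA A0; rewrite muE//; apply: null_set_integral => //.
by apply/measurable_EFinP; exact: measurable_funTS.
Qed.

Lemma eball_convex x r y z (t : R) : eball x r y -> eball x r z -> 0 <= t <= 1 ->
  eball x r (y + t *: (z - y)).
Proof.
move=> xy xz /andP[t0 t1]; rewrite /eball/= in xy xz *.
rewrite (_ : x - _ = (1 - t) *: (x - y) + t *: (x - z)); last first.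
  by apply/rowP => i; rewrite !mxE; ring.
apply: (le_lt_trans (ler_enormD _ _)); rewrite !enormZ !ger0_norm ?subr_ge0//.
(* The strict inequality is taken from the term with factor t, so t = 0 is treated apart. *)
have [t00|t00] := eqVneq t 0; first by rewrite t00 subr0 mul1r mul0r addr0.
have tp : 0 < t by rewrite lt_def t00.
have h1 : (1 - t) * enorm (x - y) <= (1 - t) * r by rewrite ler_wpM2l ?subr_ge0// ltW.
have h2 : t * enorm (x - z) < t * r by rewrite ltr_pM2l.
by lra.
Qed.

End lebesgue_balls.

(** * The extension operator *)

(** A superlevel set {u > a} is the trace on [E] of a union of open balls: near a point x of it, u
    stays above a within the radius (u x - a) / (L + 1). Adding 1 covers L = 0. *)
Lemma lipschitz_measurable (R : realType) (n : nat) (E : set 'rV[R]_n) (L : R)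
    (u : 'rV[R]_n -> R) : measurable E -> 0 <= L -> lipschitz_eucl L E u ->
  measurable_fun E u.
Proof.
move=> mE L0 uL.
apply: (measurability _ (RGenOInfty.measurableE R)) => _ [_ [a ->] <-].
rewrite (_ : _ `&` _ = E `&`
    \bigcup_(x in [set x | E x /\ a < u x]) eball x ((u x - a) / (L + 1))).
  apply: measurableI => //; apply: open_measurable_rV.
  by apply: bigcup_open => x _; exact: open_eball.
have L1 : 0 < L + 1 by rewrite ltr_wpDl.
apply/seteqP; split => [x [Ex]|y [Ey [x [Ex ax] xy]]]; rewrite /= in_itv/= andbT.
  move=> ax; split => //; exists x => //.
  by rewrite /eball/= subrr enorm0 divr_gt0// subr_gt0.
split => //; have := uL x y Ex Ey; rewrite ler_norml => /andP[_ h].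
move: xy; rewrite /eball/= ltr_pdivlMr// => h2; have := enorm_ge0 (x - y).
by move: h h2; rewrite mulrDr mulr1 mulrC; lra.
Qed.

Section sext_algebra.
Variables (R : realType) (n N : nat).
Variables (nu : {measure set 'rV[R]_n -> \bar R}) (E : set 'rV[R]_n).
Hypothesis mE : measurable E.
Implicit Types (u v : 'rV[R]_n -> R) (x : 'rV[R]_n) (e a : R).
Local Notation sext := (shepard_ext N nu E).

Lemma sext_linear e a u v x : away E e x ->
  nu.-integrable E (EFin \o u) -> nu.-integrable E (EFin \o v) ->
  sext e (fun y => a * u y + v y) x = a * sext e u x + sext e v x.
Proof.
move=> aw iu iv; rewrite /shepard_ext mulrA -mulrDl; congr (_ / _).
have iuK := integrable_mul_shepard N mE aw iu.
have ivK := integrable_mul_shepard N mE aw iv.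
rewrite -RintegralZl// -RintegralD//; last first.
  by apply: eq_integrable (integrable_mulr mE a iuK) => // y _; rewrite /= mulrC.
by apply: eq_Rintegral => y _; ring.
Qed.

Lemma eq_sext_ae e u v x : measurable_fun E u -> measurable_fun E v ->
  {ae nu, forall y, E y -> u y = v y} -> sext e u x = sext e v x.
Proof.
move=> mu mv uv; rewrite /shepard_ext; congr (_ / _); rewrite /Rintegral; congr fine.
apply: ae_eq_integral => //.
- by apply/measurable_EFinP; apply: measurable_funM => //; exact: measurable_shepard_r.
- by apply/measurable_EFinP; apply: measurable_funM => //; exact: measurable_shepard_r.
- by apply: filterS uv => y h Ey; rewrite h.
Qed.

End sext_algebra.

Section restriction.
Variables (R : realType) (n : nat).
Variables (nu : {measure set 'rV[R]_n -> \bar R}) (E : set 'rV[R]_n) (p theta : R).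
Hypothesis mE : measurable E.
Hypothesis nuoo : (nu E < +oo)%E.
Hypothesis p1 : 1 < p.
Implicit Types (u : 'rV[R]_n -> R).

Lemma patch_in u x : E x -> (u \_ E) x = u x.
Proof. by move=> Ex; rewrite patchE mem_set. Qed.

Lemma besov_energy_patch u : besov_energy nu p theta E (u \_ E) = besov_energy nu p theta E u.
Proof.
apply: eq_integral => x /set_mem Ex; apply: eq_integral => y /set_mem Ey.
by rewrite !patch_in.
Qed.

Lemma integral_powR_patch u :
  (\int[nu]_(x in E) (`|(u \_ E) x| `^ p)%:E = \int[nu]_(x in E) (`|u x| `^ p)%:E)%E.
Proof. by apply: eq_integral => x /set_mem Ex; rewrite patch_in. Qed.

Lemma besov_measurable u : besov nu p theta E u -> measurable_fun E u.
Proof. by move=> [/(Lp_onP _ _ mE p1)[]]. Qed.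

Lemma besov_integrable u : besov nu p theta E u -> nu.-integrable E (EFin \o u).
Proof.
move=> [/(Lp_onP _ _ mE p1)[mu fin] _].
have mup : measurable_fun E (fun y => `|u y| `^ p).
  by apply: (measurableT_comp (measurable_powR _)); exact: measurableT_comp.
have iup : nu.-integrable E (EFin \o (fun y => `|u y| `^ p)).
  by apply: integrable_nonneg_fin => // y _; exact: powR_ge0.
apply: integrable_dom (integrable_addr mE (integrable_cst1 mE nuoo) iup) => //.
by move=> y _; apply: (normr_le_1D_powR p1).
Qed.

Lemma integrable_patch u : nu.-integrable E (EFin \o u) -> nu.-integrable E (EFin \o (u \_ E)).
Proof. by apply: eq_integrable => // x /set_mem Ex; rewrite /= patch_in. Qed.

End restriction.

(** * The operator for a nonempty set that is regular up to a scale [delta] *)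

Section ahlfors_extension.
Variables (R : realType) (n : nat) (Q p theta alpha : R).
Variables (E : set 'rV[R]_n) (x0 : 'rV[R]_n) (r0 : R).
Variables (mu nu : {measure set 'rV[R]_n -> \bar R}) (delta Creg : R).
Hypothesis hQ : 0 < Q < n%:R.
Hypothesis cE : compact E.
Hypothesis E0 : E !=set0.
Hypothesis hdelta : 0 < delta <= 1.
Hypothesis Creg0 : 0 < Creg.
Hypothesis regE : forall y (r : R), E y -> 0 < r <= delta ->
  ((Creg^-1 * r `^ Q)%:E <= nu (E `&` eball y r) <= (Creg * r `^ Q)%:E)%E.
Hypothesis nuR : forall A, nu A = nu (E `&` A).
Hypothesis hr0 : 0 < r0.
Hypothesis hEB : E `<=` eball x0 (r0 / 2).
Hypothesis p1 : 1 < p.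
Hypothesis theta01 : 0 < theta < 1.
Hypothesis halpha : alpha <= 0.
Hypothesis hthetaalpha : 1 - (alpha + n%:R - Q) / p <= theta.
Hypothesis hmu : weighted_lebesgue mu.
Variable N : nat.
Hypothesis Mp : p + 2 * Q <= (2 * N)%:R.
Variable c : R.
Hypothesis c0 : 0 <= c.
Hypothesis mu_up : forall y (r : R), E y -> 0 < r <= 1 ->
  (mu (eball y r) <= (c * r `^ (n%:R + alpha))%:E)%E.

Local Notation B := (eball x0 r0).
Local Notation m := (lebesgue_rV R n).
Local Notation s := (Q + p * (1 - theta)).

Let mE : measurable E. Proof. exact: compact_measurable_rV. Qed.
Let mB : measurable B. Proof. exact: measurable_eball. Qed.
Let Q0 : 0 < Q. Proof. by have /andP[] := hQ. Qed.
Let p0 : 0 < p. Proof. by move: p1; lra. Qed.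
Let delta0 : 0 < delta. Proof. by have /andP[] := hdelta. Qed.

Let EB : E `<=` B.
Proof. by move=> x /hEB; rewrite /eball/= => /lt_trans; apply; move: hr0; lra. Qed.

Let nuoo : (nu E < +oo)%E. Proof. exact: ahlfors_finite regE. Qed.

Let nu_up y (r : R) : E y -> 0 < r ->
  (0 < nu (eball y r) <= (ahlfors_upper_const nu E Q delta Creg * r `^ Q)%:E)%E.
Proof. by move=> Ey r1; rewrite nuR; exact: ahlfors_upper. Qed.

Let nuE : (0 < nu E < +oo)%E.
Proof.
rewrite nuoo andbT; have [y Ey] := E0.
have /andP[pos _] := ahlfors_upper cE Q0 delta0 Creg0 regE Ey ltr01.
apply: (lt_le_trans pos); apply: le_measure_subset => //.
by apply: measurableI => //; exact: measurable_eball.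
Qed.

(** This is the hypothesis relating [theta] and [alpha], multiplied by p. *)
Let s_le : s <= n%:R + alpha.
Proof.
have : p * (1 - (alpha + n%:R - Q) / p) <= p * theta by rewrite ler_wpM2l// ltW.
rewrite mulrBr mulr1 mulrCA divff ?gt_eqF// mulr1 mulrBr mulr1; lra.
Qed.

Let Qs : Q < s.
Proof. by have /andP[_ t1] := theta01; rewrite ltrDl mulr_gt0// subr_gt0. Qed.

Let s0 : 0 <= s. Proof. by apply: ltW; exact: lt_trans Qs. Qed.

Let mBoo : (m B < +oo)%E.
Proof. exact: le_lt_trans (lebesgue_eball _ hr0) (ltry _). Qed.

Let muBoo : (mu B < +oo)%E. Proof. exact: weighted_lebesgue_eball. Qed.

(** Lebesgue measure grows with exponent n, and here alpha <= 0 yields s <= n + alpha <= n. *)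
Let mgrowth y (r : R) : E y -> 0 < r ->
  (m (B `&` eball y r) <= ((2 ^+ n + fine (m B)) * r `^ s)%:E)%E.
Proof.
apply: (@growth_of_local _ _ m E B _ s n%:R) => //.
- by rewrite s0/=; move: s_le halpha; lra.
- by move=> z q _ /andP[q0 _]; exact: lebesgue_eball.
Qed.

Let mugrowth y (r : R) : E y -> 0 < r ->
  (mu (B `&` eball y r) <= ((c + fine (mu B)) * r `^ s)%:E)%E.
Proof.
apply: (@growth_of_local _ _ mu E B _ s (n%:R + alpha)) => //.
by rewrite s0.
Qed.

Let mCP0 : 0 <= 2 ^+ n + fine (m B) :> R.
Proof. by rewrite addr_ge0 ?fine_ge0 ?exprn_ge0. Qed.

Let muCP0 : 0 <= c + fine (mu B). Proof. by rewrite addr_ge0 ?fine_ge0. Qed.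

Lemma lebesgue_ahlfors_null : m E = 0%E.
Proof. exact: (ahlfors_null cE delta0 Creg0 regE EB mB mBoo Qs mCP0 mgrowth). Qed.

Let muE : mu E = 0%E.
Proof. exact: weighted_lebesgue_null hmu mE lebesgue_ahlfors_null. Qed.

Local Notation M := ((2 * N)%:R : R).

Let MQ : Q + 1 < M. Proof. by move: Mp p1 Q0; lra. Qed.

(** Points of [B] and [E] are less than 2 r0 apart, and passing to the regularised distance adds at
    most sqrt e <= 1. *)
Local Notation T := (2 * r0 + 1).

Let T0 : 0 < T. Proof. by move: hr0; lra. Qed.

Let BET x y : B x -> E y -> enorm (x - y) < T.
Proof.
move=> Bx /hEB Ey; rewrite /eball/= in Bx Ey *.
have := enorm_distD x0 x y; rewrite (enormC x x0); move: hr0; lra.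
Qed.

Let BT (e : R) x y : 0 <= e <= 1 -> B x -> E y -> rdist e x y <= T.
Proof.
move=> /andP[e0 e1] Bx /hEB Ey; rewrite /eball/= in Bx Ey *.
have := enorm_distD x0 x y; rewrite (enormC x x0) => h.
apply: (le_trans (rdist_le x y e0)).
have : Num.sqrt e <= 1 by rewrite -(@sqrtr1 R) ler_wsqrtr.
by move: hr0 h Bx Ey; lra.
Qed.

Let cl : R := Creg^-1 * (delta / T) `^ Q.

Let cl0 : 0 < cl.
Proof. by rewrite mulr_gt0 ?invr_gt0// powR_gt0// divr_gt0. Qed.

Definition mass_const := 3 `^ M / cl.
Local Notation Cm := mass_const.

Let Cm0 : 0 < Cm. Proof. by rewrite divr_gt0// powR_gt0. Qed.

Let mass_low e x y : away E e x -> E y -> rdist e x y <= T ->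
  Cm^-1 * rdist e x y `^ (Q - M) <= mass N nu E e x.
Proof.
move=> a Ey rT; have dT : delta <= T by have /andP[_] := hdelta; move: hr0; lra.
exact: (mass_lower N mE nuoo cl0 (ahlfors_lower cE delta0 regE dT) a Ey rT).
Qed.

Local Notation Cu := (ahlfors_upper_const nu E Q delta Creg).
Let Cu0 : 0 < Cu. Proof. exact: ahlfors_upper_const_gt0. Qed.

Let nu_up_any x (r : R) : 0 < r ->
  (nu (E `&` eball x r) <= (Cu * 2 `^ Q * r `^ Q)%:E)%E.
Proof. exact: ahlfors_upper_any. Qed.

Local Notation CPmu := (c + fine (mu B)).

Definition value_const := Cm * potential_const Q p theta T CPmu.
Definition grad_const := n%:R `^ p * (M `^ p * Cm ^+ 2) * offdiag_const Q p theta CPmu Cu.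
(** The Lipschitz estimate integrates [nu] over balls centred at points x off [E], which brings in
    the factor 2^Q. *)
Definition lip_const := lipschitz_const N Q Cm (Cu * 2 `^ Q).
(** Absolute values let a single constant dominate all three without a discussion of their signs. *)
Definition extension_const := 1 + `|value_const| + `|grad_const| + `|lip_const|.

(** A Besov function is measurable on [E] only; setting it to 0 elsewhere gives a function
    measurable on the whole space without changing any integral over [E]. *)
Definition extension (u : 'rV[R]_n -> R) := shepard_extend N nu E (u \_ E).
Local Notation S := extension.

Let off_E (Pr : 'rV[R]_n -> Prop) : (forall x, B x -> ~ E x -> Pr x) ->
  {ae m, forall x, B x -> Pr x}.
Proof.
move=> h; exists E; split => //; first exact: lebesgue_ahlfors_null.
by move=> x /= nP; apply: contrapT => nEx; apply: nP => Bx; exact: h.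
Qed.

Let clE : closed E. Proof. by apply: compact_closed cE; exact: norm_hausdorff. Qed.

Lemma extension_linear (a : R) u v : besov nu p theta E u -> besov nu p theta E v ->
  {ae m, forall x, B x -> S (fun y => a * u y + v y) x = a * S u x + S v x}.
Proof.
move=> bu bv; apply: off_E => x Bx nEx; rewrite /S /shepard_extend !asboolF//.
rewrite -sext_linear//; last 3 first.
- exact: away_closed.
- exact: (integrable_patch mE (besov_integrable mE nuoo p1 bu)).
- exact: (integrable_patch mE (besov_integrable mE nuoo p1 bv)).
congr (_ / _); apply: eq_Rintegral => y /set_mem Ey.
by rewrite !patch_in.
Qed.

Lemma extension_ae u v : besov nu p theta E u -> besov nu p theta E v ->
  {ae nu, forall x, E x -> u x = v x} -> {ae m, forall x, B x -> S u x = S v x}.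
Proof.
move=> bu bv uv; apply: off_E => x Bx nEx; rewrite /S /shepard_extend !asboolF//.
have patchm w : besov nu p theta E w -> measurable_fun E (w \_ E).
  by move=> /(besov_measurable mE p1)/(measurable_restrictT _ mE)/measurable_funTS.
apply: eq_sext_ae => //; [exact: patchm|exact: patchm|].
by apply: filterS uv => y h Ey; rewrite !patch_in// h.
Qed.

Lemma extension_const_ge1 : 1 <= extension_const.
Proof. by rewrite /extension_const -!addrA lerDl !addr_ge0. Qed.

Let le_const (k : R) (I : \bar R) : `|k| <= extension_const - 1 -> (0 <= I)%E ->
  (k%:E * I <= extension_const%:E * I)%E.
Proof.
move=> h I0; rewrite lee_wpmul2r// lee_fin.
by rewrite (le_trans (ler_norm _))// (le_trans h)// gerBl.
Qed.

Lemma extension_sobolev u : besov nu p theta E u ->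
  exists gradSu : 'rV[R]_n -> 'rV[R]_n,
  [/\ sobolev_with_gradient mu p B (S u) gradSu,
    (\int[mu]_(x in B) (enorm (gradSu x) `^ p)%:E <=
       extension_const%:E * besov_energy nu p theta E u)%E &
    (\int[mu]_(x in B) (`|S u x| `^ p)%:E <=
       extension_const%:E * \int[nu]_(x in E) (`|u x| `^ p)%:E)%E].
Proof.
move=> bu; set v := u \_ E.
have mv : measurable_fun setT v.
  by apply/(measurable_restrictT _ mE); exact: besov_measurable bu.
have iv : nu.-integrable E (EFin \o v).
  exact: (integrable_patch mE (besov_integrable mE nuoo p1 bu)).
have vp : (\int[nu]_(y in E) (`|v y| `^ p)%:E < +oo)%E.
  by rewrite integral_powR_patch; have [/(Lp_onP _ _ mE p1)[]] := bu.
have vb : (besov_energy nu p theta E v < +oo)%E by rewrite besov_energy_patch; have [] := bu.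
have vp0 : (0 <= \int[nu]_(y in E) (`|v y| `^ p)%:E)%E.
  by apply: integral_ge0 => y _; rewrite lee_fin powR_ge0.
have vb0 : (0 <= besov_energy nu p theta E v)%E.
  apply: integral_ge0 => x _; apply: integral_ge0 => y _.
  by rewrite lee_fin divr_ge0 ?powR_ge0// mulr_ge0 ?powR_ge0 ?fine_ge0.
have oB : open B by exact: open_eball.
have hS : (\int[mu]_(x in B) (`|S u x| `^ p)%:E <=
    value_const%:E * \int[nu]_(y in E) (`|v y| `^ p)%:E)%E.
  exact: (integral_extend cE nuE oB Q0 p1 theta01 Cm0 T0 mass_low BT BET muBoo muCP0 mugrowth muE).
have hG : (\int[mu]_(x in B) (enorm (extend_grad N nu E v x) `^ p)%:E <=
    grad_const%:E * besov_energy nu p theta E v)%E.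
  exact: (integral_extend_grad cE nuE oB Q0 p1 theta01 Mp Cm0 Cu0 mass_low nu_up BT muBoo muCP0
    mugrowth muE).
have fin_mul (k : R) (I : \bar R) : (0 <= I)%E -> (I < +oo)%E -> (k%:E * I < +oo)%E.
  by move=> I0 Ioo; rewrite -[X in (_ * X)%E]fineK ?ge0_fin_numE// -EFinM ltry.
have mg i : measurable_fun setT (fun x => extend_grad N nu E v x 0 i).
  exact: measurable_extend_grad.
exists (extend_grad N nu E v); split.
- split.
  + apply/(Lp_onP _ _ mB p1); split.
      by apply: measurable_funTS; exact: measurable_extend.
    exact: le_lt_trans hS (fin_mul _ _ vp0 vp).
  + exact: (weak_gradient_extend cE nuE oB Q0 p1 theta01 Mp Cm0 Cu0 T0 mass_low nu_up BT BET
      mBoo mCP0 mgrowth lebesgue_ahlfors_null mv iv vp vb).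
  + apply/(Lp_onP _ _ mB p1); split.
      by apply: measurable_funTS; apply: measurable_enorm; exact: measurable_fun_rV.
    under eq_integral do rewrite ger0_norm ?enorm_ge0//.
    exact: le_lt_trans hG (fin_mul _ _ vb0 vb).
- rewrite -besov_energy_patch; apply: (le_trans hG); apply: le_const => //.
  by rewrite /extension_const; have := normr_ge0 value_const; have := normr_ge0 lip_const; lra.
- rewrite -(integral_powR_patch nu E p u); apply: (le_trans hS); apply: le_const => //.
  by rewrite /extension_const; have := normr_ge0 grad_const; have := normr_ge0 lip_const; lra.
Qed.

(** Finite Besov energy is not asked of [u]: a Lipschitz function is bounded and measurable on [E],
    hence integrable there, and the averages are defined. *)
Lemma extension_lipschitz (L : R) u : 0 <= L -> lipschitz_eucl L E u ->
  (forall x, E x -> S u x = u x) /\ lipschitz_eucl (extension_const * L) B (S u).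
Proof.
move=> L0 uL; split; first by move=> x Ex; rewrite /S /shepard_extend asboolT// patch_in.
have vL : lipschitz_eucl L E (u \_ E) by move=> x y Ex Ey; rewrite !patch_in//; exact: uL.
have mu' := lipschitz_measurable mE L0 uL.
have [y0 Ey0] := E0.
have iv : nu.-integrable E (EFin \o (u \_ E)).
  apply: (integrable_patch mE); apply: (@integrable_bounded _ _ _ nu E mE _ (`|u y0| + L * T)) =>
    //.
  move=> x Ex; rewrite -(subrK (u y0) (u x)) (le_trans (ler_normD _ _))// addrC lerD2l.
  rewrite (le_trans (uL _ _ Ex Ey0))// ler_wpM2l// ltW//.
  by apply: BET => //; exact: EB.
have BT' (e : R) x y : 0 < e <= 1 -> B x -> E y -> rdist e x y <= T.
  by move=> /andP[e0 e1]; apply: BT; rewrite ltW.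
have Cu2 : 0 <= Cu * 2 `^ Q by rewrite mulr_ge0 ?powR_ge0 ?ltW.
move=> x y Bx By.
have Bc z w (t : R) : B z -> B w -> 0 <= t <= 1 -> B (z + t *: (w - z)).
  exact: eball_convex.
apply: le_trans (lipschitz_extend cE E0 nuE Q0 MQ Cm0 Cu2 mass_low nu_up_any BT' Bc iv L0 vL Bx
  By) _.
rewrite ler_wpM2r ?enorm_ge0// ler_wpM2r// -/lip_const /extension_const.
have := ler_norm lip_const; have := normr_ge0 value_const; have := normr_ge0 grad_const; lra.
Qed.

Lemma ahlfors_extension :
  exists (C : R) (S : ('rV[R]_n -> R) -> 'rV[R]_n -> R),
  [/\ 1 <= C,
    (forall (a : R) u v, besov nu p theta E u -> besov nu p theta E v ->
      {ae m, forall x, B x -> S (fun y => a * u y + v y) x = a * S u x + S v x}),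
    (forall u v, besov nu p theta E u -> besov nu p theta E v ->
      {ae nu, forall x, E x -> u x = v x} -> {ae m, forall x, B x -> S u x = S v x}),
    (forall u, besov nu p theta E u ->
      exists gradSu : 'rV[R]_n -> 'rV[R]_n,
      [/\ sobolev_with_gradient mu p B (S u) gradSu,
        (\int[mu]_(x in B) (enorm (gradSu x) `^ p)%:E <=
           C%:E * besov_energy nu p theta E u)%E &
        (\int[mu]_(x in B) (`|S u x| `^ p)%:E <=
           C%:E * \int[nu]_(x in E) (`|u x| `^ p)%:E)%E]) &
    (forall (L : R) u, 0 <= L -> lipschitz_eucl L E u ->
      exists Su : 'rV[R]_n -> R,
      [/\ {ae m, forall x, B x -> S u x = Su x},
        forall x, E x -> Su x = u x &
        lipschitz_eucl (C * L) B Su])].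
Proof.
exists extension_const, extension; split.
- exact: extension_const_ge1.
- exact: extension_linear.
- exact: extension_ae.
- exact: extension_sobolev.
- move=> L u L0 uL; have [SE SL] := extension_lipschitz L0 uL.
  by exists (extension u); split => //; exact: off_E.
Qed.

End ahlfors_extension.

Lemma weak_gradient0 (R : realType) (n : nat) (U : set 'rV[R]_n) :
  weak_gradient U (fun=> 0) (fun=> 0).
Proof.
have li : loc_integrable (lebesgue_rV R n) U (fun=> 0).
  by split => // K _ _; rewrite integral0_eq// => x _; rewrite normr0.
split => //.
- move=> i; rewrite (_ : (fun _ => _) = fun=> 0)//.
  by apply/funext => x; rewrite mxE.
- move=> phi _ i; rewrite !integral0_eq ?oppe0// => x _; last by rewrite mul0r.
  by rewrite mxE mul0r.
Qed.

Theorem theorem6p1 (R : realType) (n : nat) (Q p theta alpha : R)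
  (E : set 'rV[R]_n) (x0 : 'rV[R]_n) (r0 : R)
  (mu : {measure set 'rV[R]_n -> \bar R})
  (hQ : 0 < Q < n%:R)
  (hE : compact E)
  (hEreg : ahlfors_regular Q E)
  (hEpt : forall x, E <> [set x])
  (hEdiam : (diam E <= 1%:E)%E)
  (hr0 : 0 < r0)
  (hEB : E `<=` eball x0 (r0 / 2))
  (hp : 1 < p)
  (htheta : 0 < theta < 1)
  (halpha : alpha <= 0)
  (halphaQ : 0 < alpha + n%:R - Q)
  (hthetaalpha : 1 - (alpha + n%:R - Q) / p <= theta)
  (hmu : weighted_lebesgue mu)
  (hmuB : doubling_on mu (eball x0 r0))
  (hmuE : exists2 c : R, 1 <= c & forall x r, E x -> 0 < r <= 10 ->
     ((c^-1 * r `^ (n%:R + alpha))%:E <= mu (eball x r)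
       <= (c * r `^ (n%:R + alpha))%:E)%E) :
  let B := eball x0 r0 in
  let m := lebesgue_rV R n in
  let nu := hausdorff_on Q hE in
  exists (C : R) (S : ('rV[R]_n -> R) -> 'rV[R]_n -> R),
  [/\ 1 <= C,
    (forall (a : R) u v, besov nu p theta E u -> besov nu p theta E v ->
      {ae m, forall x, B x ->
        S (fun y => a * u y + v y) x = a * S u x + S v x}),
    (forall u v, besov nu p theta E u -> besov nu p theta E v ->
      {ae nu, forall x, E x -> u x = v x} ->
      {ae m, forall x, B x -> S u x = S v x}),
    (forall u, besov nu p theta E u ->
      exists gradSu : 'rV[R]_n -> 'rV[R]_n,
      [/\ sobolev_with_gradient mu p B (S u) gradSu,
        (\int[mu]_(x in B) (enorm (gradSu x) `^ p)%:E <=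
           C%:E * besov_energy nu p theta E u)%E &
        (\int[mu]_(x in B) (`|S u x| `^ p)%:E <=
           C%:E * \int[nu]_(x in E) (`|u x| `^ p)%:E)%E]) &
    (forall (L : R) u, 0 <= L -> lipschitz_eucl L E u ->
      exists Su : 'rV[R]_n -> R,
      [/\ {ae m, forall x, B x -> S u x = Su x},
        forall x, E x -> Su x = u x &
        lipschitz_eucl (C * L) B Su])].
Proof.
have [E0 B m nu|E0 B m nu] := pselect (E !=set0).
- have [y Ey] := E0.
  (* Since [E] is nonempty and not a singleton, its diameter is positive and can serve as the scale
     [delta]. *)
  have [z [Ez yz]] : exists z, E z /\ 0 < enorm (y - z).
    apply: contrapT => no; apply: (hEpt y); apply/seteqP; split => [z Ez /=|z ->//].
    apply/eqP; rewrite eq_sym -subr_eq0 -normr_le0.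
    apply: (le_trans (ler_norm_enorm _)); rewrite leNgt; apply/negP => yz.
    by apply: no; exists z.
  have [Creg Creg1 reg] := hEreg.
  have dE := diam_ub Ey Ez.
  have dfin : diam E \is a fin_num.
    by rewrite ge0_fin_numE ?diam_ge0// (le_lt_trans hEdiam) ?ltry.
  have hd : 0 < fine (diam E) <= 1.
    rewrite -lte_fin -lee_fin fineK// hEdiam andbT.
    by apply: lt_le_trans dE; rewrite lte_fin.
  have Creg0 : 0 < Creg by apply: lt_le_trans Creg1.
  have nuR A : nu A = nu (E `&` A).
    by rewrite /nu /hausdorff_on /= /mrestr (setIC E A) -setIA setIid.
  have regE w (r : R) : E w -> 0 < r <= fine (diam E) ->
      ((Creg^-1 * r `^ Q)%:E <= nu (E `&` eball w r) <= (Creg * r `^ Q)%:E)%E.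
    move=> Ew /andP[r1 rd].
    rewrite /nu /hausdorff_on /= /mrestr setIAC setIid.
    by apply: reg => //; rewrite -(fineK dfin) lee_fin.
  have [c c1 hmuE'] := hmuE.
  have mu_up w (r : R) : E w -> 0 < r <= 1 ->
      (mu (eball w r) <= (c * r `^ (n%:R + alpha))%:E)%E.
    move=> Ew /andP[r1 rle]; have r10 : 0 < r <= 10 by rewrite r1; lra.
    by have /andP[] := hmuE' w r Ew r10.
  have c0 : 0 <= c by apply: le_trans c1.
  (* The choice of N already exceeds p + 2Q by itself, so 2N does as well. *)
  have Mp : p + 2 * Q <= (2 * (Num.truncn (p + 2 * Q)).+1)%:R.
    by rewrite ltW// (lt_le_trans (truncnS_gt _))// ler_nat leq_pmull.
  exact: (ahlfors_extension hQ hE E0 hd Creg0 regE nuR hr0 hEB hp htheta halpha hthetaalpha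
    hmu Mp c0 mu_up).
(* For empty [E] the zero operator works with C = 1: the right-hand sides are nonnegative and the
   extension condition is vacuous. *)
have E_empty w : ~ E w by move=> Ew; apply: E0; exists w.
have p0 : p != 0 by rewrite gt_eqF//; lra.
have pow0 : 0 `^ p = 0 :> R by rewrite powR0.
exists 1, (fun _ _ => 0); split => //.
- by move=> a u v _ _; apply: aeW => x _; rewrite mulr0 addr0.
- by move=> u v _ _ _; apply: aeW.
- move=> u _.
  have mB : measurable B by exact: measurable_eball.
  have z1 : (\int[mu]_(x in B) (`|0 : R| `^ p)%:E = 0)%E.
    by rewrite integral0_eq// => x _; rewrite normr0 pow0.
  have z2 : (\int[mu]_(x in B) (enorm (0 : 'rV[R]_n) `^ p)%:E = 0)%E.
    by rewrite integral0_eq// => x _; rewrite enorm0 pow0.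
  exists (fun=> 0); split.
  + split; [| |].
    * by apply/(Lp_onP _ _ mB hp); rewrite z1.
    * exact: weak_gradient0.
    * apply/(Lp_onP _ _ mB hp); split => //.
      by rewrite integral0_eq// => x _; rewrite enorm0 normr0 pow0.
  + rewrite z2; apply: mule_ge0 => //; apply: integral_ge0 => x Ex.
    by case: (E_empty x).
  + rewrite z1; apply: mule_ge0 => //; apply: integral_ge0 => x _.
    by rewrite lee_fin powR_ge0.
- move=> L u L0 _; exists (fun=> 0); split => //.
  + exact: aeW.
  + by move=> x /E_empty.
  + by move=> x y _ _; rewrite subrr normr0 mul1r mulr_ge0 ?enorm_ge0.
Qed.
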